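(* There is a $W^*$-bundle $(M,\mathbb{E},K)$ over a compact metrizable space $K$ such that each fiber $M_p$ ($p\in K$) is a $\mathrm{II}_1$-factor with separable predual, and such that the following holds: given any $n\in\mathbb{N}$ and any $a_1,\dots,a_n\in M$, there is a $p\in K$ (depending upon $a_1,\dots,a_n$) so that $a_{1,p},\dots,a_{n,p}$ do not generate $M_p$ as a von Neumann algebra.
   Context: A $W^*$-bundle is a triple $(M,\mathbb{E},K)$ where $K$ is a compact Hausdorff space, $M$ is a unital $C^*$-algebra containing a unital copy of $C(K)$ in its center $Z(M)$, and $\mathbb{E}\colon M\to C(K)$ is a faithful conditional expectation which is tracial ($\mathbb{E}(xy)=\mathbb{E}(yx)$ for all $x,y\in M$), such that the closed operator-norm unit ball of $M$ is complete under the norm $\|x\|_{\mathbb{E}}=\|\mathbb{E}(x^*x)\|^{1/2}$. For $p\in K$, $\tau_p(x)=\mathbb{E}(x)(p)$ is a tracial state on $M$; $\pi_p$ is its GNS representation, $M_p=\pi_p(M)$ (the fiber at $p$; it is a von Neumann algebra, with faithful normal trace induced by $\tau_p$), and $x_p=\pi_p(x)$ for $x\in M$. Elements of $M$ are regarded as continuous sections $p\mapsto x_p$. *)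

(* Defs.v *)
(* Built on MathComp-Analysis, with the complex numbers [R[i]] of
   mathcomp-real-closed. *)
From HB Require Import structures.
From mathcomp Require Import all_boot all_order all_algebra.
From mathcomp Require Import all_classical all_reals all_analysis.
From mathcomp Require Import complex.

Set Implicit Arguments.
Unset Strict Implicit.
Unset Printing Implicit Defensive.

Import Order.TTheory GRing.Theory Num.Theory.
Import numFieldNormedType.Exports.

Local Open Scope classical_set_scope.
Local Open Scope ring_scope.

(* mathcomp-real-closed puts no topology on [R[i]]; this is the one given by
   the modulus. *)
HB.instance Definition _ (R : realType) :=
  NormedModule.copy R[i] (R[i] : numFieldType)^o.

(* [N] is meant to be a seminorm on [V]. *)
Definition seq_complete (R : realType) (V : zmodType) (N : V -> R) (B : set V) :=
  forall u : nat -> V, (forall n, B (u n)) ->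
    (forall e : R, 0 < e ->
       exists n0, forall m n, (n0 <= m)%N -> (n0 <= n)%N -> N (u m - u n) < e) ->
    exists2 x, B x & (fun n => N (u n - x)) @ \oo --> (0 : R).

(* The norm is a separate real-valued field because the hierarchies of MathComp
   have no join of [algType] and [normedModType]. *)
Record cstarAlg (R : realType) := CStarAlg {
  cs_sort :> algType R[i];
  cs_norm : cs_sort -> R;
  star : cs_sort -> cs_sort;
  cs_norm_eq0 : forall x, cs_norm x = 0 -> x = 0;
  cs_normD : forall x y, cs_norm (x + y) <= cs_norm x + cs_norm y;
  cs_normZ : forall (a : R[i]) x, cs_norm (a *: x) = complex.Re `|a| * cs_norm x;
  cs_normM : forall x y, cs_norm (x * y) <= cs_norm x * cs_norm y;
  cs_complete : seq_complete cs_norm [set: cs_sort];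
  starK : involutive star;
  starD : forall x y, star (x + y) = star x + star y;
  starZ : forall (a : R[i]) x, star (a *: x) = (a^*) *: star x;
  starM : forall x y, star (x * y) = star y * star x;
  cs_normE : forall x, cs_norm (star x * x) = cs_norm x ^+ 2
}.

(* Elements of [C(K)] are the functions [f : K -> R[i]] with [continuous f],
   with the pointwise operations of the function space [K -> R[i]].  The values
   of [wb_incl] on discontinuous functions are irrelevant; its injectivity on
   [C(K)] follows from [wb_exp_incl]. *)
Record wstarBundle (R : realType) (K : topologicalType) := WStarBundle {
  wb_alg :> cstarAlg R;
  wb_compact : compact [set: K];
  wb_hausdorff : hausdorff_space K;
  wb_incl : (K -> R[i]) -> wb_alg;
  wb_incl_lin : forall (a : R[i]) (f g : K -> R[i]), continuous f -> continuous g ->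
    wb_incl (a *: f + g) = a *: wb_incl f + wb_incl g;
  wb_inclM : forall f g : K -> R[i], continuous f -> continuous g ->
    wb_incl (f * g) = wb_incl f * wb_incl g;
  wb_incl1 : wb_incl (fun=> 1) = 1;
  wb_incl_star : forall f : K -> R[i], continuous f ->
    wb_incl (fun p => (f p)^*) = star (wb_incl f);
  wb_incl_central : forall f : K -> R[i], continuous f ->
    forall x : wb_alg, wb_incl f * x = x * wb_incl f;
  wb_exp : wb_alg -> K -> R[i];
  wb_exp_continuous : forall x, continuous (wb_exp x);
  wb_exp_lin : forall (a : R[i]) (x y : wb_alg),
    wb_exp (a *: x + y) = a *: wb_exp x + wb_exp y;
  wb_exp_incl : forall f : K -> R[i], continuous f -> wb_exp (wb_incl f) = f;
  wb_exp_module : forall f : K -> R[i], continuous f ->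
    forall x : wb_alg, wb_exp (wb_incl f * x) = f * wb_exp x;
  wb_exp_ge0 : forall (x : wb_alg) p, 0 <= wb_exp (star x * x) p;
  wb_exp_faithful : forall x : wb_alg, wb_exp (star x * x) = (fun=> 0) -> x = 0;
  wb_exp_tracial : forall x y : wb_alg, wb_exp (x * y) = wb_exp (y * x);
  wb_ball_complete :
    seq_complete
      (fun x : wb_alg =>
         Num.sqrt (sup (range (fun p : K => complex.Re `|wb_exp (star x * x) p|))))
      [set x : wb_alg | cs_norm x <= 1]
}.

Definition wb_trace (R : realType) (K : topologicalType) (M : wstarBundle R K)
  (p : K) (x : M) : R[i] := wb_exp x p.

(* The inner product is linear in its first argument. *)
HB.mixin Record isHilbert (R : realType) H & CompleteNormedModule R[i] H := {
  inner : H -> H -> R[i];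
  innerDl : forall x y z : H, inner (x + y) z = inner x z + inner y z;
  innerZl : forall (a : R[i]) (x y : H), inner (a *: x) y = a * inner x y;
  inner_conj : forall x y : H, inner y x = (inner x y)^*;
  innerxx : forall x : H, inner x x = `|x| ^+ 2
}.

#[short(type="hilbertType")]
HB.structure Definition Hilbert (R : realType) :=
  {H of CompleteNormedModule R[i] H & isHilbert R H}.

Section Operators.
Variables (R : realType) (H : hilbertType R).
Implicit Types (T S P Q V W : H -> H) (A : set (H -> H)).

Definition bounded_op T := linear T /\ continuous T.

Definition adjoint_op T S := forall x y, inner (T x) y = inner x (S y).

(* Adherence for the weak operator topology: the finite families of pairs of
   vectors index its basic neighbourhoods. *)
Definition wot_adherent A T :=
  forall (F : seq (H * H)) (e : R[i]), 0 < e ->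
    exists2 S, A S & forall xy, xy \in F -> `|inner (T xy.1 - S xy.1) xy.2| < e.

Record von_neumann_algebra A : Prop := VonNeumannAlgebra {
  vna_bounded : A `<=` bounded_op;
  vna_id : A idfun;
  vna_lin : forall (a : R[i]) T S, A T -> A S -> A (fun x => a *: T x + S x);
  vna_comp : forall T S, A T -> A S -> A (T \o S);
  vna_adjoint : forall T, A T -> exists2 S, A S & adjoint_op T S;
  vna_closed : forall T, bounded_op T -> wot_adherent A T -> A T
}.

(* The von Neumann algebra in [B(H)] generated by a set of operators. *)
Definition vna_generated (X : set (H -> H)) := smallest von_neumann_algebra X.

Definition projection A P := [/\ A P, P \o P = P & adjoint_op P P].

(* Murray-von Neumann equivalence relative to [A]. *)
Definition mvn_equiv A P Q :=
  exists V W, [/\ A V, A W, adjoint_op V W, W \o V = P & V \o W = Q].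

Definition finite_projection A P := projection A P /\
  forall Q, projection A Q -> P \o Q = Q -> mvn_equiv A P Q -> Q = P.

Definition abelian_projection A P := projection A P /\
  forall S T, A S -> A T ->
    (P \o S \o P) \o (P \o T \o P) = (P \o T \o P) \o (P \o S \o P).

Definition factor A := [/\ von_neumann_algebra A,
  exists x : H, x != 0 &
  forall T, A T -> (forall S, A S -> T \o S = S \o T) ->
    exists a : R[i], T = (fun x => a *: x)].

Definition II1_factor A := [/\ factor A,
  finite_projection A idfun &
  forall P, abelian_projection A P -> P = (fun=> 0)].

(* The predual of [A] consists of the ultraweakly continuous functionals on
   [A], that is, of the sums of [T |-> inner (T (xi k)) (eta k)] with [xi] and
   [eta] square-summable.  Only the values of [phi] on [A] matter. *)
Definition in_predual A (phi : (H -> H) -> R[i]) :=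
  exists xi eta : nat -> H,
    [/\ cvgn (series (fun k => `|xi k| ^+ 2)),
        cvgn (series (fun k => `|eta k| ^+ 2)) &
        forall T, A T ->
          series (fun k => inner (T (xi k)) (eta k)) @ \oo --> phi T].

(* Separability is for the norm of functionals on [A], the supremum over the
   operators of norm at most 1. *)
Definition separable_predual A :=
  exists2 f : nat -> ((H -> H) -> R[i]), (forall k, in_predual A (f k)) &
    forall phi, in_predual A phi -> forall e : R[i], 0 < e ->
      exists k, forall T, A T -> (forall x, `|T x| <= `|x|) ->
        `|phi T - f k T| <= e.

End Operators.

(* The GNS construction: [gns_space] is the Hilbert space completion of the
   quotient of [M] by the null vectors of [(x, y) |-> tau (star y * x)], given
   with the canonical map [gns_vec] of [M] onto a dense subspace. *)
Record gns (R : realType) (M : cstarAlg R) (tau : M -> R[i]) := GNS {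
  gns_space : hilbertType R;
  gns_vec : M -> gns_space;
  gns_vec_linear : linear gns_vec;
  gns_inner : forall x y, inner (gns_vec x) (gns_vec y) = tau (star y * x);
  gns_dense : dense (range gns_vec);
  gns_rep : M -> gns_space -> gns_space;
  gns_rep_bounded : forall x, bounded_op (gns_rep x);
  gns_repE : forall x y, gns_rep x (gns_vec y) = gns_vec (x * y)
}.

Arguments gns_vec {R M tau} g _.
Arguments gns_rep {R M tau} g _ _.

(* Elements of the fiber at [p] are operators on the GNS space of the trace at
   [p]. *)
Definition fiber (R : realType) (K : topologicalType) (M : wstarBundle R K)
    (p : K) (G : gns (@wb_trace R K M p)) : set (gns_space G -> gns_space G) :=
  range (gns_rep G).
Arguments fiber {R K M p} G _.

(* Main.v *)
(* Let [Xset d] be the product over k of the l1-unit spheres of R^(d k + 1); the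
   group G = (Z/2)^N acts on it by flipping the signs of the factors, and K is
   the quotient.  Twisting the translations of l2(nat), nat being the group of
   finite subsets of N, by the Pauli cocycle gives left and right translations;
   the commutant [CR] of the right ones is the hyperfinite II_1 factor, and G
   acts on it, a sign vector e multiplying the coefficient at S by the product
   of the e_k, k in S.  The bundle consists of the continuous sections of the
   bundle over K with fiber [CR] associated to [Xset d] -> K.

   The coefficient at S of a section is a function on [Xset d] changing sign
   under the flip of the k-th sphere exactly when k is in S.  Given n sections,
   the S with maximum k provide 2n 2^k real functions, at most d k of them when
   k >= n and d k = k 2^(k+1).  By a Borsuk-Ulam theorem for products of spheres
   and by compactness, the coefficients at all S not contained in {0, ..., n-1}
   have a common zero.  At the corresponding point of K, the n operators commute
   with the left translation by {2n}, which is not central in the fiber. *)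
Require Import Defs.
From HB Require Import structures.
From Stdlib Require Import PeanoNat.
From mathcomp Require Import all_boot all_order all_algebra.
From mathcomp Require Import all_classical all_reals all_analysis.
From mathcomp Require Import complex.
From mathcomp Require Import lra ring.

Set Implicit Arguments.
Unset Strict Implicit.
Unset Printing Implicit Defensive.

Import Order.TTheory GRing.Theory Num.Theory.
Import numFieldNormedType.Exports.

Local Open Scope classical_set_scope.
Local Open Scope ring_scope.

(** The bundle is fixed before the number of sections, and no fixed [d k] can control all
    coefficients at level [k] for every [n]. The levels below [n] are therefore given up: operators
    whose coefficients survive only there still commute with a noncentral unitary.

    A coefficient at S is odd in every sphere indexed by S, not just in the last one. In the mod 2
    cohomology of a product of projective spaces its class is x_k plus some x_j with j < k. Ordered
    by level, the product of these classes has a leading monomial with exponent at most [d k] in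
    each x_k, hence does not vanish. This triangular form of Borsuk-Ulam is proved with cochains on
    words of arbitrary points, without triangulations.

    Continuity of sections is required only in the norm of the trace. Uniform boundedness upgrades
    it to strong continuity, whence products; the trace makes the adjoint isometric, whence stars.
    That every fiber is all of [CR], and not merely weakly dense in it, needs a section through each
    given operator; Schur multipliers by odd functions supply it. *)

Local Notation "x %:C" := (real_complex _ x) (format "x %:C").
Local Notation re := (@complex.Re _).
Local Notation im := (@complex.Im _).

(** * Cochains and a Borsuk-Ulam theorem for products of spheres *)

Section Cochains.
Variable X : Type.
Implicit Types (F G b : seq X -> bool) (s r : seq X) (l : X -> bool).

(* Functions [seq X -> bool] are mod 2 cochains on the simplicial set of words
   over [X]; [cob] is the coboundary, [prism] the homotopy between the maps
   induced by [h0] and [h1]. *)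
Fixpoint cob b s : bool :=
  if s is v :: s' then b s' (+) cob (fun r => b (v :: r)) s' else false.

Fixpoint prism (h0 h1 : X -> X) F s : bool :=
  if s is v :: s' then
    F (h0 v :: h1 v :: map h1 s') (+) prism h0 h1 (fun r => F (h0 v :: r)) s'
  else false.

Definition mulhead l F s : bool := if s is v :: _ then l v && F s else false.

(* Read as 0-cochains, equivariant labels are trivializations of characters of
   the group of flips; [cup] represents the product of the characters. *)
Fixpoint cup (L : seq (X -> bool)) : seq X -> bool :=
  if L is l :: L' then cob (mulhead l (cup L')) else fun s => size s == 1%N.

Lemma cobD b b' s : cob (fun r => b r (+) b' r) s = cob b s (+) cob b' s.
Proof.
elim: s b b' => [//|v s IHs] b b' /=.
by rewrite IHs addbACA.
Qed.

Lemma cob0 s : cob (fun=> false) s = false.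
Proof. by elim: s. Qed.

Lemma cobM c b s : cob (fun r => c && b r) s = c && cob b s.
Proof. by case: c => //=; rewrite cob0. Qed.

Lemma cobK b s : cob (cob b) s = false.
Proof.
elim: s b => [//|v s IHs] b /=.
by rewrite cobD IHs addbF addbb.
Qed.

Lemma prismD h0 h1 F G s :
  prism h0 h1 (fun r => F r (+) G r) s = prism h0 h1 F s (+) prism h0 h1 G s.
Proof.
elim: s F G => [//|v s IHs] F G /=.
by rewrite IHs addbACA.
Qed.

Lemma cob_map (f : X -> X) b s : cob b (map f s) = cob (fun r => b (map f r)) s.
Proof. by elim: s b => [//|v s IHs] b /=; rewrite IHs. Qed.

(** The chain homotopy formula mod 2: deleting one of the two middle letters of a prism word gives a
    telescoping sum, and every other deletion occurs once in each summand. *)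
Lemma cob_prism h0 h1 b s :
  prism h0 h1 (cob b) s (+) cob (prism h0 h1 b) s = b (map h1 s) (+) b (map h0 s).
Proof.
elim: s b => [|v s IHs] b /=; first by rewrite addbb.
rewrite prismD cobD.
have := IHs (fun r => b (h0 v :: r)); rewrite cob_map /=.
move: (prism _ _ _ s) (cob (fun r => prism _ _ _ r) s) (prism _ _ _ s).
move: (cob _ s) (b _) (b _) (b _).
by do 7!case.
Qed.

Lemma prism_map (h0 h1 f : X -> X) : (forall x, h0 (f x) = f (h0 x)) ->
  (forall x, h1 (f x) = f (h1 x)) ->
  forall F s, prism h0 h1 F (map f s) = prism h0 h1 (fun r => F (map f r)) s.
Proof.
move=> h0f h1f F s; elim: s F => [//|v s IHs] F /=.
rewrite IHs !h0f !h1f; congr (F (_ :: _ :: _) (+) _).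
by rewrite -!map_comp; apply: eq_map => x /=; rewrite h1f.
Qed.

End Cochains.

Section CochainSupport.
Variable X : Type.
Implicit Types (F G b : seq X -> bool) (s r : seq X) (l : X -> bool).
Import List.

Lemma eq_cob_in F G s : (forall r, incl r s -> F r = G r) -> cob F s = cob G s.
Proof.
elim: s F G => [//|v s IHs] F G FG /=; rewrite FG; last exact/incl_tl/incl_refl.
congr (_ (+) _); apply: IHs => r rs; apply: FG.
by apply: incl_cons; [left|apply: incl_tl].
Qed.

Lemma prism_eq0 (h0 h1 : X -> X) F s :
  (forall r, (forall x, In x r -> exists2 v, In v s & x = h0 v \/ x = h1 v) ->
     F r = false) -> prism h0 h1 F s = false.
Proof.
elim: s F => [//|v s IHs] F F0 /=; rewrite F0 ?IHs//.
- move=> r rP; apply: F0 => x /= [<-|/rP[w ws xw]]; first by exists v; auto.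
  by exists w; auto.
- move=> x /= [<-|[<-|]]; [by exists v; auto|by exists v; auto|].
  by rewrite in_map_iff => -[w [<- ws]]; exists w; auto.
Qed.

(** Where a label is the constant [c], multiplying by it commutes with [cob]; since the product of
    the remaining labels is a cocycle, the result is zero. A product that vanishes on all subwords
    stays zero under further labels. *)
Lemma cup_const L l s c : In l L -> (forall v, In v s -> l v = c) ->
  cup L s = false.
Proof.
elim: L s => [//|l' L IHL] s /= [->|lL] lc; last first.
  rewrite (@eq_cob_in _ (fun=> false)) ?cob0// => r rs.
  by case: r rs => [//|v r] rs /=; rewrite IHL ?andbF// => w wr; apply/lc/rs.
rewrite (@eq_cob_in _ (fun r => c && cup L r)); last first.
  move=> [|v r] rs /=; last by rewrite lc//; apply: rs; left.
  by case: (L) => [|? ?]; rewrite /= andbF.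
rewrite cobM; case: L {IHL} => [|l0 L] /=; last by rewrite cobK andbF.
case: s {lc} => [|v [|w [|z s]]] //=; rewrite ?andbF//=.
by rewrite cob0 andbF.
Qed.

End CochainSupport.

(** * The fundamental chain of a product of spheres and its pairing with labels *)

Section Transfer.
Variables (X : Type) (x0 : X) (N : nat).
Variables (fl : nat -> X -> X) (h : nat -> nat -> nat -> X -> X).
Hypothesis flK : forall k x, fl k (fl k x) = x.
Hypothesis fl_h : forall j k q t x, j != k -> h k q t (fl j x) = fl j (h k q t x).
Hypothesis flC : forall j k x, fl j (fl k x) = fl k (fl j x).
(* [h k q t], for [t] from 0 to [N], moves the [k]-th factor to its [q]-th pole. *)
Hypothesis h0 : forall k q x, h k q 0 x = x.
Hypothesis hN : forall k q x, h k q N (fl k x) = h k q N x.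
Implicit Types (F b : seq X -> bool) (s : seq X) (l : X -> bool) (w : seq nat).

Definition prisms k q F s :=
  \big[addb/false]_(t < N) prism (h k q t) (h k q t.+1) F s.

(** On chains: a hemisphere and its flip form a sphere, and the cone over this sphere is the
    hemisphere one dimension higher. *)
Definition transfer k q F s := prisms k q F s (+) prisms k q F (map (fl k) s).

(* Evaluation on a fundamental chain of a product of spheres, built by iterated
   suspension: a hemisphere is the cone over the sphere of one dimension less,
   and a sphere is a hemisphere plus its flip.  The number of occurrences of [k]
   in [w'] is the dimension of the sphere reached so far in the [k]-th factor. *)
Fixpoint fund w F : bool :=
  if w is k :: w' then fund w' (transfer k (count_mem k w').+1 F) else F [:: x0].

Lemma eq_fund w F b : F =1 b -> fund w F = fund w b.
Proof. by move=> Fb; rewrite (funext Fb). Qed.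

Lemma cob_big n (f : nat -> seq X -> bool) s :
  cob (fun r => \big[addb/false]_(t < n) f t r) s =
  \big[addb/false]_(t < n) cob (f t) s.
Proof.
elim: n => [|n IHn].
  by rewrite big_ord0 -[RHS](cob0 s); congr cob; apply/funext => r; rewrite big_ord0.
rewrite big_ord_recr /= -IHn -cobD; congr cob.
by apply/funext => r; rewrite big_ord_recr.
Qed.

Lemma cob_prisms k q b s :
  prisms k q (cob b) s (+) cob (prisms k q b) s = b (map (h k q N) s) (+) b s.
Proof.
rewrite (cob_big _ (fun t => prism (h k q t) (h k q t.+1) b)) -big_split /=.
under eq_bigr do rewrite cob_prism.
elim: N => [|n IHn]; rewrite ?big_ord0 ?big_ord_recr ?IHn /=.
  by rewrite (eq_map (h0 k q)) map_id addbb.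
by case: (b s); do 2!case: (b _).
Qed.

(** Such a cochain descends to the quotient by the flips from [k] on. The clause on the empty word
    is there because [cob] is the augmented coboundary. *)
Definition invariant_from k b :=
  (forall j s, (k <= j)%N -> b (map (fl j) s) = b s) /\ b [::] = false.

(** At the last stage [hN] identifies a word with its flip, so the far ends of the two homotopies
    cancel mod 2 and only the near ends remain. *)
Lemma cob_transfer k q b s :
  transfer k q (cob b) s = cob (transfer k q b) s (+) (b s (+) b (map (fl k) s)).
Proof.
rewrite /transfer cobD -(cob_map (fl k) (prisms k q b)).
have := cob_prisms k q b s; have := cob_prisms k q b (map (fl k) s).
rewrite -[X in b X (+) _]map_comp (eq_map (hN k q)).
move: (prisms _ _ _ _) (cob _ _) (b _) (b _) (prisms _ _ _ _) (cob _ _) (b _).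
by do 7!case.
Qed.

Lemma map_flK k s : map (fl k) (map (fl k) s) = s.
Proof. by rewrite -map_comp (eq_map (flK k)) map_id. Qed.

Lemma map_flC j k s : map (fl k) (map (fl j) s) = map (fl j) (map (fl k) s).
Proof. by rewrite -!map_comp; apply: eq_map => x /=. Qed.

Lemma prisms_fl j k q F s : j != k ->
  prisms k q F (map (fl j) s) = prisms k q (fun r => F (map (fl j) r)) s.
Proof. by move=> jk; apply: eq_bigr => t _; rewrite prism_map// => x; rewrite fl_h. Qed.

(** Invariance under the flip of [k] comes from the symmetrization; the later flips commute with the
    homotopies of the [k]-th factor. *)
Lemma transfer_invariant k q b :
  (forall j s, (k < j)%N -> b (map (fl j) s) = b s) ->
  invariant_from k (transfer k q b).
Proof.
move=> bj; split => [j s kj|]; last first.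
  by rewrite /transfer /prisms/= big1 ?addbb.
rewrite /transfer; have [->|jk] := eqVneq j k; first by rewrite map_flK addbC.
have {}kj : (k < j)%N by rewrite ltn_neqAle eq_sym jk.
rewrite map_flC !(prisms_fl _ _ _ jk).
by have -> : (fun r => b (map (fl j) r)) = b by apply/funext => r; rewrite bj.
Qed.

(** Stokes' formula: the chain is a fundamental domain for the flips, closed only up to terms that
    an invariant cochain does not see. *)
Lemma fund_cob k w b : all (leq k) w -> invariant_from k b ->
  fund w (cob b) = false.
Proof.
elim: w b => [|j w IHw] b /=; first by move=> _ [_ ->].
move=> /andP[kj kw] [bi b0].
rewrite (@eq_fund _ _ (cob (transfer j (count_mem j w).+1 b))); last first.
  by move=> s; rewrite cob_transfer bi// addbb addbF.
apply: IHw => //; have [|tj t0] := @transfer_invariant j (count_mem j w).+1 b.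
  by move=> i s ji; apply: bi; exact: leq_trans kj (ltnW ji).
split => // i s ki; rewrite /transfer.
have [<-|ij] := eqVneq i j; first by rewrite map_flK addbC.
rewrite map_flC !(prisms_fl _ _ _ ij).
by have -> : (fun r => b (map (fl i) r)) = b by apply/funext => r; rewrite bi.
Qed.

(* [kl] is a label together with the last factor on which its sign depends. *)
Definition odd_label (kl : nat * (X -> bool)) :=
  [/\ forall j, exists e, forall x, kl.2 (fl j x) = kl.2 x (+) e,
      forall x, kl.2 (fl kl.1 x) = ~~ kl.2 x &
      forall j x, (kl.1 < j)%N -> kl.2 (fl j x) = kl.2 x].

(** A flip changes a label by a constant [e], and so the product by [e] times the coboundary of a
    cocycle. *)
Lemma cup_fl (L : seq (nat * (X -> bool))) j s :
  (forall kl, List.In kl L -> odd_label kl) ->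
  cup (map snd L) (map (fl j) s) = cup (map snd L) s.
Proof.
elim: L s => [|kl L IHL] s LP /=; first by rewrite size_map.
have [/(_ j)[e le] _ _] := LP kl (or_introl erefl).
have {}IHL r : cup (map snd L) (map (fl j) r) = cup (map snd L) r.
  by apply: IHL => k kL; apply: LP; right.
rewrite cob_map (_ : (fun r => _) = fun r => mulhead kl.2 (cup (map snd L)) r (+)
    (e && (if r is _ :: _ then cup (map snd L) r else false))); last first.
  apply/funext => -[|v r] /=; first by rewrite andbF.
  have := IHL (v :: r); rewrite /= => ->; rewrite le.
  by case: (cup _ _); case: e {le}; case: (kl.2 v).
rewrite cobD cobM [X in e && X](_ : _ = false) ?andbF ?addbF//.
case: L {LP IHL} => [|l0 L]; last first.
  rewrite -[RHS](cobK (mulhead l0.2 (cup (map snd L))) s).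
  by congr cob; apply/funext; case.
by case: s => [|v [|w [|z s]]] //=; rewrite cob0.
Qed.

(** Induction on the labels, removing the first, whose factor [k] is the smallest. As [l] is odd
    under the flip of [k], the sum of [mulhead l (cup L)] and its flip is [cup L]. The other term is
    the coboundary of a cochain invariant from [k] on, which [fund_cob] kills because sorting makes
    all remaining factors at least [k]. *)
Theorem fund_cup (L : seq (nat * (X -> bool))) :
  (forall kl, List.In kl L -> odd_label kl) -> sorted leq (map fst L) ->
  fund (map fst L) (cup (map snd L)) = true.
Proof.
elim: L => [//|[k l] L IHL] LP; rewrite [map fst _]/= [map snd _]/= => kL.
have {IHL} : fund (map fst L) (cup (map snd L)) = true.
  apply: IHL; last exact: path_sorted kL.
  by move=> kl klL; apply: LP; right.
have {}kL : all (leq k) (map fst L) by exact: order_path_min leq_trans kL.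
have [_ /= lk lj] := LP _ (or_introl erefl).
have {}LP kl : List.In kl L -> odd_label kl by move=> klL; apply: LP; right.
move=> <- /=; set b := mulhead l (cup (map snd L)); set q := _.+1.
have bj j s : (k < j)%N -> b (map (fl j) s) = b s.
  case: s => [//|v s] kj; rewrite /b/= (lj _ _ kj); congr (_ && _).
  exact: (cup_fl j (v :: s)).
rewrite (@eq_fund _ _ (fun s => cob (transfer k q b) s (+) cup (map snd L) s)).
  rewrite (_ : fund _ _ = fund (map fst L) (cob (transfer k q b)) (+)
                        fund (map fst L) (cup (map snd L))).
    by rewrite (fund_cob kL) ?addFb//; exact: transfer_invariant.
  move: (cob _) (cup _) => F G; elim: (map fst L) F G => [//|j w IHw] F G /=.
  rewrite -IHw; apply: eq_fund => s; rewrite /transfer addbACA.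
  by congr (_ (+) _); rewrite -big_split; apply: eq_bigr => t _; rewrite prismD.
move=> s; rewrite cob_transfer; congr (_ (+) _).
case: s => [|v s]; first by case: (L).
have := cup_fl k (v :: s) LP; rewrite /b /= => ->.
by rewrite (lk v); case: (l v); case: (cup _ _).
Qed.

Section Support.

Variable Q : seq nat -> seq X -> Prop.
Hypothesis Q0 : Q [::] [:: x0].
Hypothesis Q_fl : forall w k s, Q w s -> Q w (map (fl k) s).
Hypothesis Q_h : forall k w s r t, Q w s -> (t < N)%N ->
  (forall x, List.In x r -> exists2 v, List.In v s &
     x = h k (count_mem k w).+1 t v \/ x = h k (count_mem k w).+1 t.+1 v) ->
  Q (k :: w) r.

(** [Q w] is meant to hold for all words that occur in the fundamental chain of [w]; the hypotheses
    on [Q] follow the construction of that chain. *)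
Lemma fund_supp w F : (forall s, Q w s -> F s = false) -> fund w F = false.
Proof.
elim: w F => [|k w IHw] F QF /=; first exact: QF.
apply: IHw => s Qs; rewrite /transfer.
suff P0 r : Q w r -> prisms k (count_mem k w).+1 F r = false.
  by rewrite !P0//; exact: Q_fl.
move=> Qr; rewrite /prisms big1// => t _.
by apply: prism_eq0 => r' r'P; apply: QF; apply: Q_h r'P.
Qed.

End Support.
End Transfer.

(** * Products of l1-spheres, with flips and pushes towards poles *)

Section Spheres.
Variables (R : realType) (d : nat -> nat).
Notation pt := (nat -> nat -> R).
Implicit Types (x y : pt) (k q i j : nat).

Definition Xset x := forall k, \sum_(i < (d k).+1) `|x k i| = 1 /\
  forall i, (d k < i)%N -> x k i = 0.

Definition flip k x : pt := fun j i => if j == k then - x j i else x j i.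

Definition push k q (t : R) x : pt :=
  fun j i => if j == k then (1 - t) * x j i + t * (i == q)%:R else x j i.

Lemma Xset_flip k x : Xset x -> Xset (flip k x).
Proof.
move=> Xx j; have [x1 x0] := Xx j; rewrite /flip; have [jk|//] := eqVneq j k.
split => [|i /x0 ->]; last exact: oppr0.
by rewrite -[RHS]x1; apply: eq_bigr => i _; rewrite normrN.
Qed.

(** The l1-norm is additive on disjoint supports, so the segment to a pole outside the support of
    the row stays in the sphere without renormalization. *)
Lemma Xset_push k q (t : R) x : 0 <= t <= 1 -> (q <= d k)%N -> x k q = 0 -> Xset x ->
  Xset (push k q t x).
Proof.
move=> /andP[t0 t1] qd xq Xx j; have [x1 x0] := Xx j.
rewrite /push; have [jk|//] := eqVneq j k; subst j; split => [|i di]; last first.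
  by rewrite x0// mulr0 add0r gtn_eqF ?mulr0//; exact: leq_ltn_trans di.
rewrite (eq_bigr (fun i : 'I__ => (1 - t) * `|x k i| + t * (i == q :> nat)%:R)).
  rewrite big_split /= -!mulr_sumr x1 mulr1 (bigD1 (inord q)) //= inordK//.
  rewrite eqxx big1 ?addr0 ?mulr1 ?subrK// => i iq.
  by rewrite -(inj_eq val_inj) /= inordK// in iq; rewrite (negPf iq).
move=> i _; have [->|iq] := eqVneq (i : nat) q.
  by rewrite xq normr0 !mulr0 !add0r mulr1 ger0_norm.
by rewrite !mulr0 !addr0 normrM ger0_norm// subr_ge0.
Qed.

Lemma Xset_le1 x k i : Xset x -> `|x k i| <= 1.
Proof.
move=> Xx; have [x1 x0] := Xx k; have [/x0 ->|id] := ltnP (d k) i.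
  by rewrite normr0.
rewrite -x1 (bigD1 (inord i)) //= inordK// lerDl sumr_ge0//.
Qed.

Section Filling.
Variable N : nat.
Hypothesis N0 : (0 < N)%N.
(* The second component provides a sign at the zeros of a function. *)
Notation spt := (pt * (nat -> bool))%type.

Definition sflip k (z : spt) : spt :=
  (flip k z.1, fun j => if j == k then ~~ z.2 j else z.2 j).

(** The flag of the [k]-th factor is erased as soon as [t] is nonzero: stage 0 has to be the
    identity, and stage [N] has to forget the flip. *)
Definition spush k q (t : nat) (z : spt) : spt :=
  (push k q (t%:R / N%:R) z.1,
   fun j => if (j == k) && (t != 0%N) then false else z.2 j).

Lemma sflipK k z : sflip k (sflip k z) = z.
Proof.
case: z => x e; rewrite /sflip/flip/=; congr pair; apply/funext => j.
  by apply/funext => i; case: eqP => // _; rewrite opprK.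
by case: eqP => // _; rewrite negbK.
Qed.

Lemma sflipC j k z : sflip j (sflip k z) = sflip k (sflip j z).
Proof.
case: z => x e; rewrite /sflip/flip/=; congr pair; apply/funext => l.
  by apply/funext => i; do 2!case: eqP.
by do 2!case: eqP.
Qed.

Lemma sflip_push j k q t z : j != k -> spush k q t (sflip j z) = sflip j (spush k q t z).
Proof.
move=> jk; case: z => x e; rewrite /sflip/flip/spush/push/=.
congr pair; apply/funext => l; [apply/funext => i|].
  by case: (eqVneq l k) => [->|//]; rewrite [k == j]eq_sym (negPf jk).
by case: (eqVneq l k) => [->|//]; rewrite [k == j]eq_sym (negPf jk).
Qed.

Lemma spush0 k q z : spush k q 0 z = z.
Proof.
case: z => x e; rewrite /spush/push/= mul0r; congr pair; apply/funext => j.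
  by apply/funext => i; rewrite subr0 mul1r mul0r addr0; case: ifP.
by rewrite andbF.
Qed.

Lemma spushN k q z : spush k q N (sflip k z) = spush k q N z.
Proof.
case: z => x e; rewrite /spush/push/sflip/flip/= divff ?pnatr_eq0 -?lt0n//.
congr pair; apply/funext => j; [apply/funext => i|].
  by case: eqP => // _; rewrite subrr !mul0r.
by rewrite N0 andbT; case: eqP.
Qed.

Definition base : spt := (fun k i => (i == 0%N)%:R, fun=> false).

(** The bound on the supports keeps the next pole, [(count_mem k w).+1], off the support of the row,
    as [Xset_push] requires. Each suspension adds at most [1 / N] to the diameter. *)
Definition small_in (w : seq nat) (s : seq spt) :=
  (forall z, List.In z s -> Xset z.1 /\
     forall k i, (count_mem k w < i)%N -> z.1 k i = 0) /\
  (forall z z', List.In z s -> List.In z' s ->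
     forall k i, `|z.1 k i - z'.1 k i| <= (size w)%:R / N%:R).

(** The bound by [d] is a premise because [fund_supp] takes a predicate on all [w], whereas pushes
    beyond [d k] leave [Xset]. *)
Definition small_if (w : seq nat) s := (forall k, (count_mem k w <= d k)%N) -> small_in w s.

Lemma small_base : small_if [::] [:: base].
Proof.
move=> _; split => [z [<-|//]|z z' [<-|//] [<-|//]] /=.
  split => [k|k i]; last by case: i.
  split => [|[]//]; rewrite big_ord_recl big1 ?normr1 ?addr0//= => i _.
  exact: normr0.
by move=> k i; rewrite subrr normr0 mul0r.
Qed.

Lemma small_flip w k s : small_if w s -> small_if w (map (sflip k) s).
Proof.
move=> ws wd; have [sX ss] := ws wd; split.
  move=> z /List.in_map_iff[z' [<- /sX[Xz zw]]]; split; first exact: Xset_flip.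
  by move=> j i /zw /= ji; rewrite /flip ji oppr0 if_same.
move=> _ _ /List.in_map_iff[z [<- zs]] /List.in_map_iff[z' [<- z's]] j i.
rewrite /= /flip; case: eqP => _; last exact: ss.
by rewrite -opprD normrN; exact: ss.
Qed.

Lemma small_push k w s r t : small_if w s -> (t < N)%N ->
  (forall z, List.In z r -> exists2 v, List.In v s &
     z = spush k (count_mem k w).+1 t v \/ z = spush k (count_mem k w).+1 t.+1 v) ->
  small_if (k :: w) r.
Proof.
move=> ws tN rs wd; have wk := wd k; rewrite /= eqxx add1n in wk.
have {wd} /ws[sX ss] j : (count_mem j w <= d j)%N.
  by apply: leq_trans (wd j); rewrite /= leq_addl.
have N0' : 0 < N%:R :> R by rewrite ltr0n.
have tle u : (u <= N)%N -> 0 <= (u%:R / N%:R : R) <= 1.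
  by move=> uN; rewrite divr_ge0//= ler_pdivrMr// mul1r ler_nat.
have {}rs z : List.In z r -> exists v u, [/\ List.In v s,
    z = spush k (count_mem k w).+1 u v & (t <= u <= t.+1)%N].
  by move=> /rs[v vs [->|->]]; [exists v, t|exists v, t.+1]; rewrite ?leqnn ?leqnSn.
split => [z /rs[v [u [vs -> /andP[tu ut]]]]|z z' /rs[v [u [vs -> /andP[tu ut]]]]].
  have [Xv vw] := sX v vs; split.
    by apply: Xset_push => //; [apply: tle; exact: leq_trans ut tN|exact: vw].
  move=> j i; rewrite /= /push; have [->|jk] := eqVneq j k.
    rewrite add1n => ki; rewrite (gtn_eqF ki) mulr0 addr0 vw ?mulr0//.
    exact: ltn_trans ki.
  by rewrite add0n => /vw.
move=> /rs[v' [u' [v's -> /andP[tu' ut']]]] j i.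
have le_s : (size w)%:R / N%:R <= (size (k :: w))%:R / N%:R :> R.
  by rewrite ler_pM2r ?invr_gt0// ler_nat.
rewrite /= /push; case: eqP => [->|_]; last exact: le_trans (ss _ _ vs v's _ _) le_s.
have /andP[u0 u1] := tle u (leq_trans ut tN).
have uu : `|u%:R / N%:R - u'%:R / N%:R| <= 1 / N%:R :> R.
  rewrite -mulrBl normrM (@ger0_norm _ N%:R^-1) ?invr_ge0// ler_pM2r ?invr_gt0//.
  move: tu ut tu' ut'; rewrite -!(ler_nat R) -!natr1 ler_norml => *.
  by apply/andP; split; lra.
have [Xv vw] := sX v vs; have [Xv' vw'] := sX v' v's.
(* At the new pole both rows vanish before the push, so only the two times are compared. In the
   other columns the difference splits into a contracted old difference and a change of time. *)
have [->|iq] := eqVneq i (count_mem k w).+1.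
  rewrite !vw// !vw'// !mulr0 !add0r !mulr1; apply: le_trans uu _.
  by rewrite ler_pM2r ?invr_gt0// ler1n.
rewrite !mulr0 !addr0.
set a := u%:R / _ in u0 u1 uu *; set a' := u'%:R / _ in uu *.
rewrite (_ : _ - _ = (1 - a) * (v.1 k i - v'.1 k i) + (a' - a) * v'.1 k i); last by ring.
apply: le_trans (ler_normD _ _) _; rewrite !normrM /= -natr1 mulrDl.
apply: lerD; last first.
  apply: le_trans (ler_wpM2l (normr_ge0 _) (Xset_le1 k i Xv')) _.
  by rewrite mulr1 distrC.
rewrite ger0_norm ?subr_ge0//; apply: le_trans (ss _ _ vs v's k i).
by rewrite ler_piMl// gerBl.
Qed.

(* The product of the labels does not vanish on the fundamental chain, all of
   whose simplices are small, but it vanishes wherever a label is constant. *)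
Theorem exists_small (L : seq (nat * (spt -> bool))) :
  (forall kl, List.In kl L -> odd_label sflip kl) -> sorted leq (map fst L) ->
  (forall k, (count_mem k (map fst L) <= d k)%N) ->
  exists s : seq spt, [/\ forall z, List.In z s -> Xset z.1,
     forall z z', List.In z s -> List.In z' s ->
       forall k i, `|z.1 k i - z'.1 k i| <= (size L)%:R / N%:R &
     forall kl c, List.In kl L -> ~ forall z, List.In z s -> kl.2 z = c].
Proof.
move=> LP Ls Ld.
have fE := fund_cup base sflipK sflip_push sflipC spush0 spushN LP Ls.
apply: contrapT => /forallNP nex; move: fE.
rewrite (fund_supp small_base small_flip small_push)// => s /(_ Ld) [sX ss].
apply/negbTE/negP => cs; apply: (nex s); split.
- by move=> z /sX[].
- by move=> z z' zs z's k i; rewrite -(size_map fst); exact: ss.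
- move=> kl c klL zc; move: cs; rewrite (@cup_const _ _ kl.2 s c)//.
  exact: List.in_map.
Qed.

End Filling.
End Spheres.

(** * Compactness of the product of spheres and the common zero *)

Section Compactness.
Variables (R : realType) (d : nat -> nat).
Notation pt := (nat -> nat -> R).
Implicit Types (x y : pt).
Import ArrowAsProduct.

Let coord_continuous i : continuous (fun u : nat -> R => u i).
Proof. exact: (@proj_continuous nat (fun=> R) i). Qed.

Let norm1_continuous n : continuous (fun u : nat -> R => \sum_(i < n) `|u i|).
Proof.
have c i : continuous (fun u : nat -> R => `|u i|).
  move=> u; apply: (@continuous_comp _ _ _ (fun u : nat -> R => u i) (fun z : R => `|z|));
        [exact: coord_continuous|exact: (@norm_continuous _ R)].
elim: n => [|n IHn].
  rewrite (_ : (fun u => _) = fun=> 0); first exact: cst_continuous.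
  by apply/funext => u; rewrite big_ord0.
rewrite (_ : (fun u : nat -> R => _) = (fun u : nat -> R => \sum_(i < n) `|u i| + `|u n|)).
  move=> u; exact: (@cvgD R R _ (nbhs u) _ (fun u : nat -> R => \sum_(i < n) `|u i|)
    (fun u : nat -> R => `|u n|) _ _ (IHn u) (c n u)).
by apply/funext => u; rewrite big_ord_recr.
Qed.

Let row_compact k : compact [set u : nat -> R |
  \sum_(i < (d k).+1) `|u i| = 1 /\ forall i, (d k < i)%N -> u i = 0].
Proof.
apply: (@subclosed_compact _ _ [set u : nat -> R | forall i, `[-1, 1]%classic (u i)]).
- rewrite (_ : mkset _ =
    ((fun u : nat -> R => \sum_(i < (d k).+1) `|u i|) @^-1` [set 1]) `&`
    (\bigcap_(i in [set i | (d k < i)%N]) ((fun u : nat -> R => u i) @^-1` [set 0]))).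
    apply: closedI.
      apply: closed_comp; last exact: closed_eq.
      by move=> u _; exact: norm1_continuous.
    apply: closed_bigI => i _; apply: closed_comp; last exact: closed_eq.
    by move=> u _; exact: coord_continuous.
  by apply/seteqP; split => u [u1 u0]; split => // i /u0.
- exact: (@tychonoff nat (fun=> R) (fun=> `[-1, 1]%classic) (fun=> @segment_compact _ _ _)).
- move=> u [u1 u0] i; rewrite /= in_itv/= -ler_norml.
  have [/u0 ->|id] := ltnP (d k) i; first by rewrite normr0.
  by rewrite -u1 (bigD1 (inord i)) //= inordK// lerDl sumr_ge0.
Qed.

(** All columns of finitely many rows are compared. Within [Xset] this is a condition on finitely
    many coordinates, since the columns beyond [d k] vanish. *)
Definition near_pt (M : nat) (e : R) x y :=
  forall k i, (k < M)%N -> `|x k i - y k i| < e.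

Lemma nbhs_near M e x : 0 < e -> nbhs x [set y : pt |
  forall k : 'I_M, forall i : 'I_(d k).+1, `|x k i - y k i| < e].
Proof.
move=> e0.
refine (@filter_forall _ _ (fun (k : 'I_M) (y : pt) =>
  forall i : 'I_(d k).+1, `|x k i - y k i| < e) (nbhs x) (nbhs_filter x) _) => k.
refine (@filter_forall _ _ (fun (i : 'I_(d k).+1) (y : pt) => `|x k i - y k i| < e)
  (nbhs x) (nbhs_filter x) _) => i.
have /cvgrPdist_lt/(_ e e0) : (fun y : pt => y k i) @ x --> x k i => //.
apply: (@continuous_comp _ _ _ (fun y : pt => y k) (fun v : nat -> R => v i)).
  exact: (@proj_continuous nat (fun=> (nat -> R)%type) k).
exact: coord_continuous.
Qed.

Lemma near_ptP M e x y : 0 < e -> Xset d x -> Xset d y ->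
  (forall (k : 'I_M) (i : 'I_(d k).+1), `|x k i - y k i| < e) -> near_pt M e x y.
Proof.
move=> e0 Xx Xy xy k i kM; have [di|id] := ltnP (d k) i; last first.
  by rewrite -ltnS in id; exact: (xy (Ordinal kM) (Ordinal id)).
by rewrite (Xx k).2// (Xy k).2// subrr normr0.
Qed.

Lemma Xset_compact : compact (Xset d : set pt).
Proof. exact: (@tychonoff nat (fun=> (nat -> R)%type) _ row_compact). Qed.

Lemma Xset_cluster (u : nat -> pt) : (forall n, Xset d (u n)) ->
  exists2 x, Xset d x & forall M e n0, 0 < e ->
    exists2 n, (n0 <= n)%N & near_pt M e x (u n).
Proof.
move=> Xu; have := Xset_compact.
move=> /(_ (u n @[n --> \oo]) _)[|x [Xx xu]]; first by exists 0%N => // n _; exact: (Xu n).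
exists x => // M e n0 e0; have Bx := nbhs_near M x e0.
have un0 : (u n @[n --> \oo]) [set u n | n in [set n | (n0 <= n)%N]].
  by exists n0 => // n /= n0n; exists n.
have [_ [[n n0n <-] Bu]] := xu _ _ un0 Bx.
by exists n => //; exact: near_ptP.
Qed.

(** Continuity on [Xset] with explicit moduli and an arbitrary distance, so that real-valued and
    l2-valued functions are treated alike. *)
Definition row_continuous_at (V : Type) (dist : V -> V -> R) (g : pt -> V) x :=
  forall e, 0 < e -> exists M, exists2 del, 0 < del &
    forall y, Xset d y -> near_pt M del x y -> dist (g x) (g y) < e.

Lemma near_ptW M M' e e' x y : (M' <= M)%N -> e <= e' ->
  near_pt M e x y -> near_pt M' e' x y.
Proof. by move=> MM ee xy k i kM; apply: lt_le_trans (xy _ _ (leq_trans kM MM)) ee. Qed.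

Section Zero.
Variable I : Type.
Variables (lev : I -> nat) (sig : I -> nat -> bool) (g : I -> pt -> R).
Hypothesis g_cont : forall i x, Xset d x ->
  row_continuous_at (fun a b => `|a - b|) (g i) x.
Hypothesis g_flip : forall i j x, Xset d x ->
  g i (flip j x) = (-1) ^+ sig i j * g i x.
Hypothesis sig_lev : forall i, sig i (lev i).
Hypothesis sig_gt : forall i j, (lev i < j)%N -> sig i j = false.

(** At a zero of [g i], or outside [Xset], the sign is replaced by a parity of flags that changes
    under flips in the same way. Thus [odd_label] holds at every point. *)
Let lab i (z : pt * (nat -> bool)) :=
  if `[< Xset d z.1 >] && (g i z.1 != 0) then g i z.1 < 0
  else \big[addb/false]_(j < (lev i).+1) (sig i j && z.2 j).

Let sum_flip i j (e : nat -> bool) :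
  \big[addb/false]_(l < (lev i).+1) (sig i l && (if l == j :> nat then ~~ e l else e l)) =
  \big[addb/false]_(l < (lev i).+1) (sig i l && e l) (+) sig i j.
Proof.
transitivity (\big[addb/false]_(l < (lev i).+1)
    ((sig i l && e l) (+) (sig i l && (l == j :> nat)))).
  by apply: eq_bigr => l _; case: eqP; case: (sig i l); case: (e l).
rewrite big_split /=; congr (_ (+) _); have [ij|ji] := ltnP (lev i) j.
  rewrite sig_gt// big1// => l _; rewrite ltn_eqF ?andbF//.
  exact: leq_ltn_trans (leq_ord l) ij.
rewrite (bigD1 (inord j)) //= inordK ?ltnS// eqxx andbT big1 ?addbF// => l.
by rewrite -(inj_eq val_inj) /= inordK ?ltnS// => /negPf ->; rewrite andbF.
Qed.

Let lab_flip i j z : lab i (sflip j z) = lab i z (+) sig i j.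
Proof.
have XE : `[< Xset d (flip j z.1) >] = `[< Xset d z.1 >].
  apply: asbool_equiv_eq; split => [/(Xset_flip j)|]; last exact: Xset_flip.
  by rewrite -[flip j (flip j _)]/(sflip j (sflip j z)).1 sflipK.
rewrite /lab /= XE; case: asboolP => /= [Xz|_]; last exact: sum_flip.
rewrite g_flip// mulf_eq0 signr_eq0 /=.
have [g0|g0] := eqVneq (g i z.1) 0; first exact: sum_flip.
case: (sig i j); last by rewrite mul1r addbF.
by rewrite expr1 mulN1r oppr_lt0 addbT lt_neqAle eq_sym g0 leNgt.
Qed.

(* Arbitrarily small simplices on which the sign of no [g i] is constant
   accumulate at a common zero. *)
Theorem common_zero (L : seq I) : sorted leq (map lev L) ->
  (forall k, (count_mem k (map lev L) <= d k)%N) ->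
  exists2 x, Xset d x & forall i, List.In i L -> g i x = 0.
Proof.
move=> Ls Ld; pose L' := [seq (lev i, lab i) | i <- L].
have L'1 : map fst L' = map lev L by rewrite -map_comp.
have L'P kl : List.In kl L' -> odd_label (@sflip R) kl.
  move=> /List.in_map_iff[i [<- iL]]; split => [j|z|j z ij] /=.
  - by exists (sig i j) => z; exact: lab_flip.
  - by rewrite lab_flip sig_lev addbT.
  - by rewrite lab_flip sig_gt// addbF.
have [s sP] : {s : nat -> seq (pt * (nat -> bool)) & forall n,
    [/\ forall z, List.In z (s n) -> Xset d z.1,
     forall z z', List.In z (s n) -> List.In z' (s n) ->
       forall k i, `|z.1 k i - z'.1 k i| <= (size L')%:R / n.+1%:R &
     forall kl c, List.In kl L' -> ~ forall z, List.In z (s n) -> kl.2 z = c]}.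
  apply: (@choice _ _ (fun n s => [/\ forall z, List.In z s -> Xset d z.1,
     forall z z', List.In z s -> List.In z' s ->
       forall k i, `|z.1 k i - z'.1 k i| <= (size L')%:R / n.+1%:R &
     forall kl c, List.In kl L' -> ~ forall z, List.In z s -> kl.2 z = c])).
  by move=> n; apply: exists_small => //; rewrite L'1.
pose u n := (head (base R) (s n)).1.
have [->|L0] : L = [::] \/ exists i, List.In i L.
  by case: (L) => [|i ?]; [left|right; exists i; left].
  exists (base R).1 => //.
  by have [/(_ (base R)) []//] := @small_base R d 1 (fun=> leq0n _); left.
(* On an empty word every label would be constant, so the words are nonempty. *)
have s0 n : List.In (head (base R) (s n)) (s n).
  have [i iL] := L0; have [_ _ /(_ (lev i, lab i) true)] := sP n.
  case: (s n) => [|z t]; last by left.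
  by move=> H; exfalso; apply: H => //; apply/List.in_map_iff; exists i.
have uX n : Xset d (u n) by have [+ _ _] := sP n; exact.
have [x Xx ux] := Xset_cluster uX; exists x => // i iL.
apply/eqP/negPn/negP => gx0.
have [|M [e e0 gM]] := @g_cont i x Xx `|g i x|; first by rewrite normr_gt0.
pose n0 := Num.truncn ((size L')%:R / (e / 2)).
have [n nn0 xn] := ux M (e / 2) n0 ltac:(by rewrite divr_gt0).
have small : (size L')%:R / n.+1%:R < e / 2.
  rewrite ltr_pdivrMr ?ltr0n// mulrC -ltr_pdivrMr ?divr_gt0//.
  by rewrite -truncn_le_nat.
have [sX ss /(_ (lev i, lab i) (g i x < 0))] := sP n.
apply; first by apply/List.in_map_iff; exists i.
move=> z zs /=; have Xz := sX z zs.
have xz : near_pt M e x z.1.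
  move=> k l kM; rewrite -(subrKA (u n k l)) (le_lt_trans (ler_normD _ _))//.
  rewrite [ltRHS]splitr ltrD ?xn//; apply: le_lt_trans small.
  exact: ss (s0 n) zs _ _.
have := gM _ Xz xz; rewrite /lab asboolT//=.
case: (ltgtP (g i x) 0) gx0 => //= gx _.
  rewrite (ltr0_norm gx) ltr_norml => /andP[h1 h2].
  by have h : g i z.1 < 0 by [lra]; rewrite lt_eqF.
rewrite (gtr0_norm gx) ltr_norml => /andP[h1 h2].
by have h : g i z.1 > 0 by [lra]; rewrite gt_eqF//= lt_gtF.
Qed.

End Zero.
End Compactness.

(** * The space of orbits *)

Section Signs.
Variables (R : realType) (d : nat -> nat).
Notation pt := (nat -> nat -> R).
Implicit Types (x y : pt) (k : nat) (s : nat -> bool).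

Definition act s x : pt := fun k i => (-1) ^+ s k * x k i.

Fixpoint last_sign (u : nat -> R) n :=
  if u n != 0 then u n < 0 else if n is n'.+1 then last_sign u n' else false.

Definition sg x k := last_sign (x k) (d k).

Lemma Xset_act s x : Xset d x -> Xset d (act s x).
Proof.
move=> Xx k; have [x1 x0] := Xx k; split => [|i di]; last by rewrite /act x0// mulr0.
by rewrite -x1; apply: eq_bigr => i _; rewrite normrM normr_sign mul1r.
Qed.

Lemma actK s : involutive (act s).
Proof. by move=> x; apply/funext => k; apply/funext => i; rewrite /act signrMK. Qed.

Lemma act_comp s s' x : act s (act s' x) = act (fun k => s k (+) s' k) x.
Proof. by apply/funext => k; apply/funext => i; rewrite /act signr_addb mulrA. Qed.

Lemma act0 x : act (fun=> false) x = x.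
Proof. by apply/funext => k; apply/funext => i; rewrite /act mul1r. Qed.

Lemma flip_act k x : flip k x = act (fun j => j == k) x.
Proof.
apply/funext => j; apply/funext => i; rewrite /flip /act.
by case: eqP; rewrite ?mul1r ?expr1 ?mulN1r.
Qed.

Lemma Xset_neq0 x k : Xset d x -> exists2 i, (i <= d k)%N & x k i != 0.
Proof.
move=> /(_ k)[x1 _]; apply: contrapT => /forall2NP x0.
have : (0 : R) <> 1 by apply/eqP; rewrite eq_sym oner_neq0.
apply; rewrite -x1 big1// => i _; have [|/negP] := x0 i; first by rewrite -ltnS ltn_ord.
by rewrite negbK => /eqP ->; rewrite normr0.
Qed.

Lemma sg_act s x k : Xset d x -> sg (act s x) k = sg x k (+) s k.
Proof.
move=> /(Xset_neq0 k)[i id xi].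
rewrite /sg /act; case: (s k) => /=; last first.
  by rewrite addbF; congr last_sign; apply/funext => j; rewrite mul1r.
rewrite addbT; elim: (d k) id => [|n IHn] /=; rewrite expr1 mulN1r oppr_eq0.
  by rewrite leqn0 => /eqP i0; rewrite -i0 xi oppr_lt0 lt_neqAle eq_sym xi leNgt.
have [xn|xn _] := eqVneq (x k n.+1) 0; last by rewrite oppr_lt0 lt_neqAle eq_sym xn leNgt.
by rewrite leq_eqVlt => /orP[/eqP ii|/IHn//]; move: xi; rewrite ii xn eqxx.
Qed.

(* An orbit is represented by its element whose rows all have a positive last
   nonzero entry. *)
Record orbit_rep := OrbitRep {
  orep :> pt;
  orep_in : Xset d orep;
  sg_orep : forall k, sg orep k = false
}.

Lemma orep_inj (p q : orbit_rep) : (p : pt) = q -> p = q.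
Proof.
case: p q => [x Xx sx] [y Xy sy] /= xy; subst y.
by congr OrbitRep; exact: Prop_irrelevance.
Qed.

HB.instance Definition _ := gen_eqMixin orbit_rep.
HB.instance Definition _ := gen_choiceMixin orbit_rep.

Lemma Xset_base : Xset d (base R).1.
Proof. by have [/(_ (base R)) []//] := @small_base R d 1 (fun=> leq0n _); left. Qed.

(* The value is junk outside [Xset]. *)
Definition orep_of (x : pt) : orbit_rep :=
  match pselect (Xset d x) with
  | left Xx => OrbitRep (Xset_act (sg x) Xx)
      (fun k => etrans (sg_act (sg x) k Xx) (addbb _))
  | right _ => OrbitRep (Xset_act (sg (base R).1) Xset_base)
      (fun k => etrans (sg_act (sg (base R).1) k Xset_base) (addbb _))
  end.

Lemma orep_ofE x : Xset d x -> (orep_of x : pt) = act (sg x) x.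
Proof. by rewrite /orep_of; case: pselect. Qed.

Lemma orep_of_act s (p : orbit_rep) : orep_of (act s p) = p.
Proof.
apply: orep_inj; rewrite orep_ofE; last exact/Xset_act/orep_in.
rewrite act_comp -[RHS]act0; congr act; apply/funext => k.
by rewrite sg_act ?sg_orep ?addbb//; exact: orep_in.
Qed.

Lemma orep_of_orep (p : orbit_rep) : orep_of p = p.
Proof. by rewrite -[p in orep_of p]act0 orep_of_act. Qed.

Lemma act_orep_of x : Xset d x -> act (sg x) (orep_of x) = x.
Proof. by move=> Xx; rewrite orep_ofE// actK. Qed.

Definition rdist k x y := \sum_(i < (d k).+1) `|x k i - y k i|.

(** Rows can be flipped independently of each other, so the distance of orbits can be minimized row
    by row, with two choices in each. *)
Definition odist k x y := Num.min (rdist k x y) (rdist k x (act (fun=> true) y)).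

Lemma rdist_ge0 k x y : 0 <= rdist k x y.
Proof. exact: sumr_ge0. Qed.

Lemma rdist_act s k x y : rdist k (act s x) (act s y) = rdist k x y.
Proof.
by apply: eq_bigr => i _; rewrite /act -mulrBr normrM normr_sign mul1r.
Qed.

Lemma rdistC k x y : rdist k x y = rdist k y x.
Proof. by apply: eq_bigr => i _; rewrite distrC. Qed.

Lemma rdistD k x y z : rdist k x z <= rdist k x y + rdist k y z.
Proof. by rewrite -big_split; apply: ler_sum => i _; exact: ler_distD. Qed.

Lemma eq_rdist k x s s' y : s k = s' k -> rdist k x (act s y) = rdist k x (act s' y).
Proof. by move=> ss; apply: eq_bigr => i _; rewrite /act ss. Qed.

Lemma odistP k x y : exists b, odist k x y = rdist k x (act (fun=> b) y).
Proof.
rewrite /odist minEle; case: ifP => _; [exists false|by exists true].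
by rewrite act0.
Qed.

Lemma odist_le k x y s : odist k x y <= rdist k x (act s y).
Proof.
case sk: (s k); rewrite ge_min; apply/orP; [right|left].
  by rewrite (@eq_rdist k x _ s y).
by rewrite -[X in rdist k x X <= _]act0 (@eq_rdist k x _ s y).
Qed.

Lemma odist_ge0 k x y : 0 <= odist k x y.
Proof. by have [b ->] := odistP k x y; exact: rdist_ge0. Qed.

Lemma odistC k x y : odist k x y = odist k y x.
Proof.
suff le u v : odist k u v <= odist k v u by apply/eqP; rewrite eq_le !le.
have [b ->] := odistP k v u; rewrite -(rdist_act (fun=> b)) actK rdistC.
exact: odist_le.
Qed.

Lemma odistD k x y z : odist k x z <= odist k x y + odist k y z.
Proof.
have [b ->] := odistP k x y; have [c ->] := odistP k y z.
apply: le_trans (odist_le k x z (fun=> b (+) c)) _.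
rewrite -(rdist_act (fun=> b) k y) act_comp.
exact: rdistD.
Qed.

Lemma odist_le2 k x y : Xset d x -> Xset d y -> odist k x y <= 2.
Proof.
move=> /(_ k)[x1 _] /(_ k)[y1 _].
apply: le_trans (odist_le k x y (fun=> false)) _; rewrite act0.
rewrite (_ : 2 = \sum_(i < (d k).+1) (`|x k i| + `|y k i|)); last first.
  by rewrite big_split /= x1 y1.
by apply: ler_sum => i _; exact: ler_normB.
Qed.

Definition orbit_dist (p q : orbit_rep) : R :=
  sup (range (fun k => 2^-1 ^+ k * odist k p q)).

Lemma exp2V_ge0 k : 0 <= 2^-1 ^+ k :> R.
Proof. by rewrite exprn_ge0// invr_ge0. Qed.

Lemma exp2V_le1 k : 2^-1 ^+ k <= 1 :> R.
Proof. by rewrite exprn_ile1 ?invr_ge0// invf_le1// ler1n. Qed.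

Lemma orbit_dist_ub (p q : orbit_rep) k : 2^-1 ^+ k * odist k p q <= orbit_dist p q.
Proof.
apply: ub_le_sup; last by exists k.
exists 2 => _ [j _ <-]; rewrite -[leRHS]mul1r ler_pM ?odist_ge0 ?exp2V_le1//.
by apply: odist_le2; exact: orep_in.
Qed.

Lemma orbit_dist_le (p q : orbit_rep) c : (forall k, 2^-1 ^+ k * odist k p q <= c) ->
  orbit_dist p q <= c.
Proof.
move=> kc; apply: ge_sup => [|_ [k _ <-]//].
by exists (2^-1 ^+ 0 * odist 0 p q), 0%N.
Qed.

Lemma orbit_distxx p : orbit_dist p p = 0.
Proof.
have p0 k : 2^-1 ^+ k * odist k p p = 0.
  apply/eqP; rewrite mulf_eq0; apply/orP; right; rewrite eq_le odist_ge0 andbT.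
  apply: le_trans (odist_le k p p (fun=> false)) _; rewrite act0.
  by rewrite /rdist big1// => i _; rewrite subrr normr0.
apply/eqP; rewrite eq_le -{2}(p0 0%N) orbit_dist_ub andbT.
by apply: orbit_dist_le => k; rewrite p0.
Qed.

Lemma orbit_dist_eq0 p q : orbit_dist p q = 0 -> p = q.
Proof.
move=> pq; have pq0 k : odist k p q = 0.
  apply/eqP; rewrite eq_le odist_ge0 andbT.
  by have := orbit_dist_ub p q k; rewrite pq pmulr_rle0// exprn_gt0// invr_gt0.
have [s sP] : {s : nat -> bool & forall k, odist k p q = rdist k p (act (fun=> s k) q)}.
  exact: (@choice _ _ (fun k b => odist k p q = rdist k p (act (fun=> b) q))
    (fun k => odistP k p q)).
have pqE : (p : pt) = act s q.
  apply/funext => k; apply/funext => i; have [di|id] := ltnP (d k) i.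
    by rewrite /act (orep_in p k).2// (orep_in q k).2// mulr0.
  have /esym/eqP := pq0 k; rewrite sP (@eq_rdist k p _ s)// eq_sym psumr_eq0//.
  by rewrite -ltnS in id; move=> /allP/(_ (Ordinal id) (mem_index_enum _)) /=;
    rewrite normr_eq0 subr_eq0 => /eqP.
by rewrite -(orep_of_orep p) pqE orep_of_act.
Qed.

Lemma orbit_distC p q : orbit_dist p q = orbit_dist q p.
Proof. by congr sup; apply: eq_imagel => k _ /=; rewrite odistC. Qed.

Lemma orbit_distD q p r : orbit_dist p r <= orbit_dist p q + orbit_dist q r.
Proof.
apply: orbit_dist_le => k.
apply: le_trans (ler_wpM2l (exp2V_ge0 k) (odistD k p q r)) _.
by rewrite mulrDr lerD ?orbit_dist_ub.
Qed.

HB.instance Definition _ := isMetric.Build R orbit_rep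
  orbit_distxx orbit_dist_eq0 orbit_distC orbit_distD.

(** Continuity of the projection to orbits. The rows from [M] on contribute at most [2^-1 ^+ M * 2],
    as l1-spheres have diameter at most 2; the rows before [M] have [C] coordinates in all. *)
Lemma orbit_dist_lt e : 0 < e -> exists M, exists2 del, 0 < del &
  forall x y, Xset d x -> Xset d y -> near_pt M del x y ->
    mdist (orep_of x) (orep_of y) < e.
Proof.
move=> e0; have e20 : 0 < e / 2 by rewrite divr_gt0.
have [M M2] : exists M, 2^-1 ^+ M * 2 < e / 2 :> R.
  have [M _ /(_ M (leqnn M))] : \forall n \near \oo, 2^-1 ^+ n < e / 4 :> R.
    have /cvgrPdist_lt/(_ (e / 4)) : (fun n => 2^-1 ^+ n : R) @ \oo --> (0 : R).
      by apply: cvg_expr; rewrite ger0_norm ?invr_ge0// invf_lt1// ltr1n.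
    move=> /(_ ltac:(by rewrite divr_gt0)); apply: filterS => n.
    by rewrite sub0r normrN ger0_norm// exp2V_ge0.
  by exists M; lra.
pose C := (\sum_(k < M) (d k).+1)%N.
exists M, (e / 2 / (C.+1)%:R); first by rewrite divr_gt0.
move=> x y Xx Xy xy; apply: le_lt_trans (_ : _ <= e / 2) _; last first.
  by rewrite ltr_pdivrMr// ltr_pMr// ltr1n.
apply: orbit_dist_le => k; have [kM|Mk] := ltnP k M; last first.
  apply: ltW; apply: le_lt_trans M2; apply: ler_pM; rewrite ?exp2V_ge0 ?odist_ge0//.
    by rewrite ler_wiXn2l ?invr_ge0// invf_le1// ler1n.
  by apply: odist_le2; exact: orep_in.
rewrite -[leRHS]mul1r ler_pM ?exp2V_ge0 ?exp2V_le1 ?odist_ge0//.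
apply: le_trans (odist_le k _ _ (fun k => sg x k (+) sg y k)) _.
rewrite !orep_ofE// -(rdist_act (sg x) k (act _ x)) actK !act_comp.
rewrite (_ : act _ y = y); last first.
  rewrite -[RHS]act0; congr act; apply/funext => j.
  by case: (sg x j); case: (sg y j).
apply: (@le_trans _ _ (\sum_(i < (d k).+1) e / 2 / C.+1%:R)).
  by apply: ler_sum => i _; exact/ltW/xy.
rewrite sumr_const card_ord -[_ *+ _]mulr_natr -mulrA ger_pMr// mulrC ler_pdivrMr// mul1r.
rewrite ler_nat /C (bigD1 (Ordinal kM)) //=; exact: leqW (leq_addr _ _).
Qed.

(** Representatives jump where the last nonzero entry of a row vanishes; nearby orbits have nearby
    representatives only after a sign change [s]. *)
Lemma near_orbit (p : orbit_rep) M e : 0 < e -> exists2 del, 0 < del &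
  forall q : orbit_rep, mdist p q < del -> exists s, near_pt M e p (act s q).
Proof.
move=> e0; exists (2^-1 ^+ M * e); first by rewrite mulr_gt0// exprn_gt0// invr_gt0.
move=> q pq.
have [s sP] : {s : nat -> bool & forall k, odist k p q = rdist k p (act (fun=> s k) q)}.
  exact: (@choice _ _ (fun k b => odist k p q = rdist k p (act (fun=> b) q))
    (fun k => odistP k p q)).
exists s; apply: (@near_ptP R d) => //; [exact: orep_in|exact/Xset_act/orep_in|].
move=> k i; apply: (@le_lt_trans _ _ (odist k p q)).
  rewrite sP (@eq_rdist k p _ s)// /rdist (bigD1 i) //= lerDl.
  exact: sumr_ge0.
have := le_lt_trans (orbit_dist_ub p q k) pq.
rewrite -ltr_pdivlMl ?exprn_gt0 ?invr_gt0// => /lt_le_trans; apply.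
rewrite -exprVn invrK mulrA ler_piMl ?(ltW e0)//.
rewrite exprVn ler_pdivrMr ?exprn_gt0// mul1r.
by rewrite ler_weXn2l ?ler1n// ltnW.
Qed.

Import ArrowAsProduct.

Lemma orbit_rep_compact : compact [set: orbit_rep].
Proof.
have -> : [set: orbit_rep] = orep_of @` (Xset d : set pt).
  by apply/seteqP; split => // p _; exists p; [exact: orep_in|exact: orep_of_orep].
apply: continuous_compact; last exact: Xset_compact.
apply/subspace_continuousP => x Xx; apply/cvg_ballP => e e0.
have [M [del del0 xy]] := orbit_dist_lt e0.
rewrite near_withinE; have := nbhs_near d M x del0.
apply: filterS => y xyM Xy; rewrite ballEmdist; apply: xy => //.
exact: near_ptP.
Qed.

End Signs.

(** * The Hilbert space l2 *)

Section ComplexLimits.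
Variable R : realType.
Implicit Types (z w : R[i]).

Lemma conjE z : z^* = conjc z. Proof. by []. Qed.

Definition sq2 z : R := re z ^+ 2 + im z ^+ 2.

Lemma sq2_ge0 z : 0 <= sq2 z. Proof. by rewrite addr_ge0 ?sqr_ge0. Qed.

Lemma sq2E z : z * z^* = (sq2 z)%:C.
Proof. by rewrite -normCK normc_def /sq2 -rmorphXn /= sqr_sqrtr ?addr_ge0 ?sqr_ge0. Qed.

Lemma sq2_eq0 z : sq2 z = 0 -> z = 0.
Proof.
move=> z0; apply/eqP; rewrite -normr_eq0 -sqrf_eq0 normCK sq2E z0.
by rewrite rmorph0.
Qed.

Lemma sq2M z w : sq2 (z * w) = sq2 z * sq2 w.
Proof. by case: z w => a b [c d]; rewrite /sq2 /=; ring. Qed.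

Lemma reD z w : re (z + w) = re z + re w. Proof. by case: z w => ? ? []. Qed.
Lemma imD z w : im (z + w) = im z + im w. Proof. by case: z w => ? ? []. Qed.
Lemma reN z : re (- z) = - re z. Proof. by case: z. Qed.
Lemma imN z : im (- z) = - im z. Proof. by case: z. Qed.
Lemma reM z w : re (z * w) = re z * re w - im z * im w. Proof. by case: z w => ? ? []. Qed.
Lemma imM z w : im (z * w) = re z * im w + im z * re w. Proof. by case: z w => ? ? []. Qed.

Lemma complexP z w : re z = re w -> im z = im w -> z = w.
Proof. by case: z w => a b [c d] /= -> ->. Qed.

Lemma re_norm z : re `|z| = Num.sqrt (sq2 z).
Proof. by rewrite normc_def. Qed.

Lemma normE z : `|z| = (Num.sqrt (sq2 z))%:C.
Proof. by rewrite normc_def. Qed.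

Lemma ltcR_gt0 (e : R[i]) : 0 < e -> exists2 r : R, 0 < r & e = r%:C.
Proof.
case: e => a b; rewrite ltcE /= => /andP[/eqP b0 a0].
by exists a => //; rewrite b0.
Qed.

Definition cvgC (u : nat -> R[i]) (l : R[i]) :=
  (re (u n) @[n --> \oo] --> re l) /\ (im (u n) @[n --> \oo] --> im l).

Lemma cvgC_unique u l l' : cvgC u l -> cvgC u l' -> l = l'.
Proof.
by move=> [ul ul1] [ul' ul1']; apply: complexP; apply/eqP;
  [apply/eqP; exact: cvg_unique ul ul'|apply/eqP; exact: cvg_unique ul1 ul1'].
Qed.

Lemma cvgCD u v l m : cvgC u l -> cvgC v m -> cvgC (fun n => u n + v n) (l + m).
Proof.
move=> [? ?] [? ?]; split; rewrite ?reD ?imD; under eq_fun do rewrite ?reD ?imD;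
  exact: cvgD.
Qed.

Lemma cvgCM a u l : cvgC u l -> cvgC (fun n => a * u n) (a * l).
Proof.
move=> [? ?]; split; rewrite ?reM ?imM; under eq_fun do rewrite ?reM ?imM;
  [apply: cvgB|apply: cvgD]; apply: cvgMr; by [].
Qed.

Lemma reJ z : re (z^*) = re z. Proof. by rewrite conjE; case: z. Qed.
Lemma imJ z : im (z^*) = - im z. Proof. by rewrite conjE; case: z. Qed.

Lemma cvgC_conj u l : cvgC u l -> cvgC (fun n => (u n)^*) (l^*).
Proof.
move=> [ur ui]; split; rewrite ?reJ ?imJ.
  by rewrite (_ : (fun n => _) = (fun n => re (u n)))//; apply/funext => n; rewrite reJ.
rewrite (_ : (fun n => _) = (fun n => - im (u n))); first exact: cvgN.
by apply/funext => n; rewrite imJ.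
Qed.

Lemma abs_re_le z : `|re z| <= Num.sqrt (sq2 z).
Proof. by rewrite -sqrtr_sqr ler_sqrt ?sq2_ge0// lerDl sqr_ge0. Qed.

Lemma abs_im_le z : `|im z| <= Num.sqrt (sq2 z).
Proof. by rewrite -sqrtr_sqr ler_sqrt ?sq2_ge0// lerDr sqr_ge0. Qed.

Lemma sqrt_sq2R (r : R) : Num.sqrt (sq2 (r%:C)) = `|r|.
Proof. by rewrite /sq2 /= expr0n addr0 sqrtr_sqr. Qed.

Lemma sqrt_sq2_le z : Num.sqrt (sq2 z) <= `|re z| + `|im z|.
Proof.
rewrite -[leRHS]ger0_norm ?addr_ge0// -sqrtr_sqr ler_sqrt ?sqr_ge0//.
rewrite /sq2 -(real_normK (num_real (re z))) -(real_normK (num_real (im z))).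
by rewrite sqrrD lerD2r lerDl mulrn_wge0// mulr_ge0.
Qed.

Lemma cvgC_cvg u l : cvgC u l <-> u @ \oo --> l.
Proof.
split=> [[/cvgrPdist_lt ur /cvgrPdist_lt ui]|/cvgrPdist_lt ul].
  apply/cvgrPdist_lt => e /ltcR_gt0[r r0 ->].
  have r2 : 0 < r / 2 by rewrite divr_gt0.
  apply: filterS2 (ur _ r2) (ui _ r2) => n; rewrite normE ltcR -!reN -!imN -reD -imD.
  move=> h1 h2; apply: le_lt_trans (sqrt_sq2_le _) _.
  by rewrite [ltRHS]splitr ltrD.
split; apply/cvgrPdist_lt => e e0; (have /ul : 0 < e%:C by rewrite ltcR);
  apply: filterS => n; rewrite normE ltcR -?reN -?imN -?reD -?imD => /le_lt_trans; apply.
  exact: abs_re_le.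
exact: abs_im_le.
Qed.

End ComplexLimits.

Section SquareSummable.
Variable R : realType.
Notation C := R[i].
Implicit Types x y z : nat -> C.

(* Partial sums range over [i < 2 ^ n] because these sets of indices are stable
   under the translations by their elements. *)
Definition psum n x y : C := \sum_(i < 2 ^ n) x i * (y i)^*.
Definition qsum n x : R := \sum_(i < 2 ^ n) sq2 (x i).

Lemma psumDl n x y z : psum n (fun i => x i + y i) z = psum n x z + psum n y z.
Proof. by rewrite -big_split; apply: eq_bigr => i _; rewrite mulrDl. Qed.

Lemma psumZl n a x y : psum n (fun i => a * x i) y = a * psum n x y.
Proof. by rewrite mulr_sumr; apply: eq_bigr => i _; rewrite mulrA. Qed.

Lemma psumC n x y : psum n y x = (psum n x y)^*.
Proof.
by rewrite rmorph_sum; apply: eq_bigr => i _; rewrite rmorphM /= conjCK mulrC.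
Qed.

Lemma psumZr n a x y : psum n x (fun i => a * y i) = a^* * psum n x y.
Proof. by rewrite psumC psumZl rmorphM /= -psumC. Qed.

Lemma psumxx n x : psum n x x = (qsum n x)%:C.
Proof. by rewrite rmorph_sum; apply: eq_bigr => i _; rewrite sq2E. Qed.

Lemma qsum_ge0 n x : 0 <= qsum n x.
Proof. by apply: sumr_ge0 => i _; exact: sq2_ge0. Qed.

Lemma sum2E (F : nat -> R) m n : (m <= n)%N ->
  \sum_(i < 2 ^ n) F i = \sum_(i < 2 ^ m) F i + \sum_((2 ^ m)%N <= i < (2 ^ n)%N) F i.
Proof.
by move=> mn; rewrite -!(big_mkord xpredT) -big_cat_nat// leq_exp2l.
Qed.

Lemma qsum_mono x : {homo qsum^~ x : m n / (m <= n)%N >-> m <= n}.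
Proof.
move=> m n mn; rewrite /qsum (sum2E (fun i => sq2 (x i)) mn) lerDl.
by apply: sumr_ge0 => i _; exact: sq2_ge0.
Qed.

Lemma qsum_sum_le n x y : qsum n (fun i => x i + y i) <= 2 * qsum n x + 2 * qsum n y.
Proof.
rewrite /qsum !mulr_sumr -big_split; apply: ler_sum => i _ /=.
case: (x i) (y i) => a b [c e]; rewrite /sq2 /=.
have := sqr_ge0 (a - c); have := sqr_ge0 (b - e); rewrite !sqrrD !sqrrN; lra.
Qed.

Lemma qsumZ n a x : qsum n (fun i => a * x i) = sq2 a * qsum n x.
Proof. by rewrite mulr_sumr; apply: eq_bigr => i _; rewrite sq2M. Qed.

Definition bounded_sums x := exists B, forall n, qsum n x <= B.

Record l2 := L2 { l2val :> nat -> C; l2P : bounded_sums l2val }.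

Lemma l2_inj (x y : l2) : (x : nat -> C) = y -> x = y.
Proof.
case: x y => [x Px] [y Py] /= xy; subst y; congr L2; exact: Prop_irrelevance.
Qed.

Lemma bounded_sums0 : bounded_sums (fun=> 0).
Proof.
by exists 0 => n; rewrite /qsum big1// => i _; rewrite /sq2 /= expr0n addr0.
Qed.

Lemma bounded_sumsD x y : bounded_sums x -> bounded_sums y ->
  bounded_sums (fun i => x i + y i).
Proof.
move=> [B xB] [D yD]; exists (2 * B + 2 * D) => n.
by apply: le_trans (qsum_sum_le _ _ _) _; rewrite lerD// ler_pM2l.
Qed.

Lemma bounded_sumsZ a x : bounded_sums x -> bounded_sums (fun i => a * x i).
Proof.
by move=> [B xB]; exists (sq2 a * B) => n; rewrite qsumZ ler_wpM2l ?sq2_ge0.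
Qed.

Lemma bounded_sumsN x : bounded_sums x -> bounded_sums (fun i => - x i).
Proof.
move=> /(bounded_sumsZ (-1)) xB.
by rewrite (_ : (fun i => _) = fun i => -1 * x i)//; apply/funext => i; rewrite mulN1r.
Qed.

Definition l2_zero := L2 bounded_sums0.
Definition l2_add (x y : l2) := L2 (bounded_sumsD (l2P x) (l2P y)).
Definition l2_opp (x : l2) := L2 (bounded_sumsN (l2P x)).
Definition l2_scale a (x : l2) := L2 (bounded_sumsZ a (l2P x)).

HB.instance Definition _ := gen_eqMixin l2.
HB.instance Definition _ := gen_choiceMixin l2.

Let l2_addA : associative l2_add.
Proof. by move=> x y z; apply/l2_inj/funext => i; exact: addrA. Qed.
Let l2_addC : commutative l2_add.
Proof. by move=> x y; apply/l2_inj/funext => i; exact: addrC. Qed.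
Let l2_add0 : left_id l2_zero l2_add.
Proof. by move=> x; apply/l2_inj/funext => i; exact: add0r. Qed.
Let l2_addN : left_inverse l2_zero l2_opp l2_add.
Proof. by move=> x; apply/l2_inj/funext => i; exact: addNr. Qed.

HB.instance Definition _ := GRing.isZmodule.Build l2 l2_addA l2_addC l2_add0 l2_addN.

Let l2_scaleA a b (x : l2) : l2_scale a (l2_scale b x) = l2_scale (a * b) x.
Proof. by apply/l2_inj/funext => i; exact: mulrA. Qed.
Let l2_scale1 : left_id 1 l2_scale.
Proof. by move=> x; apply/l2_inj/funext => i; exact: mul1r. Qed.
Let l2_scaleDr : right_distributive l2_scale +%R.
Proof. by move=> a x y; apply/l2_inj/funext => i; exact: mulrDr. Qed.
Let l2_scaleDl (x : l2) : {morph l2_scale^~ x : a b / a + b}.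
Proof. by move=> a b; apply/l2_inj/funext => i; exact: mulrDl. Qed.

HB.instance Definition _ := GRing.Zmodule_isLmodule.Build C l2
  l2_scaleA l2_scale1 l2_scaleDr l2_scaleDl.

Lemma l2D (x y : l2) i : (x + y) i = x i + y i. Proof. by []. Qed.
Lemma l2N (x : l2) i : (- x) i = - x i. Proof. by []. Qed.
Lemma l2Z a (x : l2) i : (a *: x) i = a * x i. Proof. by []. Qed.
Lemma l2B (x y : l2) i : (x - y) i = x i - y i. Proof. by []. Qed.

Implicit Types u v w : l2.

Definition sqn u : R := limn (fun n => qsum n u).

Lemma sqn_cvg u : qsum n u @[n --> \oo] --> sqn u.
Proof.
apply: nondecreasing_is_cvgn; first by move=> m n; exact: qsum_mono.
by have [B uB] := l2P u; exists B => _ [n _ <-].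
Qed.

Lemma qsum_le n u : qsum n u <= sqn u.
Proof.
apply: nondecreasing_cvgn_le; first by move=> ? ?; exact: qsum_mono.
exact: (cvgP _ (@sqn_cvg u)).
Qed.

Lemma sqn_le u B : (forall n, qsum n u <= B) -> sqn u <= B.
Proof.
move=> uB; apply: limr_le; first exact: cvgP (@sqn_cvg u).
by exists 0%N => // n _; exact: uB.
Qed.

Definition ip u v : C :=
  Complex (limn (fun n => re (psum n u v))) (limn (fun n => im (psum n u v))).

(** Polarization reduces the convergence of the inner product to that of the monotone sums
    [qsum]. *)
Let re_psum n u v : re (psum n u v) = 4^-1 * (qsum n (u + v) - qsum n (u - v)).
Proof.
rewrite /psum /qsum -sumrB mulr_sumr (big_morph re (@reD R) (erefl _)).
apply: eq_bigr => i _ /=; rewrite reM imJ reJ.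
case: (u i) (v i) => a b [c e]; rewrite /sq2 /=.
rewrite (_ : 4^-1 * _ = 4^-1 * (4 * (a * c + b * e))); last by ring.
by rewrite mulrA mulVf ?pnatr_eq0// mul1r; ring.
Qed.

Let re_psum_cvg u v : cvgn (fun n => re (psum n u v)).
Proof.
under eq_fun do rewrite re_psum.
apply: is_cvgMr; apply: is_cvgB; exact/cvgP/sqn_cvg.
Qed.

Let im_psum n u v : im (psum n u v) = re (psum n u ((Complex 0 1 : C) *: v)).
Proof.
by rewrite psumZr reM reJ imJ /=; ring.
Qed.

Lemma ip_cvg u v : cvgC (fun n => psum n u v) (ip u v).
Proof.
split => /=; first exact: re_psum_cvg.
have := @re_psum_cvg u ((Complex 0 1 : C) *: v).
by under eq_fun do rewrite -im_psum.
Qed.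

Lemma ipDl u v w : ip (u + v) w = ip u w + ip v w.
Proof.
apply: cvgC_unique (ip_cvg _ _) _.
rewrite (_ : (fun n => _) = fun n => psum n u w + psum n v w); last first.
  by apply/funext => n; exact: psumDl.
by apply: cvgCD; exact: ip_cvg.
Qed.

Lemma ipZl a u v : ip (a *: u) v = a * ip u v.
Proof.
apply: cvgC_unique (ip_cvg _ _) _.
rewrite (_ : (fun n => _) = fun n => a * psum n u v); last first.
  by apply/funext => n; exact: psumZl.
by apply: cvgCM; exact: ip_cvg.
Qed.

Lemma ipC u v : ip v u = (ip u v)^*.
Proof.
apply: cvgC_unique (ip_cvg _ _) _.
rewrite (_ : (fun n => _) = fun n => (psum n u v)^*); last first.
  by apply/funext => n; exact: psumC.
by apply: cvgC_conj; exact: ip_cvg.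
Qed.

Lemma ipxx u : ip u u = (sqn u)%:C.
Proof.
apply: cvgC_unique (ip_cvg _ _) _.
rewrite (_ : (fun n => _) = fun n => (qsum n u)%:C); last first.
  by apply/funext => n; exact: psumxx.
by split; [exact: sqn_cvg|exact: cvg_cst].
Qed.

Lemma ipDr u v w : ip u (v + w) = ip u v + ip u w.
Proof. by rewrite ipC ipDl rmorphD /= -!ipC. Qed.

Lemma ipZr a u v : ip u (a *: v) = a^* * ip u v.
Proof. by rewrite ipC ipZl rmorphM /= -ipC. Qed.

Lemma ipNl u v : ip (- u) v = - ip u v.
Proof. by rewrite -scaleN1r ipZl mulN1r. Qed.

Lemma ipNr u v : ip u (- v) = - ip u v.
Proof. by rewrite ipC ipNl rmorphN /= -ipC. Qed.

Lemma ipBl u v w : ip (u - v) w = ip u w - ip v w.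
Proof. by rewrite ipDl ipNl. Qed.

Lemma ipBr u v w : ip u (v - w) = ip u v - ip u w.
Proof. by rewrite ipDr ipNr. Qed.

Lemma ip0l u : ip 0 u = 0.
Proof. by rewrite -[in LHS](scale0r 0) ipZl mul0r. Qed.

Lemma sqn_ge0 u : 0 <= sqn u.
Proof. exact: le_trans (qsum_ge0 0 u) (qsum_le 0 u). Qed.

Lemma sq2_le_sqn u i : sq2 (u i) <= sqn u.
Proof.
apply: le_trans (qsum_le i u); have ii := ltn_expl i (ltnSn 1).
by rewrite /qsum (bigD1 (Ordinal ii))//= lerDl sumr_ge0// => j _; exact: sq2_ge0.
Qed.

Lemma sqn_eq0 u : sqn u = 0 -> u = 0.
Proof.
move=> u0; apply/l2_inj/funext => i; apply: sq2_eq0; apply/eqP.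
by rewrite eq_le sq2_ge0 andbT -u0 sq2_le_sqn.
Qed.

Lemma sqnE u : sqn u = re (ip u u).
Proof. by rewrite ipxx. Qed.

Lemma sqnZ a u : sqn (a *: u) = sq2 a * sqn u.
Proof. by rewrite sqnE ipZl ipZr mulrA sq2E ipxx -rmorphM. Qed.

Lemma sqnD u v : sqn (u + v) = sqn u + sqn v + 2 * re (ip u v).
Proof.
by rewrite !sqnE ipDl !ipDr (ipC u v) !reD reJ; ring.
Qed.

Lemma cauchy_schwarz u v : sq2 (ip u v) <= sqn u * sqn v.
Proof.
have [v0|v0] := eqVneq (sqn v) 0.
  by rewrite (sqn_eq0 v0) ipC ip0l /sq2 reJ imJ /= oppr0 !expr0n addr0 mulr_ge0 ?sqn_ge0.
have vp : 0 < sqn v by rewrite lt_neqAle eq_sym v0 sqn_ge0.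
(* This [a] makes [u + a *: v] the component of [u] orthogonal to [v]. *)
set c := ip u v; pose a := (- (sqn v)^-1)%:C * c.
have e1 : sq2 a = (sqn v)^-1 ^+ 2 * sq2 c.
  by rewrite /a sq2M; congr (_ * _); rewrite /sq2 /= sqrrN expr0n addr0.
have e2 : re (a^* * c) = - (sqn v)^-1 * sq2 c.
  by rewrite /a conjE; case: (c) => x y; rewrite /sq2 /=; ring.
have := sqn_ge0 (u + a *: v); rewrite sqnD sqnZ ipZr -/c e1 e2.
rewrite (_ : _ + _ = sqn u - sq2 c / sqn v); last by field.
by rewrite subr_ge0 ler_pdivrMr.
Qed.

Definition nrm u : R := Num.sqrt (sqn u).

Lemma nrm_ge0 u : 0 <= nrm u. Proof. exact: sqrtr_ge0. Qed.

Lemma sqr_nrm u : nrm u ^+ 2 = sqn u.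
Proof. by rewrite sqr_sqrtr ?sqn_ge0. Qed.

Lemma abs_ip_le u v : Num.sqrt (sq2 (ip u v)) <= nrm u * nrm v.
Proof.
by rewrite -sqrtrM ?sqn_ge0// ler_sqrt ?mulr_ge0 ?sqn_ge0// cauchy_schwarz.
Qed.

Lemma nrmD u v : nrm (u + v) <= nrm u + nrm v.
Proof.
rewrite -[leRHS]ger0_norm ?addr_ge0 ?nrm_ge0// -sqrtr_sqr ler_sqrt ?sqr_ge0//.
have : re (ip u v) <= nrm u * nrm v.
  by apply: le_trans (ler_norm _) (le_trans (abs_re_le _) (abs_ip_le _ _)).
by rewrite sqnD sqrrD !sqr_nrm; lra.
Qed.

Lemma nrmZ a u : nrm (a *: u) = Num.sqrt (sq2 a) * nrm u.
Proof. by rewrite /nrm sqnZ sqrtrM ?sq2_ge0. Qed.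

Lemma nrm_eq0 u : nrm u = 0 -> u = 0.
Proof. by move=> u0; apply: sqn_eq0; rewrite -sqr_nrm u0 expr0n. Qed.

Let normD u v : (nrm (u + v))%:C <= (nrm u)%:C + (nrm v)%:C.
Proof. by rewrite -rmorphD /= lecR nrmD. Qed.

Let normZ a u : (nrm (a *: u))%:C = `|a| * (nrm u)%:C.
Proof. by rewrite nrmZ rmorphM normE. Qed.

Let norm_eq0 u : (nrm u)%:C = 0 -> u = 0.
Proof. by move=> [/nrm_eq0]. Qed.

HB.instance Definition _ := Lmodule_isNormed.Build C l2 normD normZ norm_eq0.

Lemma l2_norm u : `|u| = (nrm u)%:C. Proof. by []. Qed.

Lemma abs_coord_le u i : Num.sqrt (sq2 (u i)) <= nrm u.
Proof. by rewrite ler_sqrt ?sqn_ge0// sq2_le_sqn. Qed.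

Lemma nrmN u : nrm (- u) = nrm u.
Proof. by rewrite -scaleN1r nrmZ /sq2 /= oppr0 sqrrN expr0n addr0 expr1n sqrtr1 mul1r. Qed.

Lemma nrm_le u B : 0 <= B -> (forall n, qsum n u <= B ^+ 2) -> nrm u <= B.
Proof.
move=> B0 uB; rewrite -[leRHS]ger0_norm// -sqrtr_sqr ler_sqrt ?sqr_ge0//.
exact: sqn_le.
Qed.

Section Completeness.
Variables (F : set_system l2).
Hypotheses (FF : ProperFilter F) (Fc : cauchy F).

Let near_l2 e : 0 < e -> exists x : l2, F [set u | nrm (x - u) < e].
Proof.
move=> e0; have [|x Fx] := (@cauchyP _ l2 F FF).1 Fc e%:C; first by rewrite ltcR.
exists x; apply: filterS Fx => u; rewrite -ball_normE /ball_/= l2_norm.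
by rewrite ltcR.
Qed.

Let lre i := lim ((fun u : l2 => re (u i)) @ F).
Let lim_im i := lim ((fun u : l2 => im (u i)) @ F).

Let lreP i : (fun u : l2 => re (u i)) @ F --> lre i.
Proof.
apply: cauchy_cvg; apply: cauchy_exP => e /near_l2[x Fx]; exists (re (x i)).
suff : F [set u : l2 | ball (re (x i)) e (re (u i))] by [].
apply: filterS Fx => u /= xu; rewrite -ball_normE /ball_/=.
apply: le_lt_trans xu; rewrite (_ : _ - _ = re ((x - u) i)); last by rewrite l2B reD reN.
exact: le_trans (abs_re_le _) (abs_coord_le _ _).
Qed.

Let lim_imP i : (fun u : l2 => im (u i)) @ F --> lim_im i.
Proof.
apply: cauchy_cvg; apply: cauchy_exP => e /near_l2[x Fx]; exists (im (x i)).
suff : F [set u : l2 | ball (im (x i)) e (im (u i))] by [].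
apply: filterS Fx => u /= xu; rewrite -ball_normE /ball_/=.
apply: le_lt_trans xu; rewrite (_ : _ - _ = im ((x - u) i)); last by rewrite l2B imD imN.
exact: le_trans (abs_im_le _) (abs_coord_le _ _).
Qed.

Let lval i : C := Complex (lre i) (lim_im i).

Let qsum_lval n (x : l2) :
  (fun u : l2 => qsum n (x - u)) @ F --> qsum n (fun i => x i - lval i).
Proof.
have c1 i : (fun u : l2 => sq2 (x i - u i)) @ F --> sq2 (x i - lval i).
  rewrite /sq2 reD imD reN imN.
  rewrite (_ : (fun u => _) =
    (fun u : l2 => (re (x i) - re (u i)) ^+ 2 + (im (x i) - im (u i)) ^+ 2)).
    by apply: cvgD; rewrite expr2; apply: cvgM; apply: cvgB; by [exact: cvg_cst|].
  by apply/funext => u; rewrite reD imD reN imN.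
rewrite /qsum; elim: (2 ^ n)%N => [|m IHm].
  rewrite big_ord0 (_ : (fun u => _) = fun=> 0); first exact: cvg_cst.
  by apply/funext => u; rewrite big_ord0.
rewrite big_ord_recr /= (_ : (fun u => _) = (fun u : l2 =>
  \sum_(i < m) sq2 ((x - u) i) + sq2 (x m - u m))); first exact: cvgD.
by apply/funext => u; rewrite big_ord_recr.
Qed.

(** Finite sums pass to the coordinatewise limit with a bound independent of [n]; this gives both
    its square-summability and convergence in norm. *)
Let qsum_lval_le n (x : l2) e : 0 < e -> F [set u | nrm (x - u) < e] ->
  qsum n (fun i => x i - lval i) <= e ^+ 2.
Proof.
move=> e0 Fx; rewrite -(cvg_lim _ (@qsum_lval n x))//.
apply: limr_le; first exact: cvgP (@qsum_lval n x).
apply: filterS Fx => u /= xu; apply: le_trans (qsum_le n (x - u)) _.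
by rewrite -sqr_nrm lerXn2r ?nnegrE ?nrm_ge0 ?ltW.
Qed.

Let lval_bounded : bounded_sums lval.
Proof.
have [x Fx] := near_l2 ltr01; have xl : bounded_sums (fun i => x i - lval i).
  by exists (1 ^+ 2) => n; exact: qsum_lval_le Fx.
have := bounded_sumsD (l2P x) (bounded_sumsN xl).
by congr bounded_sums; apply/funext => i; rewrite opprB addrC subrK.
Qed.

Lemma l2_complete : cvg F.
Proof.
apply/cvg_ex; exists (L2 lval_bounded); apply/cvg_ballP => _ /ltcR_gt0[r r0 ->].
have r2 : 0 < r / 2 by rewrite divr_gt0.
have [x Fx] := near_l2 r2; apply: filterS (Fx) => u /= xu.
rewrite -ball_normE /ball_/= l2_norm ltcR -(subrKA x) [ltRHS]splitr.
apply: le_lt_trans (nrmD _ _) _; apply: ler_ltD => //.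
rewrite -nrmN; apply: nrm_le (ltW r2) _ => n.
rewrite (_ : qsum n _ = qsum n (fun i => x i - lval i)) ?qsum_lval_le//.
by apply: eq_bigr => i _; rewrite l2N l2B opprB.
Qed.

End Completeness.

HB.instance Definition _ := Uniform_isComplete.Build l2 l2_complete.

Let innerxx_l2 u : ip u u = `|u| ^+ 2.
Proof. by rewrite ipxx l2_norm -rmorphXn /= sqr_nrm. Qed.

HB.instance Definition _ := isHilbert.Build R l2 ipDl ipZl ipC innerxx_l2.

Lemma innerE u v : inner u v = ip u v. Proof. by []. Qed.

End SquareSummable.

(** * Bounded operators on l2 *)

Section Operators.
Variable R : realType.
Notation C := R[i].
Notation H := (l2 R).
Implicit Types (u v w : H) (T S : H -> H) (B : R).

Lemma bounded_sums_supp n (x : nat -> C) : (forall i, (2 ^ n <= i)%N -> x i = 0) ->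
  forall m, qsum m x <= qsum n x.
Proof.
move=> x0 m; have [mn|/ltnW nm] := leqP m n; first exact: qsum_mono.
rewrite [qsum m x](sum2E (fun i => sq2 (x i)) nm).
rewrite [X in _ + X]big_nat_cond [X in _ + X]big1 ?addr0//.
by move=> i /andP[/andP[/x0 -> _] _]; rewrite /sq2 /= expr0n addr0.
Qed.

Lemma ket_bounded k : bounded_sums (fun i => (i == k)%:R : C).
Proof.
have kk := ltn_expl k (ltnSn 1).
exists (qsum k (fun i => (i == k)%:R : C)) => m; apply: bounded_sums_supp => i ki.
by rewrite gtn_eqF//; exact: leq_trans ki.
Qed.

Definition ket k : H := L2 (ket_bounded k).

Lemma ip_supp n u v : (forall i, (2 ^ n <= i)%N -> u i * (v i)^* = 0) ->
  ip u v = psum n u v.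
Proof.
move=> uv0; apply: cvgC_unique (ip_cvg u v) _.
have E m : (n <= m)%N -> psum m u v = psum n u v.
  move=> nm; rewrite /psum -!(big_mkord xpredT (fun i => u i * (v i)^*)).
  rewrite (big_cat_nat (n := 2 ^ n))//= ?leq_exp2l//.
  by rewrite [X in _ + X]big_nat_cond [X in _ + X]big1 ?addr0// => i /andP[/andP[/uv0]].
split; apply: cvg_near_cst; exists n => // m /= nm; by rewrite E.
Qed.

Lemma ip_ket u k : ip u (ket k) = u k.
Proof.
have kk := ltn_expl k (ltnSn 1).
rewrite (@ip_supp k); last first.
  move=> i ki; rewrite /= gtn_eqF ?rmorph0 ?mulr0//; exact: leq_trans ki.
rewrite /psum (bigD1 (Ordinal kk)) //= eqxx rmorph1 mulr1 big1 ?addr0// => i.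
by rewrite -(inj_eq val_inj) /= => /negPf ->; rewrite rmorph0 mulr0.
Qed.

Lemma ketE k i : ket k i = (i == k)%:R. Proof. by []. Qed.

Lemma nrm_ket k : nrm (ket k) = 1.
Proof. by rewrite /nrm sqnE ip_ket ketE eqxx sqrtr1. Qed.

Lemma trunc_bounded n u : bounded_sums (fun i => if (i < 2 ^ n)%N then u i else 0).
Proof.
have [B uB] := l2P u; exists B => m; apply: le_trans (uB m).
apply: ler_sum => i _; case: ifP => // _.
by rewrite {1}/sq2 /= expr0n addr0 sq2_ge0.
Qed.

Definition trunc n u : H := L2 (trunc_bounded n u).

Lemma truncE n u i : trunc n u i = if (i < 2 ^ n)%N then u i else 0.
Proof. by []. Qed.

Lemma trunc_sum n u : trunc n u = \sum_(i < 2 ^ n) u i *: ket i.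
Proof.
apply/l2_inj/funext => k; rewrite truncE.
have coord (m : nat) (f : nat -> H) : (\sum_(i < m) f i) k = \sum_(i < m) f i k.
  by elim: m => [|m IHm]; rewrite ?big_ord0 ?big_ord_recr// l2D IHm.
rewrite (coord _ (fun i => u i *: ket i)).
case: ltnP => [kn|nk]; last first.
  rewrite big1// => i _; rewrite l2Z ketE gtn_eqF ?mulr0//.
  exact: leq_trans nk.
rewrite (bigD1 (Ordinal kn)) //= eqxx mulr1 big1 ?addr0// => i.
by rewrite -(inj_eq val_inj) /= eq_sym => /negPf ->; rewrite mulr0.
Qed.

Lemma sqn_trunc n u : sqn (trunc n u) = qsum n u.
Proof.
rewrite sqnE (@ip_supp n) ?psumxx.
  by apply: eq_bigr => i _; rewrite truncE ltn_ord.
by move=> i ni; rewrite truncE ltnNge ni mul0r.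
Qed.

Lemma ip_trunc n u : ip u (trunc n u) = (qsum n u)%:C.
Proof.
rewrite (@ip_supp n) ?psumxx -?psumxx.
  by apply: eq_bigr => i _; rewrite truncE ltn_ord.
by move=> i ni; rewrite truncE ltnNge ni rmorph0 mulr0.
Qed.

Lemma sqn_sub_trunc n u : sqn (u - trunc n u) = sqn u - qsum n u.
Proof.
rewrite sqnD ipNr ip_trunc -[sqn (- _)]sqr_nrm nrmN sqr_nrm sqn_trunc /=; ring.
Qed.

Lemma trunc_near u e : 0 < e ->
  exists n, forall m, (n <= m)%N -> nrm (u - trunc m u) < e.
Proof.
move=> e0; have /cvgrPdist_lt/(_ (e ^+ 2)) := @sqn_cvg _ u.
move=> /(_ ltac:(by rewrite exprn_gt0))[n _ nP]; exists n => m /nP /=.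
rewrite ger0_norm ?subr_ge0 ?qsum_le// -sqn_sub_trunc => ne.
by rewrite -[ltRHS]ger0_norm ?ltW// -sqrtr_sqr ltr_sqrt// exprn_gt0.
Qed.

Lemma nrm0 : nrm (0 : H) = 0.
Proof. by rewrite -(scale0r (0 : H)) nrmZ /sq2 /= expr0n addr0 sqrtr0 mul0r. Qed.

Lemma nrm_sum (m : nat) (f : nat -> H) :
  nrm (\sum_(i < m) f i) <= \sum_(i < m) nrm (f i).
Proof.
elim: m => [|m IHm]; first by rewrite !big_ord0 nrm0.
by rewrite !big_ord_recr /=; apply: le_trans (nrmD _ _) _; rewrite lerD2r.
Qed.

Lemma nrmB u v : nrm (u - v) = nrm (v - u).
Proof. by rewrite -nrmN opprB. Qed.

Definition bnd T B := forall u, nrm (T u) <= B * nrm u.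

Lemma linD T u v : linear T -> T (u + v) = T u + T v.
Proof. by move=> /(_ 1 u v); rewrite !scale1r. Qed.

Lemma lin0 T : linear T -> T 0 = 0.
Proof. by move=> Tl; apply: (addrI (T 0)); rewrite -(linD _ _ Tl) !addr0. Qed.

Lemma linZ T a u : linear T -> T (a *: u) = a *: T u.
Proof. by move=> Tl; rewrite -[a *: u]addr0 Tl (lin0 Tl) addr0. Qed.

Lemma linN T u : linear T -> T (- u) = - T u.
Proof. by move=> Tl; rewrite -scaleN1r (linZ _ _ Tl) scaleN1r. Qed.

Lemma linB T u v : linear T -> T (u - v) = T u - T v.
Proof. by move=> Tl; rewrite (linD _ _ Tl) (linN _ Tl). Qed.

Lemma lin_sum T m (f : nat -> H) : linear T ->
  T (\sum_(i < m) f i) = \sum_(i < m) T (f i).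
Proof.
move=> Tl; elim: m => [|m IHm]; rewrite ?big_ord0 ?(lin0 Tl)//.
by rewrite !big_ord_recr (linD _ _ Tl) IHm.
Qed.

Lemma bounded_opP T : bounded_op T <-> linear T /\ exists2 B, 0 <= B & bnd T B.
Proof.
split=> [[Tl Tc]|[Tl [B B0 TB]]]; split => //.
  have /cvgrPdist_lt/(_ 1 ltr01) := Tc 0; rewrite (lin0 Tl).
  move=> /nbhs_ballP[e /= /ltcR_gt0[r r0 ->] rP].
  have r2 : 0 < r / 2 by rewrite divr_gt0.
  exists (2 / r) => [|u]; first by rewrite divr_ge0// ltW.
  have [->|u0] := eqVneq u 0; first by rewrite (lin0 Tl) nrm0 mulr0.
  have nu : 0 < nrm u.
    by rewrite lt_neqAle nrm_ge0 andbT; apply: contra_neq u0 => /esym/nrm_eq0.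
  (* Scaling by [a] brings [u] to norm [r / 2], inside the ball on which [T] has norm less than
     1. *)
  have [a aE] : exists a : C, Num.sqrt (sq2 a) = r / 2 / nrm u.
    exists (r / 2 / nrm u)%:C; rewrite /sq2 /= expr0n addr0 sqrtr_sqr ger0_norm//.
    by rewrite !divr_ge0// ltW.
  have := rP (a *: u); rewrite -ball_normE /= !sub0r !normrN !l2_norm (linZ _ _ Tl) !nrmZ.
  rewrite ltcR (_ : 1 = 1%:C)// ltcR aE mulfVK ?gt_eqF//.
  move=> /(_ ltac:(by rewrite ltr_pdivrMr// ltr_pMr// ltr1n)).
  rewrite -ltr_pdivlMl ?divr_gt0// mulr1 => /ltW; rewrite !invf_div.
  by rewrite mulrC.
move=> u A /nbhs_ballP[e /= /ltcR_gt0[r r0 ->] eA].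
have B1 : 0 < B + 1 by rewrite ltr_wpDl.
apply/nbhs_ballP; exists (r / (B + 1))%:C; first by rewrite /= ltcR divr_gt0.
move=> v; rewrite -ball_normE /= l2_norm ltcR => uv; apply: eA.
rewrite -ball_normE /= l2_norm ltcR -(linB _ _ Tl).
apply: le_lt_trans (TB _) _; apply: (@le_lt_trans _ _ ((B + 1) * nrm (u - v))).
  by rewrite ler_wpM2r ?nrm_ge0// lerDl.
by rewrite mulrC -ltr_pdivlMr.
Qed.

Lemma eq_of_near u v : (forall e, 0 < e -> nrm (u - v) <= e) -> u = v.
Proof.
move=> uv; apply/subr0_eq/nrm_eq0/eqP; rewrite eq_le nrm_ge0 andbT.
by apply/ler_addgt0Pl => e e0; rewrite addr0 uv.
Qed.

Lemma ext_ket T S B D : linear T -> linear S -> bnd T B -> bnd S D ->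
  (forall k, T (ket k) = S (ket k)) -> T = S.
Proof.
move=> Tl Sl TB SD TS; apply/funext => u.
have tr n : T (trunc n u) = S (trunc n u).
  rewrite trunc_sum (lin_sum _ (fun i => u i *: ket i) Tl).
  rewrite (lin_sum _ (fun i => u i *: ket i) Sl); apply: eq_bigr => i _.
  by rewrite (linZ _ _ Tl) (linZ _ _ Sl) TS.
apply: eq_of_near => e e0; pose c := `|B| + `|D| + 1.
have c0 : 0 < c by rewrite ltr_wpDl// addr_ge0.
have [n /(_ n (leqnn n)) un] := trunc_near u (divr_gt0 e0 c0).
rewrite (_ : _ - _ = T (u - trunc n u) - S (u - trunc n u)); last first.
  by rewrite (linB _ _ Tl) (linB _ _ Sl) tr opprB addrA subrK.
apply: le_trans (nrmD _ _) _; rewrite nrmN.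
apply: le_trans (lerD (TB _) (SD _)) _; rewrite -mulrDl.
apply: (@le_trans _ _ (c * nrm (u - trunc n u))).
  by rewrite ler_wpM2r ?nrm_ge0// /c -[B + D]addr0 lerD// lerD// ler_norm.
by rewrite mulrC -ler_pdivlMr// ltW.
Qed.

Section Adjoint.
Variables (T : H -> H) (B : R).
Hypotheses (Tl : linear T) (B0 : 0 <= B) (TB : bnd T B).

(* The coefficients of the adjoint are square-summable because pairing a
   truncation with itself is bounded by [B * nrm y * nrm (truncation)]. *)
Lemma adj_le (y : H) n : qsum n (fun k => (ip (T (ket k)) y)^*) <= (B * nrm y) ^+ 2.
Proof.
set x := fun k => _; have xb : bounded_sums (fun i => if (i < 2 ^ n)%N then x i else 0).
  exists (qsum n x) => m.
  apply: le_trans (@bounded_sums_supp n _ _ m) _; first by move=> i ni; rewrite ltnNge ni.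
  by apply: ler_sum => i _; rewrite ltn_ord.
pose z : H := L2 xb.
have zz : sqn z = qsum n x.
  rewrite -[RHS](_ : qsum n z = _); last by apply: eq_bigr => i _; rewrite /z /= ltn_ord.
  rewrite sqnE (@ip_supp n) ?psumxx//.
  by move=> i ni; rewrite /z /= ltnNge ni mul0r.
have tz : z = \sum_(i < 2 ^ n) x i *: ket i.
  rewrite -[LHS](_ : trunc n z = z); last first.
    by apply/l2_inj/funext => i; rewrite truncE /z /=; case: (i < 2 ^ n)%N.
  by rewrite trunc_sum; apply: eq_bigr => i _; rewrite /z /= ltn_ord.
have : ip (T z) y = (qsum n x)%:C.
  rewrite tz (lin_sum _ (fun i => x i *: ket i) Tl).
  have ips m (f : nat -> H) : ip (\sum_(i < m) f i) y = \sum_(i < m) ip (f i) y.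
    by elim: m => [|m IHm]; rewrite ?big_ord0 ?ip0l// !big_ord_recr ipDl IHm.
  rewrite (ips _ (fun i => T (x i *: ket i))) /qsum rmorph_sum.
  by apply: eq_bigr => i _; rewrite (linZ _ _ Tl) ipZl -[ip _ y]conjCK sq2E.
move=> zE; have := abs_ip_le (T z) y; rewrite zE /sq2 /= expr0n addr0 sqrtr_sqr.
rewrite ger0_norm ?qsum_ge0// => le1.
have le2 : qsum n x <= B * nrm z * nrm y.
  by apply: le_trans le1 _; rewrite ler_wpM2r ?nrm_ge0// TB.
have zx : qsum n x = nrm z ^+ 2 by rewrite sqr_nrm.
have [z0|z0] := eqVneq (nrm z) 0; first by rewrite zx z0 expr0n sqr_ge0.
have zp : 0 < nrm z by rewrite lt_neqAle eq_sym z0 nrm_ge0.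
rewrite zx lerXn2r ?nnegrE ?nrm_ge0 ?mulr_ge0 ?nrm_ge0//.
by rewrite -(ler_pM2l zp) -expr2 -zx (le_trans le2)// mulrCA mulrA.
Qed.

Lemma adj_bounded y : bounded_sums (fun k => (ip (T (ket k)) y)^*).
Proof. by exists ((B * nrm y) ^+ 2) => n; exact: adj_le. Qed.

End Adjoint.

(** For a bounded linear [T] the default 0 is never reached, by [adj_bounded]. *)
Definition adj T (y : H) : H :=
  match pselect (bounded_sums (fun k => (ip (T (ket k)) y)^*)) with
  | left b => L2 b | right _ => 0 end.

Lemma adjE T B y k : linear T -> 0 <= B -> bnd T B ->
  adj T y k = (ip (T (ket k)) y)^*.
Proof.
by move=> Tl B0 TB; rewrite /adj; case: pselect => // -[]; exact: adj_bounded TB y.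
Qed.

Lemma adj_bnd T B : linear T -> 0 <= B -> bnd T B -> bnd (adj T) B.
Proof.
move=> Tl B0 TB y; apply: nrm_le; first by rewrite mulr_ge0 ?nrm_ge0.
move=> n; rewrite (_ : qsum n _ = qsum n (fun k => (ip (T (ket k)) y)^*)).
  exact: (adj_le Tl B0 TB).
by apply: eq_bigr => i _; rewrite (adjE _ _ Tl B0 TB).
Qed.

Lemma eq_ip u v : (forall w, ip w u = ip w v) -> u = v.
Proof.
move=> uv; apply/subr0_eq/sqn_eq0; rewrite sqnE ipBr uv subrr.
by [].
Qed.

Lemma sqrt_sq2D (z w : C) : Num.sqrt (sq2 (z + w)) <= Num.sqrt (sq2 z) + Num.sqrt (sq2 w).
Proof. by have := ler_normD z w; rewrite !normE -rmorphD /= lecR. Qed.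

Lemma sqrt_sq2N (z : C) : Num.sqrt (sq2 (- z)) = Num.sqrt (sq2 z).
Proof. by rewrite -!re_norm normrN. Qed.

Lemma sqrt_sq2_eq0 (z : C) : (forall e, 0 < e -> Num.sqrt (sq2 z) <= e) -> z = 0.
Proof.
move=> ze; apply/sq2_eq0/eqP; rewrite eq_le sq2_ge0 andbT -sqrtr_eq0.
rewrite eq_le sqrtr_ge0 andbT; apply/ler_addgt0Pl => e e0; rewrite addr0 ze//.
Qed.

Lemma adjP T B u v : linear T -> 0 <= B -> bnd T B -> ip (T u) v = ip u (adj T v).
Proof.
move=> Tl B0 TB; have bk k : ip (T (ket k)) v = ip (ket k) (adj T v).
  by rewrite [RHS]ipC ip_ket (adjE _ _ Tl B0 TB) conjCK.
have tr n : ip (T (trunc n u)) v = ip (trunc n u) (adj T v).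
  rewrite trunc_sum (lin_sum _ (fun i => u i *: ket i) Tl).
  have ips m (f : nat -> H) y : ip (\sum_(i < m) f i) y = \sum_(i < m) ip (f i) y.
    by elim: m => [|m IHm]; rewrite ?big_ord0 ?ip0l// !big_ord_recr ipDl IHm.
  rewrite (ips _ (fun i => T (u i *: ket i))) (ips _ (fun i => u i *: ket i)).
  by apply: eq_bigr => i _; rewrite (linZ _ _ Tl) !ipZl bk.
apply/subr0_eq/sqrt_sq2_eq0 => e e0; pose c := 2 * (B * nrm v) + 1.
have c0 : 0 < c by rewrite ltr_wpDl// !mulr_ge0// nrm_ge0.
have [n /(_ n (leqnn n)) un] := trunc_near u (divr_gt0 e0 c0).
set w := u - trunc n u in un.
rewrite (_ : _ - _ = ip (T w) v - ip w (adj T v)); last first.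
  by rewrite /w (linB _ _ Tl) !ipBl tr opprB addrA subrK.
apply: le_trans (sqrt_sq2D _ _) _; rewrite sqrt_sq2N.
apply: le_trans (lerD (abs_ip_le _ _) (abs_ip_le _ _)) _.
apply: (@le_trans _ _ (c * nrm w)); last by rewrite mulrC -ler_pdivlMr// ltW.
have h1 : nrm (T w) * nrm v <= B * nrm v * nrm w.
  by rewrite mulrAC ler_wpM2r ?nrm_ge0// TB.
have h2 : nrm w * nrm (adj T v) <= B * nrm v * nrm w.
  by rewrite mulrC ler_wpM2r ?nrm_ge0//; exact: adj_bnd.
by have := nrm_ge0 w; rewrite /c; move: h1 h2; lra.
Qed.

Lemma adj_linear T B : linear T -> 0 <= B -> bnd T B -> linear (adj T).
Proof.
move=> Tl B0 TB a u v; apply: eq_ip => w.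
by rewrite -(adjP _ _ Tl B0 TB) !ipDr !ipZr !(adjP _ _ Tl B0 TB).
Qed.

Lemma adjK T B : linear T -> 0 <= B -> bnd T B -> adj (adj T) = T.
Proof.
move=> Tl B0 TB; apply/funext => u; apply: eq_ip => w.
rewrite -(adjP _ _ (adj_linear Tl B0 TB) B0 (adj_bnd Tl B0 TB)).
by rewrite ipC -(adjP _ _ Tl B0 TB) -ipC.
Qed.

End Operators.

(** * The Pauli cocycle and the twisted translations *)

(* A natural number stands for the finite set of the positions of its binary
   digits 1; [Nat.lxor] is the symmetric difference. *)
Section Bits.
Implicit Types (g h k n S T : nat).
Definition tb k i := Nat.testbit k i.
Arguments tb : simpl never.
Definition xr g h := Nat.lxor g h.
Arguments xr : simpl never.
Local Open Scope nat_scope.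

Lemma expn_pow n : 2 ^ n = Nat.pow 2 n.
Proof. by elim: n => // n IHn; rewrite expnS IHn. Qed.

Lemma lt_exp2P S n : (S < 2 ^ n) <-> forall i, n <= i -> tb S i = false.
Proof.
rewrite expn_pow; split=> [/ssrnat.ltP Sn i /ssrnat.leP ni|Sh].
  by rewrite -(Nat.mod_small _ _ Sn); exact: Nat.mod_pow2_bits_high.
have -> : S = Nat.modulo S (Nat.pow 2 n).
  apply: Nat.bits_inj => i; have [in_|ni] := ltnP i n.
    by rewrite Nat.mod_pow2_bits_low//; exact/ssrnat.ltP.
  by rewrite [LHS]Sh// Nat.mod_pow2_bits_high//; exact/ssrnat.leP.
by apply/ssrnat.ltP/Nat.mod_upper_bound/Nat.pow_nonzero.
Qed.

Lemma tb_xr g h i : tb (xr g h) i = tb g i (+) tb h i.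
Proof. by rewrite /tb Nat.lxor_spec; case: (Nat.testbit g i); case: (Nat.testbit h i). Qed.

Lemma xrA g h k : xr g (xr h k) = xr (xr g h) k.
Proof. by rewrite /xr Nat.lxor_assoc. Qed.

Lemma xrC g h : xr g h = xr h g. Proof. exact: Nat.lxor_comm. Qed.

Lemma xrK g k : xr g (xr g k) = k.
Proof. by rewrite xrA /xr Nat.lxor_nilpotent Nat.lxor_0_l. Qed.

Lemma xr_inj g : injective (xr g). Proof. exact: can_inj (xrK g). Qed.

Lemma xr0 g : xr 0 g = g. Proof. exact: Nat.lxor_0_l. Qed.

Lemma xrr0 g : xr g 0 = g. Proof. exact: Nat.lxor_0_r. Qed.

Lemma xrr g : xr g g = 0. Proof. exact: Nat.lxor_nilpotent. Qed.

Lemma xr_lt n g k : g < 2 ^ n -> (xr g k < 2 ^ n) = (k < 2 ^ n).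
Proof.
suff lt h : g < 2 ^ n -> h < 2 ^ n -> xr g h < 2 ^ n.
  by move=> gn; apply/idP/idP => [/(lt _ gn)|/(lt _ gn)//]; rewrite xrK.
move=> /lt_exp2P gn /lt_exp2P hn; apply/lt_exp2P => i ni.
by rewrite tb_xr gn// hn.
Qed.

Definition bit k := Nat.pow 2 k.

Lemma tb_bit k i : tb (bit k) i = (k == i).
Proof. by rewrite /tb Nat.pow2_bits_eqb; case: eqP => [->|/Nat.eqb_neq//]; rewrite Nat.eqb_refl. Qed.

Lemma tb_ge k i : k <= i -> tb k i = false.
Proof. by apply: (lt_exp2P k k).1; exact: ltn_expl. Qed.

(* The Pauli cocycle: digits [2i+1] of [g] are paired with digits [2i] of [h]. *)
Definition beta g h :=
  \big[addb/false]_(i < g) (tb g i.*2.+1 && tb h i.*2).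

Lemma beta_widen n g h : g <= n ->
  beta g h = \big[addb/false]_(i < n) (tb g i.*2.+1 && tb h i.*2).
Proof.
move=> gn; rewrite /beta -!(big_mkord xpredT (fun i => tb g i.*2.+1 && tb h i.*2)).
rewrite [RHS](big_cat_nat (n := g))//= [X in _ (+) X]big_nat_cond.
rewrite [X in _ (+) X]big1 ?addbF// => i /andP[/andP[gi _] _].
have gi2 : g <= i.*2.+1 by rewrite -addnn leqW // (leq_trans gi) // leq_addl.
by rewrite (tb_ge gi2).
Qed.

Lemma beta_xl g h k : beta (xr g h) k = beta g k (+) beta h k.
Proof.
set n := maxn (xr g h) (maxn g h).
rewrite !(@beta_widen n) ?leq_maxl ?leq_max ?leqnn ?orbT//.
rewrite -big_split; apply: eq_bigr => i _; rewrite tb_xr.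
by case: (tb g _); case: (tb h _); case: (tb k _).
Qed.

Lemma beta_xr g h k : beta g (xr h k) = beta g h (+) beta g k.
Proof.
rewrite -big_split; apply: eq_bigr => i _; rewrite tb_xr.
by case: (tb g _); case: (tb h _); case: (tb k _).
Qed.

Lemma beta0l g : beta 0 g = false.
Proof. by rewrite /beta big_ord0. Qed.

Lemma beta0r g : beta g 0 = false.
Proof. by rewrite /beta big1// => i _; rewrite /tb Nat.bits_0 andbF. Qed.

Lemma beta_bitl k g : beta (bit k) g = odd k && tb g k.-1.
Proof.
have kb : k./2 < bit k.
  rewrite /bit -expn_pow; apply: leq_trans (ltn_expl k (ltnSn 1)).
  by rewrite ltnS leq_half_double -addnn leqW// leq_addl.
have [ok|ek] := boolP (odd k).
  have kE : k = k./2.*2.+1 by rewrite -[LHS]odd_double_half ok.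
  rewrite /beta (bigD1 (Ordinal kb)) //= tb_bit -kE eqxx /= big1 ?addbF.
    by rewrite [in tb g k.-1]kE.
  move=> i; rewrite -(inj_eq val_inj) /= tb_bit => ik.
  by case: eqP => //= ki; case/eqP: ik; have := congr1 half ki; rewrite /= uphalf_double => ->.
rewrite /beta big1// => i _; rewrite tb_bit; case: eqP => //= ki.
by have := congr1 odd ki; rewrite /= odd_double (negPf ek).
Qed.

Lemma beta_bitr k g : beta g (bit k) = ~~ odd k && tb g k.+1.
Proof.
have [ok|ek] := boolP (odd k).
  rewrite /beta big1// => i _; rewrite tb_bit; case: eqP => [ki|]; last by rewrite andbF.
  by have := congr1 odd ki; rewrite odd_double ok.
have kE : k = k./2.*2 by rewrite -[LHS]odd_double_half (negPf ek).
have [kb|gk] := ltnP k./2 g.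
  rewrite /beta (bigD1 (Ordinal kb)) //= tb_bit -kE eqxx andbT big1 ?addbF//.
  move=> i; rewrite -(inj_eq val_inj) /= tb_bit => ik.
  by case: eqP => [ki|]; [case/eqP: ik; have := congr1 half ki; rewrite doubleK => ->|rewrite andbF].
rewrite tb_ge; last by rewrite kE ltnW// ltnS -addnn (leq_trans gk)// leq_addl.
rewrite /beta big1// => i _; rewrite tb_bit; case: eqP => [ki|]; last by rewrite andbF.
by have := congr1 half ki; rewrite doubleK => ki2; move: gk; rewrite ki2 leqNgt ltn_ord.
Qed.

(* Translates by [bit (partner k)] anticommute with those having [k]. *)
Definition partner k := if odd k then k.-1 else k.+1.

(** The sign in the commutation relation of the translations by [g] and [h]. *)
Definition omega g h := beta g h (+) beta h g.

Lemma omega_bit k g : omega (bit (partner k)) g = tb g k.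
Proof.
rewrite /omega beta_bitl beta_bitr /partner; case ok: (odd k); last first.
  by rewrite /= ok /= addbF.
by case: k ok => //= k ok; rewrite (negPf ok).
Qed.

End Bits.

(** * Twisted translations, diagonal sign unitaries and strong limits *)

Section Shifts.
Variable R : realType.
Notation C := R[i].
Notation H := (l2 R).
Implicit Types (u v w : H) (T S : H -> H) (B : R) (g h k n : nat).
Implicit Types (c : nat -> bool) (s : nat -> bool).

Lemma sum_xr (V : zmodType) (F : nat -> V) g n : (g < 2 ^ n)%N ->
  \sum_(i < 2 ^ n) F (xr g i) = \sum_(i < 2 ^ n) F i.
Proof.
move=> gn; pose f (k : 'I_(2 ^ n)) := Ordinal (etrans (xr_lt k gn) (ltn_ord k)).
rewrite [RHS](reindex_inj (h := f))//= => i j /(congr1 val)/xr_inj.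
exact: val_inj.
Qed.

Lemma sq2_sign (b : bool) (z : C) : sq2 ((-1) ^+ b * z) = sq2 z.
Proof.
rewrite mulr_sign; case: b => //.
by rewrite /sq2 reN imN !sqrrN.
Qed.

Lemma qsum_ws c g n u : (g < 2 ^ n)%N ->
  qsum n (fun k => (-1) ^+ c k * u (xr g k)) = qsum n u.
Proof.
move=> gn; rewrite /qsum -(sum_xr (fun i => sq2 (u i)) gn).
by apply: eq_bigr => i _; rewrite sq2_sign.
Qed.

Lemma ws_bounded c g u : bounded_sums (fun k => (-1) ^+ c k * u (xr g k)).
Proof.
exists (sqn u) => n; apply: le_trans (qsum_mono _ (leq_maxl n g)) _.
rewrite qsum_ws ?qsum_le//; apply: leq_trans (ltn_expl g (ltnSn 1)) _.
by rewrite leq_exp2l// leq_maxr.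
Qed.

Definition ws c g u : H := L2 (@ws_bounded c g u).

Lemma wsE c g u k : ws c g u k = (-1) ^+ c k * u (xr g k). Proof. by []. Qed.

Lemma ws_linear c g : linear (ws c g).
Proof.
move=> a u v; apply/l2_inj/funext => k; rewrite !(wsE, l2D, l2Z); ring.
Qed.

Lemma ws_comp c g c' h u :
  ws c g (ws c' h u) = ws (fun k => c k (+) c' (xr g k)) (xr h g) u.
Proof.
by apply/l2_inj/funext => k; rewrite !wsE mulrA -signr_addb xrA.
Qed.

Lemma ws0 u : ws (fun=> false) 0 u = u.
Proof. by apply/l2_inj/funext => k; rewrite wsE mul1r xr0. Qed.

Lemma ws_sign (b : bool) c g u : ws (fun k => b (+) c k) g u = (-1) ^+ b *: ws c g u.
Proof. by apply/l2_inj/funext => k; rewrite l2Z !wsE signr_addb mulrA. Qed.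

Lemma wsK c g u : ws (fun k => c (xr g k)) g (ws c g u) = u.
Proof. by rewrite ws_comp xrr -[RHS]ws0; congr ws; apply/funext => k; rewrite addbb. Qed.

Lemma sqn_ws c g u : sqn (ws c g u) = sqn u.
Proof.
have le d v : sqn (ws d g v) <= sqn v.
  apply: sqn_le => n; apply: le_trans (qsum_mono _ (leq_maxl n g)) _.
  rewrite qsum_ws ?qsum_le//; apply: leq_trans (ltn_expl g (ltnSn 1)) _.
  by rewrite leq_exp2l// leq_maxr.
by apply/eqP; rewrite eq_le le/= -{1}(wsK c g u) le.
Qed.

Lemma nrm_ws c g u : nrm (ws c g u) = nrm u.
Proof. by rewrite /nrm sqn_ws. Qed.

Lemma ws_bnd c g : bnd (ws c g) 1.
Proof. by move=> u; rewrite nrm_ws mul1r. Qed.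

Lemma ip_ws c g u v : ip (ws c g u) v = ip u (ws (fun k => c (xr g k)) g v).
Proof.
have E n : (g <= n)%N -> psum n (ws c g u) v = psum n u (ws (fun k => c (xr g k)) g v).
  move=> gn; have {}gn : (g < 2 ^ n)%N.
    by apply: leq_trans (ltn_expl g (ltnSn 1)) _; rewrite leq_exp2l.
  rewrite /psum -(sum_xr (fun k => ws c g u k * (v k)^*) gn).
  apply: eq_bigr => i _; rewrite !wsE xrK rmorphM rmorph_sign /=; ring.
have [ur ui] := ip_cvg (ws c g u) v.
apply: cvgC_unique (ip_cvg _ _); split; [apply: cvg_trans ur|apply: cvg_trans ui];
  by apply: near_eq_cvg; exists g => // n /= gn; rewrite E.
Qed.

Definition Lsh g := ws (fun k => beta g (xr g k)) g.
Definition Rsh g := ws (fun k => beta (xr g k) g) g.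

Lemma RshE g u k : Rsh g u k = (-1) ^+ beta (xr g k) g * u (xr g k).
Proof. by []. Qed.

Lemma LshE g u k : Lsh g u k = (-1) ^+ beta g (xr g k) * u (xr g k).
Proof. by []. Qed.

(** Associativity of the twisted product: the signs agree because [beta] is bilinear. *)
Lemma Lsh_Rsh g h u : Lsh g (Rsh h u) = Rsh h (Lsh g u).
Proof.
rewrite /Lsh /Rsh !ws_comp [xr g h]xrC; congr ws; apply/funext => k.
rewrite !(beta_xl, beta_xr).
by do 5!case: (beta _ _).
Qed.

Lemma Rsh_ket0 g : Rsh g (ket R 0) = ket R g.
Proof.
apply/l2_inj/funext => k; rewrite wsE !ketE.
have [->|kg] := eqVneq k g; first by rewrite xrr beta0l mul1r.
case: eqP => [gk|]; last by rewrite mulr0.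
by case/eqP: kg; rewrite -(xrK g k) gk xrr0.
Qed.

Lemma Lsh_ket0 g : Lsh g (ket R 0) = ket R g.
Proof.
apply/l2_inj/funext => k; rewrite wsE !ketE.
have [->|kg] := eqVneq k g; first by rewrite xrr beta0r mul1r.
case: eqP => [gk|]; last by rewrite mulr0.
by case/eqP: kg; rewrite -(xrK g k) gk xrr0.
Qed.

Lemma ip_Rsh g u v : ip (Rsh g u) v = ip u ((-1) ^+ beta g g *: Rsh g v).
Proof.
rewrite /Rsh /Lsh ip_ws -ws_sign; congr ip; congr ws; apply/funext => k.
by rewrite xrK beta_xl addKb.
Qed.

Lemma ip_Lsh g u v : ip (Lsh g u) v = ip u ((-1) ^+ beta g g *: Lsh g v).
Proof.
rewrite /Rsh /Lsh ip_ws -ws_sign; congr ip; congr ws; apply/funext => k.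
by rewrite xrK beta_xr addKb.
Qed.

Definition chi s k := \big[addb/false]_(i < k) (tb k i && s i).

Lemma chi_widen n s k : (k <= n)%N ->
  chi s k = \big[addb/false]_(i < n) (tb k i && s i).
Proof.
move=> kn; rewrite /chi -!(big_mkord xpredT (fun i => tb k i && s i)).
rewrite [RHS](big_cat_nat (n := k))//= [X in _ (+) X]big_nat_cond.
by rewrite [X in _ (+) X]big1 ?addbF// => i /andP[/andP[ki _] _]; rewrite tb_ge.
Qed.

Lemma chi_xr s g k : chi s (xr g k) = chi s g (+) chi s k.
Proof.
set n := maxn (xr g k) (maxn g k).
rewrite !(@chi_widen n) ?leq_maxl ?leq_max ?leqnn ?orbT//.
rewrite -big_split; apply: eq_bigr => i _; rewrite tb_xr.
by case: (tb g i); case: (tb k i); case: (s i).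
Qed.

Lemma chiD s s' k : chi (fun i => s i (+) s' i) k = chi s k (+) chi s' k.
Proof.
rewrite -big_split; apply: eq_bigr => i _.
by case: (tb k i); case: (s i); case: (s' i).
Qed.

Lemma chi0 s : chi s 0 = false. Proof. by rewrite /chi big_ord0. Qed.

Lemma eq_chi s s' k : s =1 s' -> chi s k = chi s' k.
Proof. by move=> /funext ->. Qed.

Lemma chi_false k : chi (fun=> false) k = false.
Proof. by rewrite /chi big1// => i _; rewrite andbF. Qed.

Lemma chi_single j k : chi (fun i => i == j) k = tb k j.
Proof.
have [kj|jk] := leqP k j.
  rewrite tb_ge// /chi big1// => i _; rewrite ltn_eqF ?andbF//.
  exact: leq_trans kj.
rewrite /chi (bigD1 (Ordinal jk)) //= eqxx andbT big1 ?addbF// => i.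
by rewrite -(inj_eq val_inj) /= => /negPf ->; rewrite andbF.
Qed.

(** The unitary implementing the action of sign vectors: conjugating by it multiplies the
    coefficient at [k] by the sign given by [chi s k]. *)
Definition Usg s := ws (chi s) 0.

Lemma UsgE s u k : Usg s u k = (-1) ^+ chi s k * u k.
Proof. by rewrite wsE xr0. Qed.

Lemma Usg_comp s s' u : Usg s (Usg s' u) = Usg (fun i => s i (+) s' i) u.
Proof. by apply/l2_inj/funext => k; rewrite !UsgE chiD signr_addb mulrA. Qed.

Lemma Usg0 u : Usg (fun=> false) u = u.
Proof. by apply/l2_inj/funext => k; rewrite UsgE chi_false mul1r. Qed.

Lemma UsgK s : involutive (Usg s).
Proof.
move=> u; rewrite Usg_comp -[RHS]Usg0; congr Usg.
by apply/funext => i; rewrite addbb.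
Qed.

Lemma Usg_ket0 s : Usg s (ket R 0) = ket R 0.
Proof.
apply/l2_inj/funext => -[|k]; rewrite UsgE ketE; first by rewrite chi0 mul1r.
by rewrite mulr0.
Qed.

Lemma Usg_Rsh s g u : Usg s (Rsh g u) = (-1) ^+ chi s g *: Rsh g (Usg s u).
Proof.
apply/l2_inj/funext => k; rewrite l2Z UsgE !RshE UsgE chi_xr signr_addb.
by case: (chi s g); case: (chi s k); rewrite /=; ring.
Qed.

Definition slim (f : nat -> H) (l : H) :=
  forall e, 0 < e -> exists N, forall n, (N <= n)%N -> nrm (f n - l) < e.

Lemma slim_unique f l l' : slim f l -> slim f l' -> l = l'.
Proof.
move=> fl fl'; apply: eq_of_near => e e0; have e2 : 0 < e / 2 by rewrite divr_gt0.
have [N NP] := fl _ e2; have [N' NP'] := fl' _ e2.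
have := NP _ (leq_maxl N N'); have := NP' _ (leq_maxr N N').
set n := maxn N N' => h1 h2; rewrite -(subrKA (f n)).
apply: le_trans (nrmD _ _) _; rewrite nrmB [leRHS]splitr; exact: lerD (ltW h2) (ltW h1).
Qed.

Lemma slim_le f l (c : R) : (forall n, nrm (f n) <= c) -> slim f l -> nrm l <= c.
Proof.
move=> fc fl; apply/ler_addgt0Pl => e /fl[N /(_ N (leqnn N))] Ne.
rewrite -(subrK (f N) l); apply: le_trans (nrmD _ _) _.
by rewrite nrmB lerD// ltW.
Qed.

Lemma slim_cst l : slim (fun=> l) l.
Proof. by move=> e e0; exists 0%N => n _; rewrite subrr nrm0. Qed.

Lemma slim_map f l T B : linear T -> bnd T B -> slim f l -> slim (fun n => T (f n)) (T l).
Proof.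
move=> Tl TB fl e e0; pose D := `|B| + 1.
have D0 : 0 < D by rewrite ltr_wpDl.
have [N NP] := fl _ (divr_gt0 e0 D0); exists N => n /NP.
rewrite -(linB _ _ Tl) ltr_pdivlMr// mulrC; apply: le_lt_trans.
apply: le_trans (TB _) _; rewrite ler_wpM2r ?nrm_ge0//.
by apply: le_trans (ler_norm B) _; rewrite /D lerDl.
Qed.

Lemma slimD f f' l l' : slim f l -> slim f' l' -> slim (fun n => f n + f' n) (l + l').
Proof.
move=> fl fl' e e0; have e2 : 0 < e / 2 by rewrite divr_gt0.
have [N NP] := fl _ e2; have [N' NP'] := fl' _ e2.
exists (maxn N N') => n; rewrite geq_max => /andP[/NP h1 /NP' h2].
rewrite opprD addrACA; apply: le_lt_trans (nrmD _ _) _.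
by rewrite [ltRHS]splitr ltrD.
Qed.

Lemma slimZ a f l : slim f l -> slim (fun n => a *: f n) (a *: l).
Proof.
apply: (@slim_map _ _ ( *:%R a) (Num.sqrt (sq2 a))).
  by move=> b u v; rewrite scalerDr !scalerA mulrC.
by move=> u; rewrite nrmZ.
Qed.

Definition scauchy (f : nat -> H) :=
  forall e, 0 < e -> exists N, forall m n, (N <= m)%N -> (N <= n)%N -> nrm (f m - f n) < e.

Lemma scauchy_slim f : scauchy f -> exists l, slim f l.
Proof.
move=> fc; have : cvg (f @ \oo).
  apply: cauchy_cvg; apply: cauchy_exP => _ /ltcR_gt0[r r0 ->].
  have [N NP] := fc _ r0; exists (f N), N => // n /= Nn.
  by rewrite -ball_normE /= l2_norm ltcR NP.
move=> /cvg_ex[l /cvg_ballP fl]; exists l => e e0.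
have [|N _ NP] := fl e%:C; first by rewrite ltcR.
by exists N => n /NP; rewrite -ball_normE /= l2_norm ltcR nrmB.
Qed.

Definition inCR T := forall g u, T (Rsh g u) = Rsh g (T u).

(** The value at [ket k] is [Rsh k] of the value at [ket 0], so convergence at this one vector
    spreads to finitely supported vectors, and by the common bound [B] to all of l2. *)
Lemma strong_limit (f : nat -> H -> H) B : 0 <= B ->
  (forall n, linear (f n)) -> (forall n, bnd (f n) B) -> (forall n, inCR (f n)) ->
  scauchy (fun n => f n (ket R 0)) ->
  exists T, [/\ linear T, bnd T B, inCR T & forall u, slim (fun n => f n u) (T u)].
Proof.
move=> B0 fl fB fR fc.
have fb k : exists l, slim (fun n => f n (ket R k)) l.
  have [l ll] := scauchy_slim fc; exists (Rsh k l).
  rewrite (_ : (fun n => _) = fun n => Rsh k (f n (ket R 0))).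
    exact: slim_map (ws_linear _ _) (ws_bnd _ _) ll.
  by apply/funext => n; rewrite -fR Rsh_ket0.
have ft n u : exists l, slim (fun m => f m (trunc n u)) l.
  rewrite trunc_sum; elim: (2 ^ n)%N => [|m [l IHm]].
    exists 0; rewrite (_ : (fun n => _) = fun=> 0); first exact: slim_cst.
    by apply/funext => m; rewrite big_ord0 (lin0 (fl m)).
  have [l' ll'] := fb m; exists (l + u m *: l').
  rewrite (_ : (fun n => _) = fun n => f n (\sum_(i < m) u i *: ket R i) +
    u m *: f n (ket R m)); first exact: slimD IHm (slimZ _ ll').
  by apply/funext => j; rewrite big_ord_recr (linD _ _ (fl j)) (linZ _ _ (fl j)).
have [T TP] : {T : H -> H & forall u, slim (fun n => f n u) (T u)}.
  apply: (@choice _ _ (fun u l => slim (fun n => f n u) l)) => u.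
  apply: scauchy_slim => e e0; have B1 : 0 < 4 * (B + 1) by rewrite mulr_gt0// ltr_wpDl.
  have [j /(_ j (leqnn j)) uj] := trunc_near u (divr_gt0 e0 B1).
  have [l /(_ (e / 4))[|N NP]] := ft j u; first by rewrite divr_gt0.
  exists N => m n /NP hm /NP hn; set t := trunc j u in uj hm hn.
  have bd i : nrm (f i u - f i t) < e / 4.
    rewrite -(linB _ _ (fl i)); apply: le_lt_trans (fB i _) _.
    rewrite invfM mulrA ltr_pdivlMr ?ltr_wpDl// in uj; apply: le_lt_trans uj.
    by rewrite mulrC ler_wpM2l ?nrm_ge0// lerDl.
  have hm' := bd m; have hn' := bd n.
  rewrite (_ : f m u - f n u = (f m u - f m t) + (f m t - l) +
    - ((f n u - f n t) + (f n t - l))); last first.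
    by rewrite !addrA !subrK opprB addrA subrK.
  apply: le_lt_trans (nrmD _ _) _; rewrite nrmN.
  have := nrmD (f m u - f m t) (f m t - l); have := nrmD (f n u - f n t) (f n t - l).
  move: hm hn hm' hn'; lra.
exists T; split => //.
- move=> a u v; apply: slim_unique (TP _) _.
  rewrite (_ : (fun n => _) = fun n => a *: f n u + f n v).
    by apply: slimD; [exact: slimZ|].
  by apply/funext => n; exact: fl.
- by move=> u; apply: slim_le (TP u) => n; exact: fB.
- move=> g u; apply: slim_unique (TP _) _.
  rewrite (_ : (fun n => _) = fun n => Rsh g (f n u)).
    exact: slim_map (ws_linear _ _) (ws_bnd _ _) (TP u).
  by apply/funext => n; exact: fR.
Qed.

Lemma inCR_ket T g : inCR T -> T (ket R g) = Rsh g (T (ket R 0)).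
Proof. by move=> TR; rewrite -Rsh_ket0 TR. Qed.

(** The vector [ket 0] is cyclic for the right translations, hence separating for their
    commutant. *)
Lemma inCR_ext T S B D : linear T -> linear S -> bnd T B -> bnd S D ->
  inCR T -> inCR S -> T (ket R 0) = S (ket R 0) -> T = S.
Proof.
move=> Tl Sl TB SD TR SR TS; apply: ext_ket Tl Sl TB SD _ => k.
by rewrite (inCR_ket k TR) (inCR_ket k SR) TS.
Qed.

End Shifts.

(** * The hyperfinite factor *)

Section Commutant.
Variable R : realType.
Notation C := R[i].
Notation H := (l2 R).
Implicit Types (u v w : H) (T S P : H -> H) (B : R) (g h k n : nat).

Lemma inCR_adj T B : linear T -> 0 <= B -> bnd T B -> inCR T -> inCR (adj T).
Proof.
move=> Tl B0 TB TR g u; apply: eq_ip => w.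
have Rr a b : ip a (Rsh g b) = (-1) ^+ beta g g * ip (Rsh g a) b.
  by rewrite ip_Rsh ipZr rmorph_sign /= signrMK.
by rewrite -(adjP _ _ Tl B0 TB) !Rr -TR -(adjP _ _ Tl B0 TB).
Qed.

Lemma adj_ket0 T B k : linear T -> 0 <= B -> bnd T B -> inCR T ->
  adj T (ket R 0) k = (-1) ^+ beta k k * (T (ket R 0) k)^*.
Proof.
move=> Tl B0 TB TR; rewrite (adjE _ _ Tl B0 TB) (inCR_ket k TR) ip_Rsh ipZr rmorph_sign.
by rewrite Rsh_ket0 ip_ket rmorphM rmorph_sign.
Qed.

(** By [adj_ket0] both sides are the sum over [k] of [(-1) ^+ beta k k] times the coefficients of
    [S] and of [T] at [k], which is symmetric in the two operators. *)
Lemma tau_tracial T S B D : linear T -> linear S -> 0 <= B -> 0 <= D ->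
  bnd T B -> bnd S D -> inCR T -> inCR S ->
  ip (T (S (ket R 0))) (ket R 0) = ip (S (T (ket R 0))) (ket R 0).
Proof.
move=> Tl Sl B0 D0 TB SD TR SR; rewrite [LHS](adjP _ _ Tl B0 TB) [RHS](adjP _ _ Sl D0 SD).
have E n : psum n (S (ket R 0)) (adj T (ket R 0)) = psum n (T (ket R 0)) (adj S (ket R 0)).
  apply: eq_bigr => i _; rewrite (adj_ket0 _ Tl B0 TB TR) (adj_ket0 _ Sl D0 SD SR).
  rewrite !rmorphM !rmorph_sign /= !conjCK; ring.
apply: cvgC_unique (ip_cvg _ _) _.
by have := ip_cvg (T (ket R 0)) (adj S (ket R 0)); under eq_fun do rewrite -E.
Qed.

Lemma bounded_op_id : bounded_op (idfun : H -> H).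
Proof.
by apply/bounded_opP; split=> [a u v //|]; exists 1 => // u; rewrite mul1r.
Qed.

Lemma bounded_op_comp T S : bounded_op T -> bounded_op S -> bounded_op (T \o S).
Proof.
move=> /bounded_opP[Tl [B B0 TB]] /bounded_opP[Sl [D D0 SD]]; apply/bounded_opP.
split=> [a u v|]; first by rewrite /= Sl Tl.
exists (B * D) => [|u]; first exact: mulr_ge0.
by apply: le_trans (TB _) _; rewrite -mulrA ler_wpM2l// SD.
Qed.

Lemma bounded_op_lincomb a T S : bounded_op T -> bounded_op S ->
  bounded_op (fun x => a *: T x + S x).
Proof.
move=> /bounded_opP[Tl [B B0 TB]] /bounded_opP[Sl [D D0 SD]]; apply/bounded_opP.
split=> [b u v|].
  by rewrite Sl Tl !scalerDr !scalerA [a * b]mulrC addrACA.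
exists (Num.sqrt (sq2 a) * B + D) => [|u].
  by rewrite addr_ge0// mulr_ge0// sqrtr_ge0.
apply: le_trans (nrmD _ _) _; rewrite nrmZ mulrDl lerD// -mulrA.
by rewrite ler_wpM2l ?sqrtr_ge0.
Qed.

Lemma bounded_op_adj T : bounded_op T -> bounded_op (adj T).
Proof.
move=> /bounded_opP[Tl [B B0 TB]]; apply/bounded_opP.
split; first exact: adj_linear TB.
by exists B => //; exact: adj_bnd.
Qed.

Lemma adjointP T : bounded_op T -> adjoint_op T (adj T).
Proof. by move=> /bounded_opP[Tl [B B0 TB]] u v; exact: adjP Tl B0 TB. Qed.

Lemma bounded_op_ws c g : bounded_op (@ws R c g).
Proof.
apply/bounded_opP; split; first exact: ws_linear.
by exists 1 => //; exact: ws_bnd.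
Qed.

Definition commutant (I : Type) (U : I -> H -> H) : set (H -> H) :=
  [set T | bounded_op T /\ forall i u, T (U i u) = U i (T u)].

(** The second hypothesis says that the family is closed under adjoints up to scalars; stability of
    the commutant under adjoints and weak limits rests on it. *)
Lemma commutant_vna (I : Type) (U : I -> H -> H) :
  (forall i, linear (U i)) ->
  (forall i, exists c, forall u v, ip (U i u) v = ip u (c *: U i v)) ->
  von_neumann_algebra (commutant U).
Proof.
move=> Ul Ua; split.
- by move=> T [].
- by split; first exact: bounded_op_id.
- move=> a T S [Tb TU] [Sb SU]; split; first exact: bounded_op_lincomb.
  by move=> i u; rewrite TU SU (linD _ _ (Ul i)) (linZ _ _ (Ul i)).
- move=> T S [Tb TU] [Sb SU]; split; first exact: bounded_op_comp.
  by move=> i u; rewrite /= SU TU.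
- move=> T [Tb TU]; exists (adj T); last exact: adjointP.
  split; first exact: bounded_op_adj.
  move=> i u; apply: eq_ip => w; have [c cU] := Ua i.
  have Tw v v' : ip v (adj T v') = ip (T v) v' := esym (adjointP Tb v v').
  have Uw v v' : ip (U i v) v' = c^* * ip v (U i v') by rewrite cU ipZr.
  have Uw' v v' : ip v (U i v') = c * ip (U i v) v'.
    by rewrite ipC Uw rmorphM /= conjCK -ipC.
  by rewrite Tw Uw' -TU -Tw -Uw'.
- move=> T Tb TA; split => // i u; have [c cU] := Ua i.
  apply: eq_ip => w; rewrite [LHS]ipC [RHS]ipC; congr (_^*).
  apply/subr0_eq/sqrt_sq2_eq0 => e e0.
  have e2 : 0 < (e / 2)%:C :> C by rewrite ltcR divr_gt0.
  (* Tested against [w], the commutation relation involves only two matrix entries of [T], because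
     [c *: U i w] is the adjoint of [U i] applied to [w]. *)
  have [S [Sb SU] /= SP] := TA [:: (U i u, w); (u, c *: U i w)] _ e2.
  have := SP (U i u, w) (mem_head _ _).
  have := SP (u, c *: U i w) ltac:(by rewrite inE mem_head orbT).
  rewrite /= !innerE !normE !ltcR -cU => h1 h2.
  rewrite (_ : _ - _ = ip (T (U i u) - S (U i u)) w - ip (U i (T u - S u)) w).
    apply: le_trans (sqrt_sq2D _ _) _; rewrite sqrt_sq2N [leRHS]splitr.
    by apply: lerD; exact: ltW.
  by rewrite (linB _ _ (Ul i)) !ipBl SU opprB addrA subrK.
Qed.

Definition CR := commutant (@Rsh R).

Lemma CR_vna : von_neumann_algebra CR.
Proof.
apply: commutant_vna => g; first exact: ws_linear.
by exists ((-1) ^+ beta g g) => u v; rewrite ip_Rsh.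
Qed.

Lemma CR_eq T S : CR T -> CR S -> T (ket R 0) = S (ket R 0) -> T = S.
Proof.
move=> [/bounded_opP[Tl [B B0 TB]] TR] [/bounded_opP[Sl [D D0 SD]] SR].
exact: inCR_ext TB SD TR SR.
Qed.

Lemma Lsh_CR g : CR (Lsh g).
Proof. by split; [exact: bounded_op_ws|move=> h u; rewrite Lsh_Rsh]. Qed.

Lemma scale_CR a : CR (fun x => a *: x).
Proof.
have [_ id_CR lin_CR _ _ _] := CR_vna.
have := lin_CR a idfun (fun x => (-1) *: x + x) id_CR (lin_CR _ _ _ id_CR id_CR).
by congr CR; apply/funext => u /=; rewrite scaleN1r addNr addr0.
Qed.

Lemma tb_neq0 h : h <> 0%N -> exists j, tb h j.
Proof.
move=> h0; apply: contrapT => /forallNP hj; apply: h0.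
by apply: Nat.bits_inj_0 => j; apply/negbTE/negP; exact: hj.
Qed.

Lemma eq_opp0 (z : C) : z = - z -> z = 0.
Proof.
move=> /eqP; rewrite -subr_eq0 opprK -mulr2n mulrn_eq0 /=.
by move/eqP.
Qed.

(* Comparing coefficients of [L_g xi] and [R_g xi]. *)
Lemma Lsh_eq_Rsh u g k : Lsh g u = Rsh g u -> omega g k -> u k = 0.
Proof.
move=> /(congr1 (fun v : H => v (xr g k))); rewrite LshE RshE xrK /omega.
case: (beta g k); case: (beta k g) => //= + _; rewrite mul1r expr1 mulN1r.
  by move=> /esym /eq_opp0.
exact: eq_opp0.
Qed.

(** A central operator commutes with the left translation by [bit (partner j)], which kills its
    coefficients at all sets containing [j]. Only the empty set contains no [j]. *)
Lemma CR_factor : Defs.factor CR.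
Proof.
split; first exact: CR_vna.
  exists (ket R 0); apply/eqP => /(congr1 (@nrm R)); rewrite nrm_ket nrm0.
  by apply/eqP; rewrite oner_neq0.
move=> T TCR Tcomm; have [_ TR] := TCR; exists (T (ket R 0) 0%N); apply: CR_eq TCR (scale_CR _) _.
apply/l2_inj/funext => k; rewrite l2Z ketE.
have [->|/eqP k0] := eqVneq k 0%N; first by rewrite mulr1.
have [j kj] := tb_neq0 k0; rewrite mulr0.
apply: (@Lsh_eq_Rsh _ (bit (partner j))); last by rewrite omega_bit.
have := congr1 (fun f => f (ket R 0)) (Tcomm _ (Lsh_CR (bit (partner j)))).
by rewrite /= Lsh_ket0 (inCR_ket _ TR).
Qed.

(** The vector state at [ket 0] is a trace, so [Q] has the trace of the identity. Then [Q] fixes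
    [ket 0], which determines an element of [CR]. *)
Lemma CR_finite : finite_projection CR idfun.
Proof.
have [bCR id_CR lin_CR _ _ _] := CR_vna.
split; first by split.
move=> Q [QCR QQ Qa] _ [V [W [VCR WCR _ WV VW]]].
apply: (CR_eq QCR id_CR) => /=.
have tauQ : ip (Q (ket R 0)) (ket R 0) = ip (ket R 0) (ket R 0).
  have [[/bounded_opP[Vl [B B0 VB]] VR] [/bounded_opP[Wl [D D0 WD]] WR]] := (VCR, WCR).
  rewrite -VW /= (tau_tracial Vl Wl B0 D0 VB WD VR WR).
  by rewrite -[W (V _)]/((W \o V) _) WV.
have QQ0 : Q (Q (ket R 0)) = Q (ket R 0) by rewrite -[LHS]/((Q \o Q) _) QQ.
have Qa' u v : ip (Q u) v = ip u (Q v) by exact: Qa.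
apply/subr0_eq/sqn_eq0; rewrite sqnE ipBl !ipBr -!Qa' QQ0 tauQ !subrr.
by [].
Qed.

Lemma Rsh_anticomm g h u : Rsh g (Rsh h u) = (-1) ^+ omega g h *: Rsh h (Rsh g u).
Proof.
rewrite /Rsh !ws_comp -ws_sign [xr h g]xrC; congr ws; apply/funext => k.
rewrite /omega !(beta_xl, beta_xr).
by do 6!case: (beta _ _).
Qed.

Lemma Lsh_Rsh_trunc n u g : (forall k, (k < 2 ^ n)%N -> omega g k = false) ->
  Lsh g (trunc n u) = Rsh g (trunc n u).
Proof.
move=> gn; apply/l2_inj/funext => k; rewrite LshE RshE truncE.
have [/gn|_] := ltnP (xr g k) (2 ^ n); last by rewrite !mulr0.
by rewrite /omega; case: (beta g _); case: (beta _ g).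
Qed.

(** Two anticommuting left translations by bits beyond the approximate support of [P (ket 0)] act on
    this vector nearly as right translations, with which [P] commutes. Their compressions by [P]
    nearly anticommute there, so if they commute the vector is arbitrarily small. *)
Lemma CR_no_abelian P : abelian_projection CR P -> P = (fun=> 0).
Proof.
move=> [[PCR PP Pa] Pab].
have P0 : P (ket R 0) = 0; last first.
  have := scale_CR 0; rewrite (_ : (fun x : H => 0 *: x) = fun=> 0) => [z|].
    exact: CR_eq PCR z P0.
  by apply/funext => u; rewrite scale0r.
set xi := P (ket R 0).
have PPE u : P (P u) = P u by rewrite -[LHS]/((P \o P) u) PP.
have [/bounded_opP[Pl _] PR] := PCR.
have P1 u : nrm (P u) <= nrm u.
  have Pa' x y : ip (P x) y = ip x (P y) := Pa x y.
  have PE : ip (P u) u = (nrm (P u) ^+ 2)%:C by rewrite -{1}PPE Pa' ipxx sqr_nrm.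
  have := abs_ip_le (P u) u; rewrite PE /sq2 /= expr0n addr0 sqrtr_sqr.
  rewrite (ger0_norm (sqr_ge0 _)) => h.
  have [->|z] := eqVneq (nrm (P u)) 0; first exact: nrm_ge0.
  by rewrite -(ler_pM2l (_ : 0 < nrm (P u))) ?lt_neqAle ?nrm_ge0 1?eq_sym ?z.
apply: eq_of_near => e e0; rewrite subr0; have e4 : 0 < e / 4 by rewrite divr_gt0.
have [n /(_ n (leqnn n)) xin] := trunc_near xi e4.
(* The bits [2 n] and [2 n + 1] are partners, so the translations anticommute, and both lie beyond
   the first [n] bits. *)
pose gam := bit n.*2; pose del := bit n.*2.+1.
have gE : gam = bit (partner n.*2.+1) by rewrite /gam /partner /= odd_double.
have dE : del = bit (partner n.*2) by rewrite /del /partner odd_double.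
have gn k : (k < 2 ^ n)%N -> omega gam k = false.
  by move=> kn; rewrite gE omega_bit (proj1 (lt_exp2P k n) kn)// -addnn leqW// leq_addr.
have dn k : (k < 2 ^ n)%N -> omega del k = false.
  by move=> kn; rewrite dE omega_bit (proj1 (lt_exp2P k n) kn)// -addnn leq_addr.
have Ll g : linear (@Lsh R g) := ws_linear _ _.
have Rl g : linear (@Rsh R g) := ws_linear _ _.
have near_LR g : (forall k, (k < 2 ^ n)%N -> omega g k = false) ->
    nrm (Lsh g xi - Rsh g xi) <= e / 2.
  move=> g0; rewrite (_ : _ - _ = Lsh g (xi - trunc n xi) - Rsh g (xi - trunc n xi)).
    apply: le_trans (nrmD _ _) _; rewrite nrmN !nrm_ws; lra.
  rewrite (linB _ _ (Ll g)) (linB _ _ (Rl g)).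
  by rewrite Lsh_Rsh_trunc// opprB addrA subrK.
(* Both products of compressions are close to [+-R_gam R_del xi]. *)
have close g h : (forall k, (k < 2 ^ n)%N -> omega g k = false) ->
    (forall k, (k < 2 ^ n)%N -> omega h k = false) ->
    nrm (P (Lsh g (P (Lsh h xi))) - Rsh h (Rsh g xi)) <= e.
  move=> g0 h0; have Rxi k u : P (Rsh k u) = Rsh k (P u) by exact: PR.
  have xiE : P xi = xi by exact: PPE.
  rewrite (_ : _ - _ = P (Lsh g (P (Lsh h xi - Rsh h xi))) +
     Rsh h (P (Lsh g xi - Rsh g xi))); last first.
    rewrite !(linB _ _ Pl) !Rxi xiE (linB _ _ (Ll g)) Lsh_Rsh (linB _ _ Pl) Rxi.
    rewrite (linB _ _ (Rl h)).
    by rewrite addrA subrK.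
  apply: le_trans (nrmD _ _) _; rewrite [leRHS]splitr nrm_ws.
  apply: lerD; apply: le_trans (P1 _) _; last exact: near_LR.
  by rewrite nrm_ws; apply: le_trans (P1 _) (near_LR _ h0).
have := congr1 (fun f => f (ket R 0)) (Pab _ _ (Lsh_CR gam) (Lsh_CR del)).
rewrite /= !PPE -/xi => E.
have h1 := close _ _ gn dn; have := close _ _ dn gn; rewrite -E Rsh_anticomm.
have -> : omega gam del by rewrite gE omega_bit tb_bit eqxx.
rewrite /= expr1 scaleN1r opprK => h2.
set x := P (Lsh gam _) in h1 h2; set y := Rsh del _ in h1 h2.
have yn : nrm y = nrm xi by rewrite /y !nrm_ws.
have : nrm (y + y) <= e + e.
  rewrite (_ : y + y = (x + y) - (x - y)); last first.
    by rewrite opprB [x + y]addrC addrACA subrr addr0.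
  by apply: le_trans (nrmD _ _) _; rewrite nrmN lerD.
have s2 : Num.sqrt (sq2 (2%:R : C)) = 2.
  rewrite (_ : 2%:R = (2 : R)%:C); last by rewrite rmorph_nat.
  by rewrite /sq2 /= expr0n addr0 sqrtr_sqr ger0_norm.
rewrite -mulr2n -scaler_nat nrmZ yn s2; lra.
Qed.

End Commutant.

(** * Separability of the predual *)

Section Predual.
Variable R : realType.
Notation C := R[i].
Notation H := (l2 R).
Implicit Types (u v w : H) (T S P : H -> H) (B : R) (g h k n : nat).

Definition ratc (q : rat * rat) : C := Complex (ratr q.1) (ratr q.2).

Definition ratvec (s : seq (rat * rat)) : H :=
  \sum_(i < size s) ratc (nth (0, 0) s i) *: ket R i.

Lemma ratc_near (z : C) e : 0 < e -> exists q, Num.sqrt (sq2 (z - ratc q)) < e.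
Proof.
move=> e0; have e2 : 0 < e / 2 by rewrite divr_gt0.
have near_rat (x : R) : exists q, `|x - ratr q| < e / 2.
  have [|q] := @rat_in_itvoo R (x - e / 2) (x + e / 2); first by lra.
  by rewrite in_itv /= => /andP[h1 h2]; exists q; rewrite ltr_norml; apply/andP; split; lra.
have [p pz] := near_rat (re z); have [q qz] := near_rat (im z); exists (p, q).
apply: le_lt_trans (sqrt_sq2_le _) _; rewrite reD imD reN imN /=.
by rewrite [ltRHS]splitr ltrD.
Qed.

Lemma ratvec_near u e : 0 < e -> exists s, nrm (u - ratvec s) < e.
Proof.
move=> e0; have e2 : 0 < e / 2 by rewrite divr_gt0.
have [n /(_ n (leqnn n)) un] := trunc_near u e2; pose m := (2 ^ n)%N.
have em : 0 < e / 2 / m.+1%:R by rewrite divr_gt0.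
have [q qP] : {q : nat -> rat * rat & forall i, Num.sqrt (sq2 (u i - ratc (q i))) < e / 2 / m.+1%:R}.
  apply: (@choice _ _ (fun i q => Num.sqrt (sq2 (u i - ratc q)) < e / 2 / m.+1%:R)).
  by move=> i; exact: ratc_near.
exists (mkseq q m); rewrite -(subrKA (trunc n u)) [ltRHS]splitr.
apply: le_lt_trans (nrmD _ _) _; apply: ltr_leD => //.
rewrite trunc_sum /ratvec size_mkseq -sumrB.
rewrite (eq_bigr (fun i : 'I_m => (u i - ratc (q i)) *: ket R i)); last first.
  by move=> i _; rewrite nth_mkseq// -scalerBl.
apply: le_trans (nrm_sum m (fun i => (u i - ratc (q i)) *: ket R i)) _.
apply: (@le_trans _ _ (\sum_(i < m) e / 2 / m.+1%:R)).
  by apply: ler_sum => i _; rewrite nrmZ nrm_ket mulr1 ltW.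
rewrite sumr_const card_ord -[_ *+ _]mulr_natr -mulrA ger_pMr//.
by rewrite mulrC ler_pdivrMr// mul1r ler_nat.
Qed.

Definition ratfun (l : seq (seq (rat * rat) * seq (rat * rat))) T : C :=
  \sum_(i < size l) ip (T (ratvec (nth ([::], [::]) l i).1)) (ratvec (nth ([::], [::]) l i).2).

Lemma series_supp (V : zmodType) (F : nat -> V) m : (forall i, (m <= i)%N -> F i = 0) ->
  forall n, (m <= n)%N -> series F n = \sum_(i < m) F i.
Proof.
move=> F0 n mn; rewrite /series /= (big_cat_nat (n := m))//= big_mkord.
by rewrite [X in _ + X]big_nat_cond [X in _ + X]big1 ?addr0// => i /andP[/andP[/F0]].
Qed.

Lemma series_supp_cvg (F : nat -> C) m : (forall i, (m <= i)%N -> F i = 0) ->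
  series F @ \oo --> \sum_(i < m) F i.
Proof.
move=> F0; apply: cvg_near_cst; exists m => // n /= mn; exact: series_supp.
Qed.

Lemma ratfun_predual (A : set (H -> H)) l : A `<=` @bounded_op R H -> in_predual A (ratfun l).
Proof.
move=> Ab; pose x k : H := if (k < size l)%N then ratvec (nth ([::], [::]) l k).1 else 0.
pose y k : H := if (k < size l)%N then ratvec (nth ([::], [::]) l k).2 else 0.
exists x, y; split.
- apply/cvg_ex; exists (\sum_(i < size l) `|x i| ^+ 2); apply: series_supp_cvg => i li.
  by rewrite /x ltnNge li /= normr0 expr0n.
- apply/cvg_ex; exists (\sum_(i < size l) `|y i| ^+ 2); apply: series_supp_cvg => i li.
  by rewrite /y ltnNge li /= normr0 expr0n.
- move=> T /Ab [Tl _].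
  have -> : ratfun l T = \sum_(i < size l) inner (T (x i)) (y i).
    by apply: eq_bigr => i _; rewrite /x /y ltn_ord.
  apply: (series_supp_cvg (F := fun k => inner (T (x k)) (y k))) => i li.
  by rewrite /x ltnNge li /= (lin0 Tl) innerE ip0l.
Qed.

(* The tail of [sum <T xi_k, eta_k>] is controlled by [|xi_k|^2 + |eta_k|^2]. *)
Lemma ip_amgm T u v : (forall x, nrm (T x) <= nrm x) ->
  Num.sqrt (sq2 (ip (T u) v)) <= nrm u ^+ 2 + nrm v ^+ 2.
Proof.
move=> T1; apply: le_trans (abs_ip_le _ _) _.
apply: le_trans (ler_wpM2r (nrm_ge0 _) (T1 _)) _.
have := sqr_ge0 (nrm u - nrm v); rewrite sqrrB.
by have := sqr_ge0 (nrm u); have := sqr_ge0 (nrm v); lra.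
Qed.

Lemma cvg_sqsum (x : nat -> H) : cvgn (series (fun k => `|x k| ^+ 2)) ->
  forall e : R, 0 < e -> exists N, forall n, (N <= n)%N ->
    \sum_(N <= k < n) nrm (x k) ^+ 2 < e.
Proof.
move=> /cvg_ex[l /cvgC_cvg[lr _]] e e0.
have e2 : 0 < e / 2 by rewrite divr_gt0.
have E n : re (series (fun k => `|x k| ^+ 2) n) = \sum_(0 <= k < n) nrm (x k) ^+ 2.
  rewrite /series /= (big_morph re (@reD R) (erefl _)); apply: eq_bigr => k _.
  by rewrite l2_norm -rmorphXn.
have /cvgrPdist_lt/(_ _ e2)[N _ NP] := lr; exists N => n Nn.
have := NP N (leqnn N); have := NP n Nn; rewrite /= !E => h1 h2.
rewrite (_ : \sum_(N <= k < n) _ =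
    \sum_(0 <= k < n) nrm (x k) ^+ 2 - \sum_(0 <= k < N) nrm (x k) ^+ 2); last first.
  by rewrite (big_cat_nat (m := 0) (n := N) (p := n))//= addrAC subrr add0r.
move: h1 h2; rewrite !ltr_norml => /andP[? ?] /andP[? ?]; lra.
Qed.

Lemma series_sub (F : nat -> C) N n : (N <= n)%N ->
  series F n - series F N = \sum_(N <= k < n) F k.
Proof. by move=> Nn; rewrite /series /= (big_cat_nat (m := 0) (n := N) (p := n))//= addrAC subrr add0r. Qed.

Lemma ab_sum N n (F : nat -> C) :
  Num.sqrt (sq2 (\sum_(N <= k < n) F k)) <= \sum_(N <= k < n) Num.sqrt (sq2 (F k)).
Proof.
elim/big_ind2 : _ => [|a b c d ab cd|//]; first by rewrite /sq2 /= expr0n addr0 sqrtr0.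
exact: le_trans (sqrt_sq2D _ _) (lerD ab cd).
Qed.

(** Functionals given by finite lists of pairs of rational, finitely supported vectors are
    enumerated by [unpickle]; half of [e] covers the tail of the series, the other half its first
    [N] terms. *)
Theorem predual_separable (A : set (H -> H)) : A `<=` @bounded_op R H -> separable_predual A.
Proof.
move=> Ab.
exists (fun k => if unpickle k is Some l then ratfun l else ratfun [::]).
  by move=> k; case: unpickle => [l|]; exact: ratfun_predual.
move=> phi [x [y [xc yc phiP]]] _ /ltcR_gt0[e e0 ->].
have e4 : 0 < e / 4 by rewrite divr_gt0.
have [N1 N1P] := cvg_sqsum xc e4; have [N2 N2P] := cvg_sqsum yc e4.
pose N := maxn N1 N2.
have tail n : (N <= n)%N ->
    \sum_(N <= k < n) (nrm (x k) ^+ 2 + nrm (y k) ^+ 2) <= e / 2.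
  move=> Nn; rewrite big_split /= (_ : e / 2 = e / 4 + e / 4); last by lra.
  have sub M (z : nat -> H) : (M <= N)%N ->
      \sum_(N <= k < n) nrm (z k) ^+ 2 <= \sum_(M <= k < n) nrm (z k) ^+ 2.
    move=> MN; rewrite (big_cat_nat (m := M) (n := N))//= lerDr.
    by apply: sumr_ge0 => i _; exact: sqr_ge0.
  apply: lerD; apply: le_trans (sub _ _ _) (ltW _); [exact: leq_maxl| |exact: leq_maxr|].
    by apply: N1P; exact: leq_trans (leq_maxl _ _) Nn.
  by apply: N2P; exact: leq_trans (leq_maxr _ _) Nn.
pose c := e / 2 / N.+1%:R.
have c0 : 0 < c by rewrite !divr_gt0.
(* First [x k] is approximated with a precision depending on [y k], then [y k] with a precision
   depending on the vector just chosen. *)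
have [ab abP] : {ab : nat -> seq (rat * rat) * seq (rat * rat) & forall k,
    nrm (x k - ratvec (ab k).1) * nrm (y k) +
    nrm (ratvec (ab k).1) * nrm (y k - ratvec (ab k).2) <= c}.
  apply: (@choice _ _ (fun k ab => nrm (x k - ratvec ab.1) * nrm (y k) +
    nrm (ratvec ab.1) * nrm (y k - ratvec ab.2) <= c)) => k.
  have y1 : 0 < 2 * (nrm (y k) + 1) by rewrite mulr_gt0// ltr_wpDl// nrm_ge0.
  have [a aP] := ratvec_near (x k) (divr_gt0 c0 y1).
  have a1 : 0 < 2 * (nrm (ratvec a) + 1) by rewrite mulr_gt0// ltr_wpDl// nrm_ge0.
  have [b bP] := ratvec_near (y k) (divr_gt0 c0 a1).
  exists (a, b) => /=; rewrite ltr_pdivlMr// in aP; rewrite ltr_pdivlMr// in bP.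
  have h1 := nrm_ge0 (x k - ratvec a); have h2 := nrm_ge0 (y k - ratvec b).
  by move: aP bP h1 h2; lra.
exists (pickle (mkseq ab N)) => T TA T1; rewrite pickleK.
have {}T1 u : nrm (T u) <= nrm u by rewrite -lecR; exact: T1.
have [Tl _] := Ab T TA.
pose F k := inner (T (x k)) (y k).
have FE : ratfun (mkseq ab N) T =
    \sum_(0 <= k < N) ip (T (ratvec (ab k).1)) (ratvec (ab k).2).
  rewrite /ratfun size_mkseq big_mkord; apply: eq_bigr => i _.
  by rewrite nth_mkseq.
rewrite normE lecR FE -(subrKA (series F N)) [leRHS]splitr.
apply: le_trans (sqrt_sq2D _ _) _; apply: lerD.
  apply/ler_addgt0Pl => d d0.
  have /cvgrPdist_lt/(_ d%:C)[|M _ MP] := phiP T TA; first by rewrite ltcR.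
  pose n := maxn M N; have := MP n (leq_maxl _ _); rewrite normE ltcR => h1.
  rewrite -(subrKA (series F n)); apply: le_trans (sqrt_sq2D _ _) (lerD (ltW h1) _).
  rewrite series_sub ?leq_maxr//; apply: le_trans (ab_sum _ _ _) _.
  apply: le_trans (tail n (leq_maxr _ _)); apply: ler_sum => k _.
  exact: ip_amgm.
rewrite /series /= -sumrB; apply: le_trans (ab_sum _ _ _) _.
apply: (@le_trans _ _ (\sum_(0 <= k < N) c)).
  apply: ler_sum => k _; apply: le_trans (abP k).
  rewrite (_ : _ - _ = ip (T (x k - ratvec (ab k).1)) (y k) +
      ip (T (ratvec (ab k).1)) (y k - ratvec (ab k).2)); last first.
    by rewrite (linB _ _ Tl) ipBl ipBr addrA subrK.
  apply: le_trans (sqrt_sq2D _ _) _; apply: lerD; apply: le_trans (abs_ip_le _ _) _;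
    by rewrite ler_wpM2r ?nrm_ge0.
rewrite big_mkord sumr_const card_ord -[_ *+ _]mulr_natr /c -mulrA ger_pMr ?divr_gt0//.
by rewrite mulrC ler_pdivrMr// mul1r ler_nat.
Qed.

Lemma CR_II1 : II1_factor (@CR R).
Proof. by split; [exact: CR_factor|exact: CR_finite|exact: CR_no_abelian]. Qed.

End Predual.

(** * The bundle *)

Section Sections.
Variables (R : realType) (d : nat -> nat).
Notation C := R[i].
Notation H := (l2 R).
Notation pt := (nat -> nat -> R).
Notation K := (orbit_rep R d).
Notation vac := (ket R 0).
Implicit Types (u v w : H) (p q : K) (x y : pt) (f g : K -> H -> H).

Lemma Usg_linear s : linear (@Usg R s). Proof. exact: ws_linear. Qed.
Lemma Rsh_linear k : linear (@Rsh R k). Proof. exact: ws_linear. Qed.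

Definition l2_cont (F : pt -> H) := forall x, Xset d x ->
  row_continuous_at d (fun u v => nrm (u - v)) F x.

Lemma l2_cont_cst u : l2_cont (fun=> u).
Proof. by move=> x Xx e e0; exists 0%N, 1 => // y Xy _; rewrite subrr nrm0. Qed.

Lemma l2_contD F G : l2_cont F -> l2_cont G -> l2_cont (fun x => F x + G x).
Proof.
move=> Fc Gc x Xx e e0; have e2 : 0 < e / 2 by rewrite divr_gt0.
have [M [r r0 MP]] := Fc x Xx _ e2; have [N [s s0 NP]] := Gc x Xx _ e2.
exists (maxn M N), (Num.min r s); first by rewrite lt_min r0.
move=> y Xy xy; rewrite opprD addrACA [ltRHS]splitr.
apply: le_lt_trans (nrmD _ _) _; apply: ltrD; [apply: MP|apply: NP] => //;
  apply: near_ptW xy; by rewrite ?leq_maxl ?leq_maxr// ge_min lexx ?orbT.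
Qed.

Lemma l2_cont_map T B F : linear T -> bnd T B -> l2_cont F -> l2_cont (fun x => T (F x)).
Proof.
move=> Tl TB Fc x Xx e e0; have B1 : 0 < `|B| + 1 by rewrite ltr_wpDl.
have [M [r r0 MP]] := Fc x Xx _ (divr_gt0 e0 B1); exists M, r => // y Xy xy.
rewrite -(linB _ _ Tl); apply: le_lt_trans (TB _) _.
have := MP y Xy xy; rewrite ltr_pdivlMr// mulrC; apply: le_lt_trans.
rewrite ler_wpM2r ?nrm_ge0//; apply: le_trans (ler_norm B) _.
by rewrite lerDl.
Qed.

Lemma l2_cont_near F : (forall e, 0 < e ->
    exists2 G, l2_cont G & forall x, Xset d x -> nrm (F x - G x) <= e) -> l2_cont F.
Proof.
move=> FG x Xx e e0; have e4 : 0 < e / 4 by rewrite divr_gt0.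
have [G Gc FGe] := FG _ e4; have [M [r r0 MP]] := Gc x Xx _ e4.
exists M, r => // y Xy xy.
rewrite (_ : F x - F y = (F x - G x) + (G x - G y) - (F y - G y)); last first.
  by rewrite !addrA subrK opprB addrA subrK.
have := nrmD (F x - G x + (G x - G y)) (- (F y - G y)); rewrite nrmN.
have := nrmD (F x - G x) (G x - G y).
by have := FGe x Xx; have := FGe y Xy; have := MP y Xy xy; lra.
Qed.

Lemma eq_l2_cont F G : (forall x, Xset d x -> F x = G x) -> l2_cont F -> l2_cont G.
Proof.
move=> FG Fc; apply: l2_cont_near => e e0; exists F => // x Xx.
by rewrite FG// subrr nrm0 ltW.
Qed.

(* [f p] acts as the fibre operator at the representative [p]; [conj_op f x]
   is the same operator seen from the point [x] of the orbit. *)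
Definition conj_op f x u := Usg (sg d x) (f (orep_of d x) (Usg (sg d x) u)).
Definition ext f x := Usg (sg d x) (f (orep_of d x) vac).

(** Continuity is asked only at [ket 0], that is, in the norm of the trace. It concerns [ext f] on
    [Xset] and not [f] itself, since representatives of orbits jump. *)
Definition is_wsec f := [/\ forall p, linear (f p),
  exists2 B, 0 <= B & forall p, bnd (f p) B,
  forall p, inCR (f p) & l2_cont (ext f)].

Lemma conj_op_vac f x : conj_op f x vac = ext f x.
Proof. by rewrite /conj_op Usg_ket0. Qed.

Lemma conj_op_inCR f x : linear (f (orep_of d x)) -> inCR (f (orep_of d x)) -> inCR (conj_op f x).
Proof.
move=> fl fR k u; rewrite /conj_op Usg_Rsh (linZ _ _ fl) fR (linZ _ _ (Usg_linear _)).
by rewrite Usg_Rsh scalerA -signr_addb addbb scale1r.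
Qed.

Lemma conj_op_linear f x : linear (f (orep_of d x)) -> linear (conj_op f x).
Proof.
by move=> fl a u v; rewrite /conj_op (Usg_linear _) fl (Usg_linear _).
Qed.

Lemma conj_op_bnd f x B : bnd (f (orep_of d x)) B -> bnd (conj_op f x) B.
Proof. by move=> fB u; rewrite nrm_ws; apply: le_trans (fB _) _; rewrite nrm_ws. Qed.

(** Right translations carry continuity from [ket 0] to each [ket k]; finite sums and the uniform
    bound then give every vector. *)
Lemma conj_op_cnt f u : is_wsec f -> l2_cont (fun x => conj_op f x u).
Proof.
move=> [fl [B B0 fB] fR fc].
have bc k : l2_cont (fun x => conj_op f x (ket R k)).
  apply: (@eq_l2_cont (fun x => Rsh k (ext f x))); last first.
    exact: l2_cont_map (ws_linear _ _) (ws_bnd _ _) fc.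
  by move=> x _; rewrite -conj_op_vac -conj_op_inCR// Rsh_ket0.
have tc n : l2_cont (fun x => conj_op f x (trunc n u)).
  rewrite trunc_sum; elim: (2 ^ n)%N => [|m IHm].
    apply: (@eq_l2_cont (fun=> 0)); last exact: l2_cont_cst.
    by move=> x _; rewrite big_ord0 (lin0 (conj_op_linear (fl _))).
  apply: (@eq_l2_cont (fun x => conj_op f x (\sum_(i < m) u i *: ket R i) +
      u m *: conj_op f x (ket R m))); last first.
    apply: l2_contD IHm _; apply: (@l2_cont_map ( *:%R (u m)) (Num.sqrt (sq2 (u m)))) => //.
      by move=> b v w; rewrite scalerDr !scalerA mulrC.
    by move=> v; rewrite nrmZ.
  move=> x _; have cl := conj_op_linear (fl (orep_of d x)).
  by rewrite big_ord_recr (linD _ _ cl) (linZ _ _ cl).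
apply: l2_cont_near => e e0; have B1 : 0 < B + 1 by rewrite ltr_wpDl.
have [n /(_ n (leqnn n)) un] := trunc_near u (divr_gt0 e0 B1).
exists (fun x => conj_op f x (trunc n u)) => // x Xx.
rewrite -(linB _ _ (conj_op_linear (fl (orep_of d x)))).
apply: le_trans (conj_op_bnd (fB _) _) _; move: un; rewrite ltr_pdivlMr// mulrC => /ltW.
by apply: le_trans; rewrite ler_wpM2r ?nrm_ge0// lerDl.
Qed.

Lemma is_wsec0 : is_wsec (fun _ _ => 0).
Proof.
split=> [p a u v||p k u|].
- by rewrite scaler0 addr0.
- by exists 0 => // p u; rewrite nrm0 mul0r.
- by rewrite (lin0 (Rsh_linear _)).
- by apply: (eq_l2_cont _ (l2_cont_cst 0)) => x _; rewrite /ext (lin0 (Usg_linear _)).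
Qed.

Lemma is_wsec1 : is_wsec (fun _ u => u).
Proof.
split=> [p a u v //||p k u //|]; first by exists 1 => // p u; rewrite mul1r.
by apply: (eq_l2_cont _ (l2_cont_cst vac)) => x _; rewrite /ext Usg_ket0.
Qed.

Lemma is_wsecD f g : is_wsec f -> is_wsec g -> is_wsec (fun p u => f p u + g p u).
Proof.
move=> [fl [B B0 fB] fR fc] [gl [D D0 gD] gR gc]; split=> [p a u v||p k u|].
- by rewrite fl gl scalerDr addrACA.
- exists (B + D) => [|p u]; first exact: addr_ge0.
  by apply: le_trans (nrmD _ _) _; rewrite mulrDl (lerD (fB p u) (gD p u)).
- by rewrite fR gR (linD _ _ (Rsh_linear _)).
- by apply: (eq_l2_cont _ (l2_contD fc gc)) => x _; rewrite /ext (linD _ _ (Usg_linear _)).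
Qed.

Lemma is_wsecZ a f : is_wsec f -> is_wsec (fun p u => a *: f p u).
Proof.
move=> [fl [B B0 fB] fR fc]; split=> [p b u v||p k u|].
- by rewrite fl scalerDr !scalerA [a * b]mulrC.
- exists (Num.sqrt (sq2 a) * B) => [|p u]; first by rewrite mulr_ge0 ?sqrtr_ge0.
  by rewrite nrmZ -mulrA (ler_wpM2l (sqrtr_ge0 _) (fB p u)).
- by rewrite fR (linZ _ _ (Rsh_linear _)).
- apply: (@eq_l2_cont (fun x => a *: ext f x)) => [x _|].
    by rewrite /ext (linZ _ _ (Usg_linear _)).
  apply: (@l2_cont_map ( *:%R a) (Num.sqrt (sq2 a))) fc.
    by move=> b v w; rewrite scalerDr !scalerA mulrC.
  by move=> v; rewrite nrmZ.
Qed.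

(** The vector of a product is [conj_op f] applied to [ext g]. Strong continuity of [f] is used at
    the fixed vector [ext g x], and its uniform bound on the variation of [ext g]. *)
Lemma is_wsecM f g : is_wsec f -> is_wsec g -> is_wsec (fun p u => f p (g p u)).
Proof.
move=> fg [gl [D D0 gD] gR gc]; have [fl [B B0 fB] fR fc] := fg.
split=> [p a u v||p k u|].
- by rewrite gl fl.
- exists (B * D) => [|p u]; first exact: mulr_ge0.
  by apply: le_trans (fB _ _) _; rewrite -mulrA (ler_wpM2l B0 (gD p u)).
- by rewrite gR fR.
- have E x : ext (fun p u => f p (g p u)) x = conj_op f x (ext g x).
    by rewrite /conj_op /ext UsgK.
  move=> x Xx e e0; have e2 : 0 < e / 2 by rewrite divr_gt0.
  have B1 : 0 < B + 1 by rewrite ltr_wpDl.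
  have [M [r r0 MP]] := conj_op_cnt (ext g x) fg Xx e2.
  have [N [s s0 NP]] := gc x Xx _ (divr_gt0 e2 B1).
  exists (maxn M N), (Num.min r s); first by rewrite lt_min r0.
  move=> y Xy xy; rewrite !E.
  have h1 : nrm (conj_op f x (ext g x) - conj_op f y (ext g x)) < e / 2.
    by apply: MP => //; apply: near_ptW xy; rewrite ?leq_maxl// ge_min lexx.
  have : nrm (ext g x - ext g y) < e / 2 / (B + 1).
    by apply: NP => //; apply: near_ptW xy; rewrite ?leq_maxr// ge_min lexx orbT.
  rewrite ltr_pdivlMr// mulrC => h2.
  rewrite -(subrKA (conj_op f y (ext g x))) [ltRHS]splitr.
  apply: le_lt_trans (nrmD _ _) _; apply: ltrD => //.
  rewrite -(linB _ _ (conj_op_linear (fl _))); apply: le_lt_trans h2.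
  apply: le_trans (conj_op_bnd (fB _) _) _.
  by rewrite ler_wpM2r ?nrm_ge0// lerDl.
Qed.

Lemma nrm_conj u v (s : nat -> bool) : (forall k, u k = (-1) ^+ s k * (v k)^*) ->
  nrm u = nrm v.
Proof.
move=> uv; suff E : (fun n => qsum n u) = (fun n => qsum n v) by rewrite /nrm /sqn E.
apply/funext => n; apply: eq_bigr => i _.
by rewrite uv sq2_sign /sq2 reJ imJ sqrrN.
Qed.

(** The adjoint is isometric for the norm of the trace: coefficients are conjugated and multiplied
    by a sign [beta k k] that does not depend on the point. *)
Lemma is_wsec_adj f : is_wsec f -> is_wsec (fun p => adj (f p)).
Proof.
move=> [fl [B B0 fB] fR fc]; split=> [p||p|].
- exact: adj_linear (fB p).
- by exists B => // p; exact: adj_bnd.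
- exact: inCR_adj (fB p) (fR p).
- move=> x Xx e e0; have [M [r r0 MP]] := fc x Xx _ e0; exists M, r => // y Xy xy.
  apply: le_lt_trans (MP y Xy xy).
  rewrite (@nrm_conj _ (ext f x - ext f y) (fun k => beta k k))// => k.
  rewrite !l2B /ext !UsgE !(adj_ket0 _ (fl _) B0 (fB _) (fR _)).
  by rewrite rmorphB !rmorphM !rmorph_sign /=; ring.
Qed.

Record wsec := WSec { sfun :> K -> H -> H; sgood : is_wsec sfun }.

Lemma wsec_inj (f g : wsec) : (forall p u, f p u = g p u) -> f = g.
Proof.
case: f g => [f fg] [g gg] /= E; have fgE : f = g.
  by apply/funext => p; apply/funext => u.
by subst g; congr WSec; exact: Prop_irrelevance.
Qed.

HB.instance Definition _ := gen_eqMixin wsec.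
HB.instance Definition _ := gen_choiceMixin wsec.

Definition wsec0 := WSec is_wsec0.
Definition wsec1 := WSec is_wsec1.
Definition wsec_add (f g : wsec) := WSec (is_wsecD (sgood f) (sgood g)).
Definition wsec_scale a (f : wsec) := WSec (is_wsecZ a (sgood f)).
Definition wsec_opp (f : wsec) := wsec_scale (-1) f.
Definition wsec_mul (f g : wsec) := WSec (is_wsecM (sgood f) (sgood g)).
Definition wsec_star (f : wsec) := WSec (is_wsec_adj (sgood f)).

Lemma wsec_lin (f : wsec) p : linear (f p). Proof. by have [] := sgood f. Qed.

Let addA : associative wsec_add.
Proof. by move=> f g h; apply: wsec_inj => p u; exact: addrA. Qed.
Let addC : commutative wsec_add.
Proof. by move=> f g; apply: wsec_inj => p u; exact: addrC. Qed.
Let add0 : left_id wsec0 wsec_add.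
Proof. by move=> f; apply: wsec_inj => p u; exact: add0r. Qed.
Let addN : left_inverse wsec0 wsec_opp wsec_add.
Proof. by move=> f; apply: wsec_inj => p u /=; rewrite scaleN1r addNr. Qed.
HB.instance Definition _ := GRing.isZmodule.Build wsec addA addC add0 addN.

Let mulA : associative wsec_mul. Proof. by move=> f g h; apply: wsec_inj. Qed.
Let mul1 : left_id wsec1 wsec_mul. Proof. by move=> f; apply: wsec_inj. Qed.
Let mulr1' : right_id wsec1 wsec_mul. Proof. by move=> f; apply: wsec_inj. Qed.
Let mulDl : left_distributive wsec_mul wsec_add.
Proof. by move=> f g h; apply: wsec_inj. Qed.
Let mulDr : right_distributive wsec_mul wsec_add.
Proof. by move=> f g h; apply: wsec_inj => p u /=; rewrite (linD _ _ (wsec_lin f p)). Qed.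
Let one_neq0 : wsec1 != 0.
Proof.
apply/eqP => /(congr1 (fun f : wsec => nrm (f (orep_of d (base R).1) vac))).
by rewrite /= nrm_ket nrm0 => /eqP; rewrite oner_eq0.
Qed.
HB.instance Definition _ := GRing.Zmodule_isNzRing.Build wsec
  mulA mul1 mulr1' mulDl mulDr one_neq0.

Let scaleA a b (f : wsec) : wsec_scale a (wsec_scale b f) = wsec_scale (a * b) f.
Proof. by apply: wsec_inj => p u; exact: scalerA. Qed.
Let scale1 : left_id 1 wsec_scale.
Proof. by move=> f; apply: wsec_inj => p u; exact: scale1r. Qed.
Let scaleDr : right_distributive wsec_scale +%R.
Proof. by move=> a f g; apply: wsec_inj => p u; exact: scalerDr. Qed.
Let scaleDl (f : wsec) : {morph wsec_scale^~ f : a b / a + b}.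
Proof. by move=> a b; apply: wsec_inj => p u; exact: scalerDl. Qed.
HB.instance Definition _ := GRing.Zmodule_isLmodule.Build C wsec
  scaleA scale1 scaleDr scaleDl.

Let scaleAl a (f g : wsec) : a *: (f * g) = (a *: f) * g.
Proof. exact: wsec_inj. Qed.
HB.instance Definition _ := GRing.Lmodule_isLalgebra.Build C wsec scaleAl.

Let scaleAr a (f g : wsec) : a *: (f * g) = f * (a *: g).
Proof. by apply: wsec_inj => p u /=; rewrite (linZ _ _ (wsec_lin f p)). Qed.
HB.instance Definition _ := GRing.Lalgebra_isAlgebra.Build C wsec scaleAr.

Lemma wsecD (f g : wsec) p u : (f + g) p u = f p u + g p u. Proof. by []. Qed.
Lemma wsecN (f : wsec) p u : (- f) p u = - f p u. Proof. exact: scaleN1r. Qed.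
Lemma wsecB (f g : wsec) p u : (f - g) p u = f p u - g p u.
Proof. by rewrite wsecD wsecN. Qed.
Lemma wsecM (f g : wsec) p u : (f * g) p u = f p (g p u). Proof. by []. Qed.
Lemma wsecZ a (f : wsec) p u : (a *: f) p u = a *: f p u. Proof. by []. Qed.

End Sections.

(** * The C*-norm, the expectation and the inclusion of C(K) *)

Section SectionNorm.
Variables (R : realType) (d : nat -> nat).
Notation C := R[i].
Notation H := (l2 R).
Notation pt := (nat -> nat -> R).
Notation K := (orbit_rep R d).
Notation M := (wsec R d).
Notation vac := (ket R 0).
Implicit Types (u v w : H) (p q : K) (x y : pt) (f g h : M) (B : R).

Lemma wsec_bnd f : exists2 B, 0 <= B & forall p, bnd (f p) B.
Proof. by have [] := sgood f. Qed.
Lemma wsec_inCR f p : inCR (f p). Proof. by have [] := sgood f. Qed.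
Lemma wsec_cnt f : l2_cont d (ext f). Proof. by have [] := sgood f. Qed.
Lemma wsec_CR f p : CR (f p).
Proof.
have [B B0 fB] := wsec_bnd f; split; last exact: wsec_inCR.
by apply/bounded_opP; split; [exact: wsec_lin|exists B].
Qed.

Definition wsec_norm f : R :=
  sup [set nrm (f pu.1 pu.2) | pu in [set pu : K * H | nrm pu.2 <= 1]].

Lemma wsec_norm_le f B : 0 <= B -> (forall p, bnd (f p) B) -> wsec_norm f <= B.
Proof.
move=> B0 fB; apply: ge_sup => [|_ [[p u] /= u1 <-]].
  by exists (nrm (f (orep_of d (base R).1) 0)), (orep_of d (base R).1, 0) => //=; rewrite nrm0.
by apply: le_trans (fB p u) _; rewrite -[leRHS]mulr1 ler_wpM2l.
Qed.

Lemma wsec_norm_ub f p u : nrm u <= 1 -> nrm (f p u) <= wsec_norm f.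
Proof.
have [B B0 fB] := wsec_bnd f.
move=> u1; apply: ub_le_sup; last by exists (p, u).
exists B => _ [[q v] /= v1 <-].
by apply: le_trans (fB q v) _; rewrite -[leRHS]mulr1 ler_wpM2l.
Qed.

Lemma wsec_norm_ge0 f : 0 <= wsec_norm f.
Proof.
apply: le_trans (nrm_ge0 _) (@wsec_norm_ub f (orep_of d (base R).1) 0 _).
by rewrite nrm0.
Qed.

Lemma wsec_norm_bnd f p : bnd (f p) (wsec_norm f).
Proof.
move=> u; have [u0|u0] := eqVneq (nrm u) 0.
  by rewrite (nrm_eq0 u0) (lin0 (wsec_lin f p)) nrm0 mulr0.
have up : 0 < nrm u by rewrite lt_neqAle eq_sym u0 nrm_ge0.
pose a : C := (nrm u)^-1%:C.
have aE : Num.sqrt (sq2 a) = (nrm u)^-1 by rewrite sqrt_sq2R ger0_norm ?invr_ge0 ?nrm_ge0.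
have := @wsec_norm_ub f p (a *: u); rewrite (linZ _ _ (wsec_lin f p)) !nrmZ aE.
by rewrite mulVf// => /(_ (lexx _)); rewrite ler_pdivrMl// mulrC.
Qed.

Lemma wsec_norm_eq0 f : wsec_norm f = 0 -> f = 0.
Proof.
move=> f0; apply: wsec_inj => p u; apply: nrm_eq0; apply/eqP.
by rewrite eq_le nrm_ge0 andbT -[leRHS](mul0r (nrm u)) -f0 wsec_norm_bnd.
Qed.

Lemma wsec_normD f g : wsec_norm (f + g) <= wsec_norm f + wsec_norm g.
Proof.
apply: wsec_norm_le => [|p u]; first by rewrite addr_ge0 ?wsec_norm_ge0.
by rewrite wsecD; apply: le_trans (nrmD _ _) _; rewrite mulrDl lerD ?wsec_norm_bnd.
Qed.

Lemma wsec_normZ a f : wsec_norm (a *: f) = re `|a| * wsec_norm f.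
Proof.
rewrite re_norm; have le b g : wsec_norm (b *: g) <= Num.sqrt (sq2 b) * wsec_norm g.
  apply: wsec_norm_le => [|p u]; first by rewrite mulr_ge0 ?sqrtr_ge0 ?wsec_norm_ge0.
  by rewrite wsecZ nrmZ -mulrA ler_wpM2l ?sqrtr_ge0// wsec_norm_bnd.
apply/eqP; rewrite eq_le le /=; have [->|a0] := eqVneq a 0.
  by rewrite /sq2 /= expr0n addr0 sqrtr0 mul0r wsec_norm_ge0.
have sa : Num.sqrt (sq2 a) * Num.sqrt (sq2 a^-1) = 1.
  by rewrite -sqrtrM ?sq2_ge0// -sq2M divff// /sq2 /= expr0n addr0 expr1n sqrtr1.
have := le a^-1 (a *: f); rewrite scalerA mulVf// scale1r => h.
apply: le_trans (ler_wpM2l (sqrtr_ge0 _) h) _.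
by rewrite mulrA sa mul1r.
Qed.

Lemma wsec_normM f g : wsec_norm (f * g) <= wsec_norm f * wsec_norm g.
Proof.
apply: wsec_norm_le => [|p u]; first by rewrite mulr_ge0 ?wsec_norm_ge0.
rewrite wsecM; apply: le_trans (wsec_norm_bnd _ _ _) _.
by rewrite -mulrA ler_wpM2l ?wsec_norm_ge0// wsec_norm_bnd.
Qed.

Notation star := (@wsec_star R d).

Lemma wsec_starP f p u v : ip (f p u) v = ip u (star f p v).
Proof.
by have [B B0 fB] := wsec_bnd f; rewrite (adjP _ _ (wsec_lin f p) B0 (fB p)).
Qed.

Lemma wsec_starK : involutive star.
Proof.
move=> f; apply: wsec_inj => p u; have [B B0 fB] := wsec_bnd f.
by rewrite /= (adjK (wsec_lin f p) B0 (fB p)).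
Qed.

Lemma wsec_starD f g : star (f + g) = star f + star g.
Proof.
apply: wsec_inj => p u; apply: eq_ip => w.
by rewrite -wsec_starP wsecD ipDl ipDr -!wsec_starP.
Qed.

Lemma wsec_starZ a f : star (a *: f) = a^* *: star f.
Proof.
apply: wsec_inj => p u; apply: eq_ip => w.
by rewrite -wsec_starP !wsecZ ipZl ipZr conjCK -wsec_starP.
Qed.

Lemma wsec_starM f g : star (f * g) = star g * star f.
Proof.
apply: wsec_inj => p u; apply: eq_ip => w.
by rewrite -wsec_starP !wsecM !wsec_starP.
Qed.

Lemma wsec_norm_star f : wsec_norm (star f) <= wsec_norm f.
Proof.
apply: wsec_norm_le (wsec_norm_ge0 _) _ => p.
exact: adj_bnd (wsec_lin f p) (wsec_norm_ge0 f) (wsec_norm_bnd f p).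
Qed.

Lemma wsec_normE f : wsec_norm (star f * f) = wsec_norm f ^+ 2.
Proof.
apply/eqP; rewrite eq_le; apply/andP; split.
  apply: le_trans (wsec_normM _ _) _; rewrite expr2.
  by rewrite ler_wpM2r ?wsec_norm_ge0 ?wsec_norm_star.
set c := wsec_norm (star f * f); have c0 : 0 <= c by exact: wsec_norm_ge0.
have cs : 0 <= Num.sqrt c by exact: sqrtr_ge0.
rewrite -[leRHS](sqr_sqrtr c0) lerXn2r ?nnegrE ?wsec_norm_ge0//.
apply: wsec_norm_le => // p u.
rewrite -(ler_pXn2r (n := 2)) ?nnegrE ?mulr_ge0 ?nrm_ge0//.
rewrite exprMn (sqr_sqrtr c0) sqr_nrm sqnE wsec_starP.
apply: le_trans (ler_norm _) (le_trans (abs_re_le _) (le_trans (abs_ip_le _ _) _)).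
rewrite expr2 mulrCA ler_wpM2l ?nrm_ge0//.
exact: (wsec_norm_bnd (star f * f)).
Qed.

(* Both completeness axioms come from the same strong limit. *)
Lemma wsec_limit (f : nat -> M) B : 0 <= B -> (forall n p, bnd (f n p) B) ->
  (forall e, 0 < e -> exists N, forall m n, (N <= m)%N -> (N <= n)%N ->
     forall p, nrm (f m p vac - f n p vac) < e) ->
  exists g, [/\ forall p, bnd (g p) B, forall p u, slim (fun n => f n p u) (g p u) &
     forall e, 0 < e -> exists N, forall n, (N <= n)%N ->
       forall p, nrm (f n p vac - g p vac) <= e].
Proof.
move=> B0 fB fc.
have [g gP] : {g : K -> H -> H & forall p, [/\ linear (g p), bnd (g p) B, inCR (g p) &
    forall u, slim (fun n => f n p u) (g p u)]}.
  apply: (@choice _ _ (fun p T => [/\ linear T, bnd T B, inCR T &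
    forall u, slim (fun n => f n p u) (T u)])) => p.
  apply: strong_limit => // [n|n|e e0]; [exact: wsec_lin|exact: wsec_inCR|].
  by have [N NP] := fc e e0; exists N => m n mN nN; exact: NP.
have unif e : 0 < e -> exists N, forall n, (N <= n)%N ->
    forall p, nrm (f n p vac - g p vac) <= e.
  move=> e0; have [N NP] := fc e e0; exists N => n Nn p.
  have [_ _ _ /(_ vac) gv] := gP p.
  apply/ler_addgt0Pl => r r0; have [N' /(_ (maxn N N') (leq_maxr _ _)) h] := gv _ r0.
  rewrite -(subrKA (f (maxn N N') p vac)) addrC [leRHS]addrC.
  by apply: le_trans (nrmD _ _) _; rewrite [leRHS]addrC lerD// ltW//; apply: NP; rewrite ?leq_maxl.
have gg : is_wsec g.
  split.
  - by move=> p; have [] := gP p.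
  - by exists B => // p; have [] := gP p.
  - by move=> p; have [] := gP p.
  - apply: l2_cont_near => e e0; have [N /(_ N (leqnn N)) NP] := unif e e0.
    exists (ext (f N)) => [|x Xx]; first exact: wsec_cnt.
    by rewrite nrmB /ext -(linB _ _ (Usg_linear _)) nrm_ws; exact: NP.
exists (WSec gg); split => // [p|p u]; first by have [] := gP p.
by have [_ _ _] := gP p; exact.
Qed.

Lemma wsec_complete : seq_complete wsec_norm [set: M].
Proof.
move=> f _ fc.
(* Beyond [N0] the operators have a common bound, as [wsec_limit] requires; so it is applied to the
   sequence shifted by [N0]. *)
have [N0 N0P] := fc 1 ltr01.
have f2 n p : (N0 <= n)%N -> bnd (f n p) (wsec_norm (f N0) + 1).
  move=> Nn u; apply: le_trans (wsec_norm_bnd _ _ _) _.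
  rewrite ler_wpM2r ?nrm_ge0// -[f n](subrK (f N0)) addrC.
  apply: le_trans (wsec_normD _ _) _.
  rewrite [leRHS]addrC [leLHS]addrC lerD2r.
  rewrite ltW//; exact: N0P.
have vle (h : M) p : nrm (h p vac) <= wsec_norm h.
  by apply: le_trans (wsec_norm_bnd _ _ _) _; rewrite nrm_ket mulr1.
have [||e e0|g [_ gs _]] := @wsec_limit (fun n => f (N0 + n)%N) (wsec_norm (f N0) + 1).
- by rewrite addr_ge0 ?wsec_norm_ge0.
- by move=> n p; apply: f2; exact: leq_addr.
- have [N NP] := fc e e0; exists N => m n mN nN p.
  rewrite -wsecB; apply: le_lt_trans (vle _ _) _; apply: NP;
    by rewrite (leq_trans _ (leq_addl _ _)).
exists g => //; apply/cvgrPdist_le => e e0; have [N NP] := fc e e0.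
exists (N0 + N)%N => // n /= Nn; rewrite sub0r normrN ger0_norm ?wsec_norm_ge0//.
apply: wsec_norm_le (ltW e0) _ => p u; rewrite wsecB.
apply/ler_addgt0Pl => r r0.
have [N' /(_ (maxn N N') (leq_maxr _ _)) h] := gs p u _ r0.
rewrite -(subrKA (f (N0 + maxn N N')%N p u)) addrC.
apply: le_trans (nrmD _ _) _; apply: lerD; first exact: ltW.
rewrite -wsecB; apply: le_trans (wsec_norm_bnd _ _ _) _.
rewrite ler_wpM2r ?nrm_ge0// ltW//; apply: NP.
  by apply: leq_trans Nn; rewrite leq_addl.
by rewrite (leq_trans (leq_maxl N N'))// leq_addl.
Qed.

Definition sec_alg : cstarAlg R := @CStarAlg R M wsec_norm star
  wsec_norm_eq0 wsec_normD wsec_normZ wsec_normM wsec_complete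
  wsec_starK wsec_starD wsec_starZ wsec_starM wsec_normE.

(** The coefficient at the empty set, that is, the trace of the operator at [p]. *)
Definition sec_exp (f : sec_alg) (p : K) : C := (f : M) p vac 0%N.

Lemma sec_expE f p : sec_exp f p = ip (f p vac) vac.
Proof. by rewrite ip_ket. Qed.

Lemma sec_exp_star f p : sec_exp (star f * f) p = (sqn (f p vac))%:C.
Proof. by rewrite sec_expE wsecM ipC -wsec_starP ipxx conjE conjc_real. Qed.

(** All sign changes fix the coefficient at the empty set, so the [s] produced by [near_orbit] does
    no harm. *)
Lemma sec_exp_continuous f : continuous (sec_exp f).
Proof.
move=> p A /nbhs_ballP[_ /= /ltcR_gt0[e e0 ->] eA].
have [N [del del0 NP]] := wsec_cnt f (orep_in p) e0.
have [r r0 rP] := near_orbit p N del0.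
apply/nbhs_ballP; exists r => // q; rewrite ballEmdist /= => /rP[s ps].
apply: eA; rewrite -ball_normE /= normE ltcR.
apply: le_lt_trans (NP _ (Xset_act s (orep_in q)) ps).
apply: le_trans (abs_coord_le _ 0%N); rewrite l2B /ext !UsgE !chi0 !mul1r.
by rewrite orep_of_orep orep_of_act.
Qed.

Lemma sec_exp_lin a f g : sec_exp (a *: f + g) = a *: sec_exp f + sec_exp g.
Proof. by []. Qed.

Lemma sec_exp_ge0 f p : 0 <= sec_exp (star f * f) p.
Proof. by rewrite sec_exp_star lecR sqn_ge0. Qed.

Lemma wsec_eq0 f : (forall p, f p vac = 0) -> f = 0.
Proof.
move=> f0; apply: wsec_inj => p u.
by rewrite (CR_eq (wsec_CR f p) (wsec_CR 0 p)).
Qed.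

Lemma sec_exp_faithful f : sec_exp (star f * f) = (fun=> 0) -> f = 0.
Proof.
move=> f0; apply: wsec_eq0 => p; apply: sqn_eq0.
by have := congr1 (fun F => F p) f0; rewrite sec_exp_star => -[].
Qed.

Lemma sec_exp_tracial f g : sec_exp (f * g) = sec_exp (g * f).
Proof.
apply/funext => p; have [B B0 fB] := wsec_bnd f; have [D D0 gD] := wsec_bnd g.
by rewrite !sec_expE !wsecM (tau_tracial (wsec_lin f p) (wsec_lin g p) B0 D0 (fB p) (gD p))//;
  exact: wsec_inCR.
Qed.

Definition norm2 f : R :=
  Num.sqrt (sup (range (fun p : K => re `|sec_exp (star f * f) p|))).

Lemma norm2E f p : re `|sec_exp (star f * f) p| = nrm (f p vac) ^+ 2.
Proof. by rewrite sec_exp_star re_norm sqrt_sq2R ger0_norm ?sqn_ge0// sqr_nrm. Qed.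

Lemma norm2_ub f p : nrm (f p vac) <= norm2 f.
Proof.
rewrite -[leLHS]ger0_norm ?nrm_ge0// -sqrtr_sqr /norm2.
have [B B0 fB] := wsec_bnd f.
have ub : re `|sec_exp (star f * f) p| <=
    sup (range (fun p : K => re `|sec_exp (star f * f) p|)).
  apply: ub_le_sup; last by exists p.
  exists (B ^+ 2) => _ [q _ <-]; rewrite norm2E lerXn2r ?nnegrE ?nrm_ge0//.
  by apply: le_trans (fB _ _) _; rewrite nrm_ket mulr1.
by rewrite norm2E in ub; rewrite ler_sqrt// (le_trans (sqr_ge0 _) ub).
Qed.

Lemma norm2_le f e : 0 <= e -> (forall p, nrm (f p vac) <= e) -> norm2 f <= e.
Proof.
move=> e0 fe; rewrite -[leRHS]ger0_norm// -sqrtr_sqr ler_sqrt ?sqr_ge0//.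
apply: ge_sup => [|_ [p _ <-]].
  by exists (re `|sec_exp (star f * f) (orep_of d (base R).1)|), (orep_of d (base R).1).
by rewrite norm2E lerXn2r ?nnegrE ?nrm_ge0.
Qed.

Lemma sec_ball_complete : seq_complete norm2 [set f : sec_alg | wsec_norm f <= 1].
Proof.
move=> f f1 fc.
have [//|n p|e e0|g [gB _ gu]] := @wsec_limit f 1.
- by move=> u; apply: le_trans (wsec_norm_bnd _ _ _) _; rewrite ler_wpM2r ?nrm_ge0//; exact: f1.
- have [N NP] := fc e e0; exists N => m n mN nN p.
  by rewrite -wsecB; apply: le_lt_trans (norm2_ub _ _) (NP m n mN nN).
exists g; first exact: wsec_norm_le.
apply/cvgrPdist_le => e e0; have [N NP] := gu e e0; exists N => // n /= Nn.
rewrite sub0r normrN ger0_norm ?sqrtr_ge0//; apply: norm2_le (ltW e0) _ => p.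
by rewrite wsecB; exact: NP.
Qed.

(* Otherwise the function would be unbounded near a cluster point of
   representatives. *)
Lemma continuous_bounded (h : K -> C) : continuous h ->
  exists2 B : R, 0 <= B & forall p, Num.sqrt (sq2 (h p)) <= B.
Proof.
move=> hc; apply: contrapT => /forall2NP nB.
have [u uP] : {u : nat -> K & forall n, n%:R < Num.sqrt (sq2 (h (u n)))}.
  apply: (@choice _ _ (fun n p => n%:R < Num.sqrt (sq2 (h p)))) => n.
  have [|/existsNP[p hp]] := nB n%:R; first by rewrite ler0n.
  by exists p; rewrite ltNge; exact/negP.
have [x Xx xu] := Xset_cluster (fun n => orep_in (u n)).
have /cvgrPdist_lt/(_ 1 ltr01)/nbhs_ballP[r /= r0 rP] := hc (orep_of d x).
have [N [del del0 NP]] := @orbit_dist_lt R d r r0.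
pose n0 := (Num.truncn (Num.sqrt (sq2 (h (orep_of d x))) + 1)).+1.
have [n nn0 xn] := xu N del n0 del0.
have := NP _ _ Xx (orep_in (u n)) xn; rewrite orep_of_orep => dr.
have := rP (u n); rewrite ballEmdist /= => /(_ dr).
rewrite normE (_ : 1 = 1%:C)// ltcR => h1.
have := uP n; apply/negP; rewrite -leNgt.
have : Num.sqrt (sq2 (h (orep_of d x))) + 1 <= n%:R.
  apply: ltW; apply: lt_le_trans (truncnS_gt _) _; by rewrite ler_nat.
apply: le_trans; rewrite -[h (u n)](subrK (h (orep_of d x))) addrC.
apply: le_trans (sqrt_sq2D _ _) _; rewrite lerD2l -sqrt_sq2N opprB.
exact: ltW h1.
Qed.

Lemma is_wsec_incl (h : K -> C) : continuous h -> is_wsec (fun p u => h p *: u).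
Proof.
move=> hc; have [B B0 hB] := continuous_bounded hc; split=> [p a u v||p k u|].
- by rewrite scalerDr !scalerA [h p * a]mulrC.
- by exists B => // p u; rewrite nrmZ ler_wpM2r ?nrm_ge0.
- by rewrite (linZ _ _ (Rsh_linear _)).
- move=> x Xx e e0.
  have e1 : 0 < e%:C :> C by rewrite ltcR.
  have /cvgrPdist_lt/(_ _ e1)/nbhs_ballP[r /= r0 rP] := hc (orep_of d x).
  have [N [del del0 NP]] := @orbit_dist_lt R d r r0; exists N, del => // y Xy xy.
  have := rP (orep_of d y); rewrite ballEmdist /= => /(_ (NP _ _ Xx Xy xy)).
  rewrite normE ltcR; apply: le_lt_trans.
  rewrite /ext !(linZ _ _ (Usg_linear _)) !Usg_ket0 -scalerBl nrmZ nrm_ket mulr1.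
  exact: lexx.
Qed.

Definition sec_incl (h : K -> C) : sec_alg :=
  match pselect (continuous h) with left hc => WSec (is_wsec_incl hc) | right _ => 0 end.

Lemma sec_inclE (h : K -> C) p u : continuous h -> (sec_incl h : M) p u = h p *: u.
Proof. by rewrite /sec_incl; case: pselect. Qed.

Implicit Types (a b : K -> C).

Lemma contD a b : continuous a -> continuous b -> continuous (a + b).
Proof. by move=> ac bc p; exact: (@cvgD C C K (nbhs p) _ a b _ _ (ac p) (bc p)). Qed.

Lemma contM a b : continuous a -> continuous b -> continuous (a * b).
Proof. by move=> ac bc p; exact: (@cvgM C K (nbhs p) _ a b _ _ (ac p) (bc p)). Qed.

Lemma contZ (z : C) a : continuous a -> continuous (z *: a).
Proof.
have zc : continuous (fun _ : K => z) by exact: cst_continuous.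
by move=> ac; exact: (contM zc ac).
Qed.

Lemma cont_conj a : continuous a -> continuous (fun p => (a p)^*).
Proof.
move=> ac p A /nbhs_ballP[e /= e0 eA].
have /cvgrPdist_lt/(_ e e0)/nbhs_ballP[r /= r0 rP] := ac p.
apply/nbhs_ballP; exists r => // q pq; apply: eA.
rewrite -ball_normE /= -rmorphB norm_conjC; exact: rP.
Qed.

Lemma cont_cst (z : C) : continuous (fun _ : K => z).
Proof. exact: cst_continuous. Qed.

Lemma sec_incl_lin (z : C) a b : continuous a -> continuous b ->
  sec_incl (z *: a + b) = z *: sec_incl a + sec_incl b.
Proof.
move=> ac bc; apply: wsec_inj => p u.
have zab : (z *: a + b) p *: u = z *: (a p *: u) + b p *: u.
  by rewrite scalerA -scalerDl.
apply: etrans (sec_inclE p u (contD (@contZ z a ac) bc)) (etrans zab _).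
exact: esym (congr2 +%R (congr1 ( *:%R z) (sec_inclE p u ac)) (sec_inclE p u bc)).
Qed.

Lemma sec_inclM a b : continuous a -> continuous b ->
  sec_incl (a * b) = sec_incl a * sec_incl b.
Proof.
move=> ac bc; apply: wsec_inj => p u.
have ab : (a * b) p *: u = a p *: (b p *: u) by rewrite scalerA.
apply: etrans (sec_inclE p u (contM ac bc)) (etrans ab _).
exact: esym (etrans (sec_inclE p _ ac) (congr1 ( *:%R (a p)) (sec_inclE p u bc))).
Qed.

Lemma sec_incl1 : sec_incl (fun=> 1) = 1.
Proof.
apply: wsec_inj => p u.
exact: etrans (sec_inclE p u (@cont_cst 1)) (scale1r _).
Qed.

Lemma sec_incl_star a : continuous a ->
  sec_incl (fun p => (a p)^*) = star (sec_incl a).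
Proof.
move=> ac; apply: wsec_inj => p u; apply: eq_ip => w.
apply: etrans (congr1 (ip w) (sec_inclE p u (cont_conj ac))) _.
apply: etrans (wsec_starP _ _ _ _); apply: esym.
apply: etrans (congr1 (fun v => ip v u) (sec_inclE p w ac)) _.
by rewrite ipZl ipZr conjCK.
Qed.

Lemma sec_incl_central a : continuous a ->
  forall f : sec_alg, sec_incl a * f = f * sec_incl a.
Proof.
move=> ac f; apply: wsec_inj => p u.
apply: etrans (sec_inclE p _ ac) _; apply: esym.
exact: etrans (congr1 ((f : M) p) (sec_inclE p u ac)) (linZ _ _ (wsec_lin f p)).
Qed.

Lemma sec_exp_incl a : continuous a -> sec_exp (sec_incl a) = a.
Proof.
by move=> ac; apply/funext => p; rewrite /sec_exp (sec_inclE p _ ac) l2Z ketE mulr1.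
Qed.

Lemma sec_exp_module a : continuous a ->
  forall f, sec_exp (sec_incl a * f) = a * sec_exp f.
Proof. by move=> ac f; apply/funext => p; exact: (congr1 (fun v : H => v 0%N) (sec_inclE p _ ac)). Qed.

Definition sec_bundle : wstarBundle R K := @WStarBundle R K sec_alg
  (@orbit_rep_compact R d) (@metric_hausdorff _ K)
  sec_incl sec_incl_lin sec_inclM sec_incl1 sec_incl_star sec_incl_central
  sec_exp sec_exp_continuous sec_exp_lin sec_exp_incl sec_exp_module
  sec_exp_ge0 sec_exp_faithful sec_exp_tracial sec_ball_complete.

End SectionNorm.

(** * The fibers *)

Section FullFibre.
Variables (R : realType) (d : nat -> nat).
Notation C := R[i].
Notation H := (l2 R).
Notation pt := (nat -> nat -> R).
Notation K := (orbit_rep R d).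
Notation M := (wsec R d).
Notation vac := (ket R 0).
Implicit Types (u v w : H) (p q : K) (x y : pt) (T : H -> H).

(** Odd, 1-Lipschitz, bounded by 1 and equal to 1 at 1: what is needed to turn a coordinate of a
    sphere into the symbol of a contractive multiplier. *)
Definition clip (t : R) : R := Num.max (-1) (Num.min 1 t).

Lemma clipP t : [\/ t < -1 /\ clip t = -1, 1 < t /\ clip t = 1 |
  (-1 <= t /\ t <= 1) /\ clip t = t].
Proof.
rewrite /clip minElt maxElt; case: (ltP 1 t) => t1.
  by constructor 2; split => //; case: ltP => // ?; lra.
case: (ltP (-1) t) => t2; first by constructor 3; split => //; split=> //; exact: ltW.
case: (eqVneq t (-1)) => [->|tn]; first by constructor 3; split => //; split; lra.
by constructor 1; split => //; rewrite lt_neqAle tn.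
Qed.

Lemma clip_bound t : -1 <= clip t <= 1.
Proof. by apply/andP; have [[? ->]|[? ->]|[[? ?] ->]] := clipP t; split; lra. Qed.

Lemma clipN t : clip (- t) = - clip t.
Proof.
have [[? ->]|[? ->]|[[? ?] ->]] := clipP t;
  by have [[? ->]|[? ->]|[[? ?] ->]] := clipP (- t); lra.
Qed.

Lemma clip1 : clip 1 = 1.
Proof. by have [[? ->]|[? ->]|[[? ?] ->]] := clipP 1; lra. Qed.

Lemma clip_lip s t : `|clip s - clip t| <= `|s - t|.
Proof.
have h1 := ler_norm (s - t); have := ler_norm (t - s); rewrite distrC => h2.
rewrite ler_norml; move: h1 h2; move: (`|s - t|) => c h1 h2.
have [[? ->]|[? ->]|[[? ?] ->]] := clipP t;
  by have [[? ->]|[? ->]|[[? ?] ->]] := clipP s; apply/andP; split; lra.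
Qed.

Definition real_cont (phi : pt -> R) := forall x, Xset d x ->
  row_continuous_at d (fun a b : R => `|a - b|) phi x.

Lemma real_contM (phi psi : pt -> R) : (forall x, `|phi x| <= 1) -> (forall x, `|psi x| <= 1) ->
  real_cont phi -> real_cont psi -> real_cont (fun x => phi x * psi x).
Proof.
move=> phi1 psi1 phic psic x Xx e e0; have e2 : 0 < e / 2 by rewrite divr_gt0.
have [N [r r0 NP]] := phic x Xx _ e2; have [N' [s s0 NP']] := psic x Xx _ e2.
exists (maxn N N'), (Num.min r s); first by rewrite lt_min r0.
move=> y Xy xy.
have h1 : `|phi x - phi y| < e / 2.
  by apply: NP => //; apply: near_ptW xy; rewrite ?leq_maxl// ge_min lexx.
have h2 : `|psi x - psi y| < e / 2.
  by apply: NP' => //; apply: near_ptW xy; rewrite ?leq_maxr// ge_min lexx orbT.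
rewrite (_ : _ - _ = phi x * (psi x - psi y) + (phi x - phi y) * psi y); last by ring.
apply: le_lt_trans (ler_normD _ _) _; rewrite !normrM [ltRHS]splitr; apply: ltrD.
  by apply: le_lt_trans h2; rewrite ler_piMl.
by apply: le_lt_trans h1; rewrite ler_piMr.
Qed.

Lemma nrm_dom u v (c : R) : 0 <= c -> (forall k, sq2 (u k) <= c ^+ 2 * sq2 (v k)) ->
  nrm u <= c * nrm v.
Proof.
move=> c0 uv; apply: nrm_le => [|n]; first by rewrite mulr_ge0 ?nrm_ge0.
rewrite exprMn sqr_nrm; apply: (@le_trans _ _ (c ^+ 2 * qsum n v)).
  by rewrite /qsum mulr_sumr; apply: ler_sum => i _; exact: uv.
by rewrite ler_wpM2l ?sqr_ge0// qsum_le.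
Qed.

Section Multiplier.
(* The Schur multiplier with symbol [S |-> prod_(k in S) h k] is a limit of
   convex combinations of conjugates by diagonal sign unitaries, hence a
   contraction. *)
Variables (T : H -> H) (B : R).
Hypotheses (B0 : 0 <= B) (Tl : linear T) (TB : bnd T B) (TR : inCR T).

Definition sgn1 k := Usg (R := R) (fun i => i == k).

(** Conjugation by [sgn1 k] changes the sign of the coefficients at sets containing [k], so the
    convex combination with weights [(1 + h k) / 2] and [(1 - h k) / 2] multiplies them by [h k]. *)
Fixpoint avg (h : nat -> R) m : H -> H :=
  if m is m'.+1 then
    fun u => (((1 + h m') / 2)%:C) *: avg h m' u +
             (((1 - h m') / 2)%:C) *: sgn1 m' (avg h m' (sgn1 m' u))
  else T.

Definition symbol (h : nat -> R) m S : R := \prod_(k < m) (if tb S k then h k else 1).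

Variable h : nat -> R.
Hypothesis h1 : forall k, -1 <= h k <= 1.

Lemma sgn1_linear k : linear (sgn1 k). Proof. exact: ws_linear. Qed.

Lemma sgn1_Rsh k g u :
  sgn1 k (Rsh g u) = (-1) ^+ chi (fun i => i == k) g *: Rsh g (sgn1 k u).
Proof. exact: Usg_Rsh. Qed.

Lemma avg_props m : [/\ linear (avg h m), bnd (avg h m) B & inCR (avg h m)].
Proof.
elim: m => [|m [al aB aR]] //=; split.
- move=> a u v; rewrite (sgn1_linear _) al al (sgn1_linear _).
  by rewrite !scalerDr !scalerA ![_%:C * a]mulrC addrACA.
- move=> u; have /andP[hm hm'] := h1 m.
  apply: le_trans (nrmD _ _) _; rewrite !nrmZ !sqrt_sq2R.
  rewrite ger0_norm ?[X in _ + X * _]ger0_norm; try lra.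
  have a1 := aB u; have := aB (sgn1 m u); rewrite nrm_ws => a2.
  have -> : B * nrm u = (1 + h m) / 2 * (B * nrm u) + (1 - h m) / 2 * (B * nrm u) by field.
  by rewrite nrm_ws lerD// ler_wpM2l//; lra.
- move=> g u; rewrite aR sgn1_Rsh (linZ _ _ al) aR (linZ _ _ (sgn1_linear m)).
  rewrite sgn1_Rsh signrZK.
  by rewrite (linD _ _ (Rsh_linear _)) !(linZ _ _ (Rsh_linear _)).
Qed.

Lemma avg_vac m S : avg h m vac S = (symbol h m S)%:C * T vac S.
Proof.
elim: m => [|m IHm]; first by rewrite /symbol big_ord0 mul1r.
have s0 : sgn1 m vac = vac by exact: Usg_ket0.
have sE u : sgn1 m u S = (-1) ^+ tb S m * u S by rewrite /sgn1 UsgE chi_single.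
transitivity ((((1 + h m) / 2)%:C *: avg h m vac +
  ((1 - h m) / 2)%:C *: sgn1 m (avg h m (sgn1 m vac))) S); first by [].
have -> : (symbol h m.+1 S)%:C = (symbol h m S)%:C * (if tb S m then h m else 1)%:C.
  by rewrite /symbol big_ord_recr rmorphM.
rewrite l2D !l2Z s0 sE IHm; set P := (symbol h m S)%:C.
have -> : ((1 + h m) / 2)%:C * (P * T vac S) +
    ((1 - h m) / 2)%:C * ((-1) ^+ tb S m * (P * T vac S)) =
    P * (((1 + h m) / 2)%:C + ((1 - h m) / 2)%:C * (-1) ^+ tb S m) * T vac S by ring.
congr (_ * _ * _); case: (tb S m); rewrite ?expr1 ?mulrN1 ?expr0 ?mulr1.
  by rewrite -rmorphB /=; congr (_%:C); field.
by rewrite -rmorphD /=; congr (_%:C); field.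
Qed.

Lemma symbol_le1 m S : `|symbol h m S| <= 1.
Proof.
rewrite normr_prod; apply: prodr_ile1 => k; rewrite normr_ge0 /=.
by case: ifP => _; rewrite ?normr1// ler_norml.
Qed.

Lemma symbol_stable m n S : (S < 2 ^ n)%N -> (n <= m)%N -> symbol h m S = symbol h n S.
Proof.
move=> Sn nm; rewrite /symbol -!(big_mkord xpredT (fun k => if tb S k then h k else 1)).
rewrite (big_cat_nat (n := n))//= [X in _ * X]big_nat_cond.
rewrite [X in _ * X]big1 ?mulr1// => i /andP[/andP[ni _] _].
by rewrite (proj1 (lt_exp2P S n) Sn).
Qed.

(** At sets within the first [n] bits the symbols agree from [m = n] on. Elsewhere they differ by at
    most 2, and the coefficients of [T vac] have a small norm. *)
Lemma avg_cauchy : scauchy (fun m => avg h m vac).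
Proof.
move=> e e0; have [n /(_ n (leqnn n)) nP] := trunc_near (T vac) (divr_gt0 e0 (ltr0n _ 2)).
exists n => m m' nm nm'; apply: le_lt_trans (_ : _ <= 2 * nrm (T vac - trunc n (T vac))) _.
  apply: nrm_dom => // S; rewrite l2B !avg_vac -mulrBl -rmorphB sq2M l2B truncE.
  case: ltnP => Sn.
    by rewrite !(symbol_stable Sn)// subrr /sq2 /= expr0n addr0 mul0r !mulr_ge0// addr_ge0 ?sqr_ge0.
  rewrite subr0 ler_wpM2r ?sq2_ge0// /sq2 /= expr0n addr0.
  rewrite -[leLHS]real_normK ?num_real// lerXn2r ?nnegrE//.
  apply: le_trans (ler_normB _ _) _.
  by rewrite (_ : 2 = 1 + 1)// lerD// symbol_le1.
by move: nP; rewrite ltr_pdivlMr// mulrC.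
Qed.

Lemma multiplier : exists S, [/\ linear S, bnd S B, inCR S &
  forall k, S vac k = (symbol h k k)%:C * T vac k].
Proof.
have [||||S [Sl SB SR SP]] := @strong_limit _ (avg h) B B0.
- by move=> n; have [] := avg_props n.
- by move=> n; have [] := avg_props n.
- by move=> n; have [] := avg_props n.
- exact: avg_cauchy.
exists S; split => // k; apply/subr0_eq/sqrt_sq2_eq0 => e e0.
have [N /(_ (maxn N k) (leq_maxl _ _)) NP] := SP vac e e0.
rewrite -(symbol_stable (ltn_expl k (ltnSn 1)) (leq_maxr N k)) -avg_vac -l2B.
apply: le_trans (abs_coord_le _ _) _; rewrite nrmB; exact: ltW.
Qed.

End Multiplier.

Lemma symbol_sign (s : nat -> bool) (h : nat -> R) n S :
  symbol (fun k => (-1) ^+ s k * h k) n S =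
  (-1) ^+ (\big[addb/false]_(k < n) (tb S k && s k)) * symbol h n S.
Proof.
rewrite /symbol; elim: n => [|n IHn]; first by rewrite !big_ord0 mulr1.
rewrite !big_ord_recr /= IHn signr_addb; case: (tb S n); last by rewrite andFb expr0 !mulr1.
by rewrite andTb; ring.
Qed.

Section Extension.
(* The section through [T] at [p] has as value at [q] the Schur multiple of [T]
   whose symbol takes at [k] the value [h q k], which is odd in the [k]-th row
   of [q] and equal to 1 at [q = p]. *)
Variables (p : K) (T : H -> H) (idx : nat -> nat).
Hypotheses (TCR : CR T) (pidx : forall k, p k (idx k) != 0).

Let h x k : R := clip (x k (idx k) / p k (idx k)).

Let h_bound x k : -1 <= h x k <= 1. Proof. exact: clip_bound. Qed.

Let h_cnt k : real_cont (fun x => h x k).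
Proof.
move=> x Xx e e0; exists k.+1, (e * `|p k (idx k)|).
  by rewrite mulr_gt0// normr_gt0.
move=> y Xy /(_ k (idx k) (ltnSn k)) xy; apply: le_lt_trans (clip_lip _ _) _.
by rewrite -mulrBl normrM normfV ltr_pdivrMr// normr_gt0.
Qed.

Let symbol_cnt n S : real_cont (fun x => symbol (h x) n S).
Proof.
rewrite /symbol; elim: n => [|n IHn].
  by move=> x Xx e e0; exists 0%N, 1 => // y Xy _; rewrite !big_ord0 subrr normr0.
have -> : (fun x => \prod_(k < n.+1) (if tb S k then h x k else 1)) =
    fun x => symbol (h x) n S * (if tb S n then h x n else 1).
  by apply/funext => x; rewrite big_ord_recr.
apply: real_contM => //.
- by move=> x; apply: symbol_le1; exact: h_bound.
- by move=> x; case: ifP => _; rewrite ?normr1// ler_norml h_bound.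
- case: (tb S n); first exact: h_cnt.
  by move=> x Xx e e0; exists 0%N, 1 => // y Xy _; rewrite subrr normr0.
Qed.

Lemma section_through : exists f : M, f p = T.
Proof.
have [/bounded_opP[Tl [B B0 TB]] TR] := TCR.
have [f fP] : {f : K -> H -> H & forall q, [/\ linear (f q), bnd (f q) B, inCR (f q) &
    forall k, f q vac k = (symbol (h q) k k)%:C * T vac k]}.
  apply: (@choice _ _ (fun q S => [/\ linear S, bnd S B, inCR S &
    forall k, S vac k = (symbol (h q) k k)%:C * T vac k])) => q.
  exact: multiplier B0 Tl TB TR _ (h_bound q).
(* Since [clip] is odd, the sign from the representative cancels the one from [Usg], and the formula
   holds at [x] itself. *)
have extE x k : Xset d x -> ext f x k = (symbol (h x) k k)%:C * T vac k.
  move=> Xx; have [_ _ _ fk] := fP (orep_of d x).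
  rewrite /ext UsgE fk mulrA; congr (_ * _).
  rewrite (_ : h (orep_of d x) = fun j => (-1) ^+ sg d x j * h x j); last first.
    apply/funext => j; rewrite /h orep_ofE// /act -mulrA.
    by case: (sg d x j); rewrite ?expr0 ?mul1r// expr1 !mulN1r clipN.
  rewrite symbol_sign rmorphM mulrA rmorph_sign -/(chi (sg d x) k).
  by rewrite -signr_addb addbb mul1r.
have fgood : is_wsec f.
  split.
  - by move=> q; have [] := fP q.
  - by exists B => // q; have [] := fP q.
  - by move=> q; have [] := fP q.
  - apply: l2_cont_near => e e0.
    have [n /(_ n (leqnn n)) nP] := trunc_near (T vac) e0.
    (* Keeping finitely many coefficients is uniformly accurate in [x], because [T] is fixed and the
       symbols are at most 1. *)
    exists (fun x => \sum_(k < 2 ^ n) ((symbol (h x) k k)%:C * T vac k) *: ket R k).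
      elim: (2 ^ n)%N => [|m IHm].
        by apply: (eq_l2_cont _ (l2_cont_cst 0)) => x _; rewrite big_ord0.
      apply: (@eq_l2_cont _ _ (fun x => \sum_(k < m) ((symbol (h x) k k)%:C * T vac k) *: ket R k
        + ((symbol (h x) m m)%:C * T vac m) *: ket R m)).
        by move=> x _; rewrite big_ord_recr.
      apply: l2_contD IHm _ => x Xx r r0.
      have c1 : 0 < Num.sqrt (sq2 (T vac m)) + 1 by rewrite ltr_wpDl// sqrtr_ge0.
      have [N [t t0 NP]] := @symbol_cnt m m x Xx _ (divr_gt0 r0 c1).
      exists N, t => // y Xy /(NP y Xy); rewrite ltr_pdivlMr// => sy.
      rewrite -scalerBl -mulrBl -rmorphB nrmZ nrm_ket mulr1 sq2M sqrtrM ?sq2_ge0//.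
      rewrite sqrt_sq2R; apply: le_lt_trans sy; rewrite ler_wpM2l//.
      by rewrite lerDl.
    move=> x Xx; rewrite -[leRHS]mul1r.
    apply: (@le_trans _ _ (1 * nrm (T vac - trunc n (T vac)))); last first.
      by rewrite !mul1r ltW.
    rewrite (_ : \sum_(k < _) _ = trunc n (ext f x)); last first.
      by rewrite trunc_sum; apply: eq_bigr => k _; rewrite extE.
    apply: nrm_dom => // k; rewrite !l2B !truncE extE//; case: ifP => _.
      by rewrite !subrr expr1n mul1r.
    rewrite !subr0 sq2M ler_wpM2r ?sq2_ge0// /sq2 /= expr0n addr0 expr1n.
    by rewrite -real_normK ?num_real// exprn_ile1// symbol_le1.
exists (WSec fgood); apply: CR_eq (wsec_CR (WSec fgood) p) TCR _.
apply/l2_inj/funext => k; have [_ _ _ /= ->] := fP p.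
rewrite (_ : symbol _ _ _ = 1) ?rmorph1 ?mul1r// /symbol big1// => j _.
by case: ifP => // _; rewrite /h divff// clip1.
Qed.

End Extension.

Theorem fibre_full p T : CR T -> exists f : M, f p = T.
Proof.
move=> TCR; have [idx pidx] : {idx : nat -> nat & forall k, p k (idx k) != 0}.
  apply: (@choice _ _ (fun k i => p k i != 0)) => k.
  by have [i _ pi] := Xset_neq0 k (orep_in p); exists i.
exact: section_through TCR pidx.
Qed.

Definition sec_gns_vec p (f : sec_alg R d) : H := (f : M) p vac.
Definition sec_gns_rep p (f : sec_alg R d) : H -> H := (f : M) p.

(** Left translations take [ket 0] to the basis vectors, and by [fibre_full] each of them is the
    value at [p] of a section. *)
Lemma sec_gns_dense p : dense (range (sec_gns_vec p)).
Proof.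
move=> O [u Ou] Oopen.
have /nbhs_ballP[_ /= /ltcR_gt0[e e0 ->] eO] : nbhs u O by exact: open_nbhs_nbhs.
have [n /(_ n (leqnn n)) un] := trunc_near u e0.
exists (trunc n u); split.
  by apply: eO; rewrite -ball_normE /= l2_norm ltcR.
have [f fE] : exists f : M, f p vac = trunc n u.
  rewrite trunc_sum; elim: (2 ^ n)%N => [|m [f fE]].
    by exists 0; rewrite big_ord0.
  have [g gE] := fibre_full p (@Lsh_CR R m); exists (f + u m *: g).
  by rewrite big_ord_recr /= fE gE Lsh_ket0.
by exists f.
Qed.

Lemma sec_gns_rep_bounded p f : bounded_op (sec_gns_rep p f).
Proof. by case: (wsec_CR f p). Qed.

Lemma sec_gns_inner p (f g : sec_alg R d) :
  inner (sec_gns_vec p f) (sec_gns_vec p g) =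
  @wb_trace R K (sec_bundle R d) p (star g * f).
Proof.
rewrite innerE [RHS](sec_expE ((wsec_star (g : M) : M) * (f : M)) p).
by rewrite ipC [RHS]ipC; congr (_^*); exact: wsec_starP.
Qed.

Definition sec_gns p : gns (@wb_trace R K (sec_bundle R d) p).
Proof.
refine (@GNS R (sec_alg R d) _ (l2 R) (sec_gns_vec p) _ (sec_gns_inner p)
  (sec_gns_dense p) (sec_gns_rep p) (sec_gns_rep_bounded p) _).
- by move=> a f g.
- by [].
Defined.

Lemma sec_fibre p : fiber (sec_gns p) = @CR R.
Proof.
apply/seteqP; split => [_ [f _ <-]|T /(fibre_full p)[f <-]]; first exact: wsec_CR.
by exists f.
Qed.

End FullFibre.

(** * Non-generation *)

Section Levels.
Local Open Scope nat_scope.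
Variable T : nat -> finType.

(** Indices are listed level by level because [common_zero] takes a list sorted by level. *)
Definition levels n m : seq {k : nat & T k} :=
  flatten [seq [seq Tagged T x | x <- enum (T k)] | k <- iota n m].

Lemma mem_levels n m (i : {k : nat & T k}) : n <= tag i < n + m ->
  List.In i (levels n m).
Proof.
have memIn (X : eqType) (x : X) s : x \in s -> List.In x s.
  by elim: s => //= y s IHs; rewrite inE => /orP[/eqP ->|/IHs]; [left|right].
case: i => k x /= km; apply/memIn/flattenP.
exists [seq Tagged T x | x <- enum (T k)]; last by apply: map_f; rewrite mem_enum.
by apply/mapP; exists k => //; rewrite mem_iota.
Qed.

Lemma tag_levelsS n m :
  map tag (levels n m.+1) = nseq #|T n| n ++ map tag (levels n.+1 m).
Proof.
rewrite /levels /= map_cat -map_comp; congr (_ ++ _).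
by rewrite cardT; elim: (enum (T n)) => //= x s ->.
Qed.

Lemma levels_ge n m : all (fun k => n <= k) (map tag (levels n m)).
Proof.
elim: m n => //= m IHm n; rewrite tag_levelsS all_cat all_nseq leqnn orbT /=.
by apply: sub_all (IHm n.+1) => k /ltnW.
Qed.

Lemma sorted_levels n m : sorted leq (map tag (levels n m)).
Proof.
rewrite sorted_pairwise; last exact: leq_trans.
elim: m n => //= m IHm n; rewrite tag_levelsS pairwise_cat IHm andbT.
apply/andP; split.
  apply/allrelP => k l; rewrite mem_nseq => /andP[_ /eqP ->].
  by move=> /(allP (levels_ge n.+1 m)) /ltnW.
rewrite -sorted_pairwise; last exact: leq_trans.
by elim: #|T n| => [//|[//|c] IHc] /=; rewrite leqnn.
Qed.

Lemma count_levels n m k : count_mem k (map tag (levels n m)) <= (n <= k) * #|T k|.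
Proof.
elim: m n => //= m IHm n; rewrite tag_levelsS count_cat count_nseq /=.
have [->|nk] := eqVneq n k.
  rewrite leqnn !mul1n -[leqRHS]addn0 leq_add2l.
  by apply: leq_trans (IHm _) _; rewrite ltnn.
rewrite mul0n; apply: leq_trans (IHm _) _.
by rewrite ltn_neqAle nk.
Qed.

End Levels.

Section NonGeneration.
Variables (R : realType) (d : nat -> nat).
Notation C := R[i].
Notation H := (l2 R).
Notation pt := (nat -> nat -> R).
Notation K := (orbit_rep R d).
Notation M := (wsec R d).
Notation vac := (ket R 0).
Implicit Types (u v w : H) (p q : K) (x y : pt) (T : H -> H).

(** The flip stays in the orbit and changes [sg] at [j] only, so the two vectors differ by one sign
    unitary. *)
Lemma ext_flip (f : K -> H -> H) j x S : Xset d x ->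
  ext f (flip j x) S = (-1) ^+ tb S j * ext f x S.
Proof.
move=> Xx; rewrite /ext !UsgE flip_act mulrA -signr_addb; congr (_ * _ S).
  congr (_ ^+ nat_of_bool _); rewrite -(chi_single j S) -chiD; apply: eq_chi => k.
  by rewrite sg_act// addbC.
by rewrite -{1}(act_orep_of Xx) act_comp orep_of_act.
Qed.

Definition coord (b : bool) (z : C) : R := if b then re z else im z.

Lemma coord_le b z : `|coord b z| <= Num.sqrt (sq2 z).
Proof. by case: b; [exact: abs_re_le|exact: abs_im_le]. Qed.

Lemma coordB b (z t : C) : coord b (z - t) = coord b z - coord b t.
Proof. by case: b; rewrite /coord ?reD ?imD ?reN ?imN. Qed.

Lemma coord_sign b (s : bool) z : coord b ((-1) ^+ s * z) = (-1) ^+ s * coord b z.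
Proof. by rewrite !mulr_sign; case: s => //; case: b; rewrite /coord ?reN ?imN. Qed.

Lemma ext_coord_cnt (f : M) b S : real_cont d (fun x => coord b (ext f x S)).
Proof.
move=> x Xx e e0; have [N [r r0 NP]] := @wsec_cnt _ _ f x Xx e e0.
exists N, r => // y Xy /(NP y Xy); apply: le_lt_trans.
by rewrite -coordB -l2B (le_trans (coord_le _ _))// abs_coord_le.
Qed.

Lemma tb_exp2D k r : (r < 2 ^ k)%N -> tb (2 ^ k + r) k.
Proof.
move=> rk; apply/negPn/negP => /negbTE kS.
suff: (2 ^ k + r < 2 ^ k)%N by rewrite ltnNge leq_addr.
apply/lt_exp2P => i; rewrite leq_eqVlt => /orP[/eqP <- //|]; apply: (lt_exp2P _ _).1.
by rewrite expnS mul2n -addnn ltn_add2l.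
Qed.

Section CommonZero.
Variables (n : nat) (a : 'I_n -> M).
Hypothesis d_ge : forall k, (k * 2 ^ k.+1 <= d k)%N.

(** The sets with maximum [k] are the numbers [2 ^ k + r] with [r < 2 ^ k]. With a choice of section
    and of real or imaginary part there are [n * 2 ^ k.+1] functions, at most [d k] of them when
    [n <= k]. *)
Let idx k : finType := ('I_(2 ^ k) * 'I_n * bool)%type.
Let fun_at (i : {k : nat & idx k}) x : R :=
  let: existT k (r, j, b) := i in coord b (ext (a j) x (2 ^ k + r)%N).

Let level_zero m : exists2 x, Xset d x &
  forall i : {k : nat & idx k}, List.In i (levels idx n m) -> fun_at i x = 0.
Proof.
apply: (@common_zero R d {k : nat & idx k} (fun i => tag i)
  (fun i l => let: existT k (r, _, _) := i in tb (2 ^ k + r)%N l) fun_at).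
- by move=> [k [[r j] b]] x; exact: ext_coord_cnt.
- by move=> [k [[r j] b]] l x Xx; rewrite -coord_sign -ext_flip.
- by move=> [k [[r j] b]] /=; exact: tb_exp2D.
- move=> [k [[r j] b]] l /=; apply: (lt_exp2P _ _).1.
  by rewrite expnS mul2n -addnn ltn_add2l.
- exact: sorted_levels.
- move=> k; apply: leq_trans (count_levels _ _ _ _) _; have [nk|//] := leqP n k.
  rewrite mul1n; apply: leq_trans (d_ge k).
  rewrite !card_prod !card_ord card_bool expnS mulnA [leqRHS]mulnAC.
  by rewrite leq_mul// mulnC leq_mul2r nk orbT.
Qed.

(** Zeros for [m] levels are available for each [m]. Any given coefficient vanishes at all of them
    from some [m] on, hence at a cluster point by continuity. *)
Theorem ext_common_zero : exists2 x, Xset d x &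
  forall j S, (2 ^ n <= S)%N -> ext (a j) x S = 0.
Proof.
have [u uP] := choice (fun m => let: ex_intro2 x Xx x0 := level_zero m in
  ex_intro (fun x => Xset d x /\ forall i : {k : nat & idx k},
    List.In i (levels idx n m) -> fun_at i x = 0) x (conj Xx x0)).
have [x Xx xu] := Xset_cluster (fun m => (uP m).1); exists x => // j S nS.
have S0 : (0 < S)%N by apply: leq_trans nS; rewrite expn_gt0.
have /andP[kS Sk] := trunc_log_bounds (ltnSn 1) S0; set k := trunc_log 2 S in kS Sk.
have rk : (S - 2 ^ k < 2 ^ k)%N.
  by rewrite ltn_subLR// addnn -mul2n -expnS.
have uS m : (S <= m)%N -> ext (a j) (u m) S = 0.
  move=> Sm; have z b : coord b (ext (a j) (u m) S) = 0.
    have /= := (uP m).2 (Tagged idx (Ordinal rk, j, b)); rewrite subnKC//; apply.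
    apply: mem_levels => /=; apply/andP; split.
      by rewrite -ltnS -(ltn_exp2l _ _ (ltnSn 1)) (leq_ltn_trans nS).
    apply: leq_trans (leq_addl _ _); apply: leq_trans Sm; apply: leq_trans kS.
    exact: ltn_expl.
  by apply: complexP; [exact: (z true)|exact: (z false)].
apply: sqrt_sq2_eq0 => e e0; have [N [r r0 NP]] := @wsec_cnt _ _ (a j) x Xx e e0.
have [m Sm xm] := xu N r S r0.
rewrite -[ext _ _ _]subr0 -(uS m Sm) -l2B; apply: le_trans (abs_coord_le _ _) _.
exact/ltW/(NP _ (uP m).1).
Qed.

End CommonZero.

(** It suffices to compare at [ket 0], where the claim is that left and right translation agree on
    [T vac]. The bit [2 n] is taken because its partner [2 n + 1] is not among the first [n] bits;
    the partner of [n] may be [n - 1]. *)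
Lemma CR_finite_support_comm T n : CR T ->
  (forall S, (2 ^ n <= S)%N -> T vac S = 0) ->
  forall u, T (Lsh (bit n.*2) u) = Lsh (bit n.*2) (T u).
Proof.
move=> TCR T0 u; have [_ _ _ compCR _ _] := CR_vna R; have [_ TR] := TCR.
suff /(congr1 (@^~ u)) : T \o Lsh (bit n.*2) = Lsh (bit n.*2) \o T by [].
apply: CR_eq; [exact: compCR (Lsh_CR _ _)|exact: compCR (Lsh_CR _ _) _|].
rewrite /= Lsh_ket0 (inCR_ket _ TR).
have -> : T vac = trunc n (T vac).
  by apply/l2_inj/funext => k; rewrite truncE; case: ltnP => // /T0.
apply/esym/Lsh_Rsh_trunc => k kn.
have -> : bit n.*2 = bit (partner n.*2.+1) by rewrite /partner /= odd_double.
by rewrite omega_bit (proj1 (lt_exp2P k n) kn)// -addnn leqW// leq_addr.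
Qed.

Lemma Lsh_anticomm_bit n : Lsh (bit n.*2.+1) (Lsh (bit n.*2) vac) <>
  Lsh (bit n.*2) (Lsh (bit n.*2.+1) vac).
Proof.
have o : omega (bit n.*2.+1) (bit n.*2).
  have -> : bit n.*2.+1 = bit (partner n.*2) by rewrite /partner odd_double.
  by rewrite omega_bit tb_bit.
rewrite !Lsh_ket0 => /(congr1 (fun v : H => v (xr (bit n.*2.+1) (bit n.*2)))).
rewrite !LshE xrK [xr (bit n.*2.+1) _]xrC xrK !ketE !eqxx !mulr1.
move: o; rewrite /omega; case: (beta _ _); case: (beta _ _) => // _; rewrite expr1 expr0.
  by move=> /esym/eq_opp0/eqP; rewrite oner_eq0.
by move=> /eq_opp0/eqP; rewrite oner_eq0.
Qed.

(** The commutant of the single unitary [Lsh (bit n.*2)] is a von Neumann algebra containing the [n]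
    operators, hence all that they generate. It misses [Lsh (bit n.*2.+1)], which belongs to the
    fiber. *)
Theorem sections_do_not_generate n (a : 'I_n -> sec_bundle R d) :
  (forall k, k * 2 ^ k.+1 <= d k)%N ->
  exists p : K, vna_generated (range (fun i => gns_rep (sec_gns p) (a i))) <>
    fiber (sec_gns p).
Proof.
move=> d_ge; have [x Xx x0] := @ext_common_zero n a d_ge; exists (orep_of d x).
rewrite sec_fibre => gen_all; pose g := bit n.*2.
have [_ /(_ tt vac)] : commutant (fun _ : unit => @Lsh R g) (Lsh (bit n.*2.+1)).
  have : @CR R (Lsh (bit n.*2.+1)) by exact: Lsh_CR.
  rewrite -gen_all; apply.
  split; first apply: commutant_vna => _.
  - exact: ws_linear.
  - by exists ((-1) ^+ beta g g) => u v; rewrite ip_Lsh.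
  move=> _ [i _ <-]; have aCR := wsec_CR (a i : M) (orep_of d x).
  split=> [|_ u]; first by case: aCR.
  apply: (CR_finite_support_comm aCR) => S /(x0 i).
  rewrite /ext UsgE => /eqP; rewrite mulf_eq0 signr_eq0 /= => /eqP; exact.
by exact: Lsh_anticomm_bit.
Qed.

End NonGeneration.

Theorem theorem1p1 (R : realType) :
  exists (K : metricType R) (M : wstarBundle R K)
         (G : forall p : K, gns (@wb_trace R K M p)),
    (forall p : K, II1_factor (fiber (G p)) /\ separable_predual (fiber (G p))) /\
    (forall (n : nat) (a : 'I_n -> M), exists p : K,
       vna_generated (range (fun i => gns_rep (G p) (a i))) <> fiber (G p)).
Proof.
pose d k := (k * 2 ^ k.+1)%N.
exists (orbit_rep R d), (sec_bundle R d), (@sec_gns R d); split=> [p|n a].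
  rewrite sec_fibre; split; first exact: CR_II1.
  by apply: predual_separable => T [].
by apply: sections_do_not_generate => k.
Qed.
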